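(* Let $n \geq 2$. Then \[ \mathbf{R}_{n}^2 \left\|\frac{f}{|x|^2}\right\|_{2}^2 + \widetilde{\mathbf{R}}_{n} \left\|\frac{P^\perp f}{|x|^2}\right\|_{2}^2 \leq \|\Delta f\|_{2}^2 \] holds for all $f \in C^\infty_0(\mathbb{R}^n \setminus \{0\})$.
   Context: $\|\cdot\|_2$ denotes the norm of $L^2(\mathbb{R}^n)$ (Lebesgue measure). $\Delta$ is the standard Laplacian on $\mathbb{R}^n$. $\mathbf{R}_n = \frac{n(n-4)}{4}$ and $\widetilde{\mathbf{R}}_{n} = (n-1)(n-1 + 2\mathbf{R}_{n})$. $P$ is the orthogonal projection of $L^2(\mathbb{R}^n)$ onto radially symmetric functions, given by $Pf(x) = \frac{1}{\sigma(\mathbb{S}^{n-1})} \int_{\mathbb{S}^{n-1}} f(|x|\omega)\, \mathrm{d}\sigma(\omega)$, where $\sigma$ is the surface measure on $\mathbb{S}^{n-1}$, and $P^{\perp}=I-P$. *)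

(* Defs.v *)
From HB Require Import structures.
From mathcomp Require Import all_boot all_order all_algebra.
From mathcomp Require Import complex.
From mathcomp Require Import all_classical all_reals all_analysis.
From mathcomp Require Import measurable_realfun.

Set Implicit Arguments.
Unset Strict Implicit.
Unset Printing Implicit Defensive.
Import Order.TTheory GRing.Theory Num.Theory.
Import numFieldNormedType.Exports.

Local Open Scope classical_set_scope.
Local Open Scope ring_scope.

(* R^n is ['rV[R]_n].  Its sigma-algebra is the one generated by the
   coordinates, i.e. the Borel sets. *)
Section measurable_rV.
Context {R : realType} (n : nat).

Let coord (i : 'I_n) (x : 'rV[R]_n) : R := x ord0 i.

Let rV_set0 : g_sigma_preimage coord set0.
Proof. exact: sigma_algebra0. Qed.

Let rV_setC A : g_sigma_preimage coord A -> g_sigma_preimage coord (~` A).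
Proof. exact: sigma_algebraC. Qed.

Let rV_bigcup (F : _^nat) : (forall i, g_sigma_preimage coord (F i)) ->
  g_sigma_preimage coord (\bigcup_i (F i)).
Proof. exact: sigma_algebra_bigcup. Qed.

HB.instance Definition _ := @isMeasurable.Build default_measure_display
  'rV[R]_n (g_sigma_preimage coord) rV_set0 rV_setC rV_bigcup.

End measurable_rV.

Section measurable_rV_lemmas.
Context {R : realType}.

Lemma measurable_rV_coord n (i : 'I_n) :
  measurable_fun [set: 'rV[R]_n] (fun x => x ord0 i).
Proof.
move=> _ Y mY; rewrite setTI; apply: sub_sigma_algebra => /=.
rewrite -bigcup_seq/=; exists i => /=; first by rewrite mem_index_enum.
by exists Y => //; rewrite setTI.
Qed.

Lemma measurable_fun_rVP d (T : measurableType d) n (f : T -> 'rV[R]_n) :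
  (forall i, measurable_fun [set: T] (fun t => f t ord0 i)) ->
  measurable_fun [set: T] f.
Proof.
move=> mf _ A mA; rewrite setTI.
suff : g_sigma_preimage
    (fun i => (fun x : 'rV[R]_n => x ord0 i) \o f) `<=` measurable.
  by apply; rewrite g_sigma_preimage_comp; exists A => //; rewrite setTI.
apply: smallest_sub; first exact: sigma_algebra_measurable.
case: n => [|n] in f mf A mA *; first by rewrite big_ord0.
rewrite -bigcup_mkord_ord; apply: bigcup_sub => i Ii.
by move=> B [C mC <-]; exact: mf.
Qed.

Definition rV_cons n (p : measurableTypeR R * 'rV[R]_n) : 'rV[R]_n.+1 :=
  @row_mx R 1 1 n (const_mx p.1) p.2.

Definition rV_uncons n (x : 'rV[R]_n.+1) : measurableTypeR R * 'rV[R]_n :=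
  (x ord0 ord0, @rsubmx R 1 1 n x).

Lemma rV_cons0 n p : @rV_cons n p ord0 ord0 = p.1.
Proof.
have -> : ord0 = @lshift 1 n ord0 :> 'I_n.+1 by exact: val_inj.
by apply: etrans (@row_mxEl R 1 1 n _ _ _ _) _; rewrite mxE.
Qed.

Lemma rV_consS n p i : @rV_cons n p ord0 (lift ord0 i) = p.2 ord0 i.
Proof.
have -> : lift ord0 i = @rshift 1 n i by exact: val_inj.
exact: etrans (@row_mxEr R 1 1 n _ _ _ _) _.
Qed.

Lemma rV_consK n : cancel (@rV_cons n) (@rV_uncons n).
Proof.
by move=> p; rewrite /rV_uncons rV_cons0 row_mxKr -surjective_pairing.
Qed.

Lemma rV_unconsK n : cancel (@rV_uncons n) (@rV_cons n).
Proof.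
move=> x; apply: etrans (@hsubmxK R 1 1 n x).
congr (@row_mx R 1 1 n _ _); apply/rowP => j; rewrite !mxE; congr (x _ _).
by apply: val_inj; rewrite /= ord1.
Qed.

Lemma measurable_rV_cons n : measurable_fun setT (@rV_cons n).
Proof.
apply: measurable_fun_rVP => i; case: (unliftP ord0 i) => [j ->|->].
- rewrite (_ : (fun _ => _) = (fun x : 'rV[R]_n => x ord0 j) \o snd).
    exact: measurableT_comp (@measurable_rV_coord n j) measurable_snd.
  by apply/funext => p; rewrite rV_consS.
- rewrite (_ : (fun _ => _) = fst); first exact: measurable_fst.
  by apply/funext => p; rewrite rV_cons0.
Qed.

Lemma measurable_rV_uncons n : measurable_fun setT (@rV_uncons n).
Proof.
apply: measurable_fun_pair; first exact: (@measurable_rV_coord n.+1).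
apply: measurable_fun_rVP => i.
rewrite (_ : (fun _ => _) = fun x : 'rV[R]_n.+1 => x ord0 (@rshift 1 n i)).
  exact: (@measurable_rV_coord n.+1).
by apply/funext => x; rewrite mxE.
Qed.

End measurable_rV_lemmas.
Arguments rV_cons {R n}.
Arguments rV_uncons {R n}.

Section lebesgue_rV.
Context {R : realType}.
Local Open Scope ereal_scope.

Section step.
Context n (mu : {sigma_finite_measure set 'rV[R]_n -> \bar R}).

Definition lebesgue_rVS : set 'rV[R]_n.+1 -> \bar R :=
  pushforward (lebesgue_measure \x mu) rV_cons.

Let mcons (A : set 'rV[R]_n.+1) :
  measurable A -> measurable (rV_cons @^-1` A).
Proof.
by move=> mA; rewrite -[X in measurable X]setTI; exact: measurable_rV_cons.
Qed.

Let lebesgue_rVS0 : lebesgue_rVS set0 = 0.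
Proof. by rewrite /lebesgue_rVS /pushforward preimage_set0 measure0. Qed.

Let lebesgue_rVS_ge0 A : 0 <= lebesgue_rVS A.
Proof. by rewrite /lebesgue_rVS /pushforward measure_ge0. Qed.

Let lebesgue_rVS_sigma_additive : semi_sigma_additive lebesgue_rVS.
Proof.
move=> F mF tF mUF; rewrite /lebesgue_rVS /pushforward preimage_bigcup.
apply: measure_semi_sigma_additive.
- by move=> k; exact: mcons.
- apply/trivIsetP => /= i j _ _ ij; rewrite -preimage_setI.
  by move/trivIsetP : tF => /(_ _ _ _ _ ij) ->//; rewrite preimage_set0.
- by rewrite -preimage_bigcup; exact: mcons.
Qed.

HB.instance Definition _ := isMeasure.Build _ _ _ lebesgue_rVS
  lebesgue_rVS0 lebesgue_rVS_ge0 lebesgue_rVS_sigma_additive.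

Let lebesgue_rVS_sigma_finite : sigma_finite setT lebesgue_rVS.
Proof.
have /sigma_finiteP[F [TF ndF Foo]] := sigma_finiteT (@lebesgue_measure R).
have /sigma_finiteP[G [TG ndG Goo]] := sigma_finiteT mu.
exists (fun k => rV_uncons @^-1` (F k `*` G k)).
  rewrite -preimage_bigcup; apply/seteqP; split => // x _.
  have [i _ Fi] : (\bigcup_i F i) (rV_uncons x).1 by rewrite -TF.
  have [j _ Gj] : (\bigcup_i G i) (rV_uncons x).2 by rewrite -TG.
  exists (maxn i j) => //; split.
  - by move: Fi; exact/subsetPset/ndF/leq_maxl.
  - by move: Gj; exact/subsetPset/ndG/leq_maxr.
move=> k; have [mF Fk] := Foo k; have [mG Gk] := Goo k.
have mFG : measurable (F k `*` G k) by exact: measurableX.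
split; first by rewrite -[X in measurable X]setTI; exact: measurable_rV_uncons.
rewrite /lebesgue_rVS /pushforward -comp_preimage.
rewrite (_ : _ \o _ = id); last by apply/funext => p; exact: rV_consK.
by rewrite /= product_measure1E// lte_mul_pinfty// ge0_fin_numE.
Qed.

HB.instance Definition _ := Measure_isSigmaFinite.Build _ _ _ lebesgue_rVS
  lebesgue_rVS_sigma_finite.

End step.

Fixpoint lebesgue_rV n : {sigma_finite_measure set 'rV[R]_n -> \bar R} :=
  match n with
  | 0 => \d_(0%R : 'rV[R]_0)
  | n'.+1 => lebesgue_rVS (lebesgue_rV n')
  end.

Lemma lebesgue_rV_box n (A : 'I_n -> set R) :
  (forall i, measurable (A i)) ->
  lebesgue_rV n [set x | forall i, A i (x ord0 i)] =
  \prod_(i < n) lebesgue_measure (A i : set (measurableTypeR R)).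
Proof.
elim: n A => [|n IH] A mA.
  by rewrite big_ord0 /= diracE mem_set//= => -[].
have mB : measurable [set x : 'rV[R]_n | forall i, A (lift ord0 i) (x ord0 i)].
  rewrite (_ : [set _ | _] = \bigcap_(i in [set: 'I_n])
      ((fun x : 'rV[R]_n => x ord0 i) @^-1` A (lift ord0 i))).
    apply: fin_bigcap_measurable => // i _.
    by rewrite -[X in measurable X]setTI; exact: measurable_rV_coord.
  by apply/seteqP; split => x /= h i; [move=> _; exact: h|exact: h].
rewrite big_ord_recl -IH//= /lebesgue_rVS /pushforward.
rewrite -product_measure1E//; last exact: mA.
congr (product_measure1 _ _ _).
apply/seteqP; split => -[a v] /=.
  move=> h; split; first by have := h ord0; rewrite rV_cons0.
  by move=> i; have := h (lift ord0 i); rewrite rV_consS.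
move=> [Aa Av] i; case: (unliftP ord0 i) => [j ->|->].
  by rewrite rV_consS; exact: Av.
by rewrite rV_cons0.
Qed.

End lebesgue_rV.

(* The norm of the normed module ['rV[R]_n] is the sup norm, whence this
   definition. *)
Definition enorm (R : realType) n (x : 'rV[R]_n) : R :=
  Num.sqrt (\sum_(i < n) x ord0 i ^+ 2).

Lemma measurable_invr (R : realType) : measurable_fun setT (@GRing.inv R).
Proof.
have -> : [set: R] = [set 0] `|` [set x | x != 0].
  by apply/seteqP; split => x //= _; case: (eqVneq x 0); [left|right].
have mE : measurable [set x : R | x != 0] by apply: open_measurable; exact: open_neq.
apply/measurable_funU => //.
split; first exact: measurable_fun_set1.
apply: open_continuous_measurable_fun; first exact: open_neq.
by move=> x; rewrite inE /= => x0; exact: inv_continuous.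
Qed.

Section surface_measure.
Context {R : realType} (n : nat).

Lemma measurable_enorm : measurable_fun setT (@enorm R n).
Proof.
have mS : measurable_fun setT
    (fun x : 'rV[R]_n => \sum_(i < n) x ord0 i ^+ 2).
  apply: measurable_sum => i; apply: measurable_funX.
  exact: measurable_rV_coord.
have mq : measurable_fun setT (@Num.sqrt R).
  by apply: continuous_measurable_fun; exact: sqrt_continuous.
exact: measurableT_comp mq mS.
Qed.

Definition sphere : set 'rV[R]_n := [set x | enorm x = 1].

Definition punctured_ball : set 'rV[R]_n := [set x | 0 < enorm x <= 1].

Lemma measurable_punctured_ball : measurable punctured_ball.
Proof.
rewrite (_ : punctured_ball = @enorm R n @^-1` `]0, 1]).
  by rewrite -[X in measurable X]setTI; exact: measurable_enorm.
by apply/seteqP; split => x /=; rewrite in_itv.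
Qed.

Definition normalize (x : 'rV[R]_n) : 'rV[R]_n := (enorm x)^-1 *: x.

Lemma measurable_normalize : measurable_fun setT normalize.
Proof.
apply: measurable_fun_rVP => i.
rewrite (_ : (fun _ => _) = (fun x => (enorm x)^-1 * x ord0 i)); last first.
  by apply/funext => x; rewrite mxE.
apply: measurable_funM; last exact: measurable_rV_coord.
exact: measurableT_comp (@measurable_invr R) measurable_enorm.
Qed.

(* Surface measure, as a measure on R^n carried by the sphere, through polar
   coordinates: the surface measure of a Borel set [A] of the unit sphere is
   [n] times the volume of the cone [{r w | 0 < r <= 1, w in A}]. *)
Definition surface_measure : set 'rV[R]_n -> \bar R := fun A =>
  (n%:R%:E * lebesgue_rV n (punctured_ball `&` normalize @^-1` A))%E.

Let mcone A : measurable A -> measurable (punctured_ball `&` normalize @^-1` A).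
Proof.
move=> mA; apply: measurableI; first exact: measurable_punctured_ball.
by rewrite -[X in measurable X]setTI; exact: measurable_normalize.
Qed.

Let surface_measure0 : surface_measure set0 = 0%E.
Proof. by rewrite /surface_measure preimage_set0 setI0 measure0 mule0. Qed.

Let surface_measure_ge0 A : (0 <= surface_measure A)%E.
Proof. by rewrite mule_ge0. Qed.

Let surface_measure_sigma_additive : semi_sigma_additive surface_measure.
Proof.
move=> F mF tF mUF; rewrite /surface_measure preimage_bigcup setI_bigcupr.
apply: (@measure_semi_sigma_additive _ _ _
  (mscale (n%:R%:nng : {nonneg R}) (lebesgue_rV n))
  (fun k => punctured_ball `&` normalize @^-1` F k)).
- by move=> k; exact: mcone.
- apply/trivIsetP => /= i j _ _ ij; rewrite setIACA setIid -preimage_setI.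
  by move/trivIsetP : tF => /(_ _ _ _ _ ij) ->//; rewrite preimage_set0 setI0.
- by rewrite -setI_bigcupr -preimage_bigcup; exact: mcone.
Qed.

HB.instance Definition _ := isMeasure.Build _ _ _ surface_measure
  surface_measure0 surface_measure_ge0 surface_measure_sigma_additive.

End surface_measure.

Arguments sphere {R} n.
Arguments surface_measure {R} n.

Section test_functions.
Context {R : realType} (n : nat).

Definition partials (s : seq 'I_n) (g : 'rV[R]_n -> R) : 'rV[R]_n -> R :=
  foldr (fun i h => 'D_(delta_mx ord0 i) h) g s.

(* [derive] is total, so the existence of each partial derivative has to be
   required besides its continuity. *)
Definition smooth (g : 'rV[R]_n -> R) : Prop :=
  forall s : seq 'I_n, continuous (partials s g) /\
    forall (i : 'I_n) (x : 'rV[R]_n),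
      derivable (partials s g) x (delta_mx ord0 i).

Definition realLaplacian (g : 'rV[R]_n -> R) (x : 'rV[R]_n) : R :=
  \sum_(i < n) partials [:: i; i] g x.

Definition csupport (f : 'rV[R]_n -> R[i]) : set 'rV[R]_n :=
  closure [set x | f x != 0].

(* Functions are complex-valued; an element of C_0^oo(R^n \ {0}) is
   identified with its extension by zero to R^n. *)
Definition test_function_away0 (f : 'rV[R]_n -> R[i]) : Prop :=
  [/\ smooth (fun x => complex.Re (f x)), smooth (fun x => complex.Im (f x)),
      compact (csupport f) & ~ csupport f 0].

Definition Laplacian (f : 'rV[R]_n -> R[i]) (x : 'rV[R]_n) : R[i] :=
  (realLaplacian (fun y => complex.Re (f y)) x
   +i* realLaplacian (fun y => complex.Im (f y)) x)%C.

End test_functions.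

Section radial_projection.
Context {R : realType} (n : nat).

Definition sphere_integral (g : 'rV[R]_n -> R[i]) : R[i] :=
  (\int[surface_measure n]_(w in sphere n) complex.Re (g w)
   +i* \int[surface_measure n]_(w in sphere n) complex.Im (g w))%C.

Definition radial_proj (f : 'rV[R]_n -> R[i]) (x : 'rV[R]_n) : R[i] :=
  ((fine (surface_measure n (sphere n)))^-1)%:C%C
  * sphere_integral (fun w => f (enorm x *: w)).

Definition radial_compl (f : 'rV[R]_n -> R[i]) (x : 'rV[R]_n) : R[i] :=
  f x - radial_proj f x.

Definition L2norm (g : 'rV[R]_n -> R[i]) : \bar R :=
  Lnorm (lebesgue_rV n) 2%:E (fun x => (Normc.normc (g x))%:E).

Definition div_sqnorm (g : 'rV[R]_n -> R[i]) (x : 'rV[R]_n) : R[i] :=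
  g x / (enorm x ^+ 2)%:C%C.

End radial_projection.

Definition rellich_const (R : realType) (n : nat) : R :=
  n%:R * (n%:R - 4) / 4.

Definition rellich_const_compl (R : realType) (n : nat) : R :=
  (n%:R - 1) * (n%:R - 1 + 2 * rellich_const R n).

(* Main.v *)
(* Write E for the Euler field x . grad, Lam for minus the spherical Laplacian, so
   that |x|^2 Delta = E^2 + (n - 2) E - Lam, and B for the inner product of
   L^2 with weight |x|^-4.  The divergence theorem for the fields |x|^-4 g h x
   says that E + (n - 4) / 2 is antisymmetric for B; since E commutes with Lam,
   expanding ||Delta f||^2 = B (|x|^2 Delta f) (|x|^2 Delta f) yields, with R the constant of the
   statement,
     R^2 B f f + 2 R B f (Lam f) + B (Lam f) (Lam f) <= ||Delta f||^2.
   Let u = f - P f.  Radial functions are B-orthogonal to Lam f, whence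
   B u (Lam f) = B f (Lam f) =: D, and the square of Lam f - (n - 1) u gives
   B (Lam f) (Lam f) >= 2 (n - 1) D - (n - 1)^2 B u u.  As n - 1 + R >= 0, it
   remains to use D >= (n - 1) B u u, the Poincare inequality of the sphere.

   The latter is the Gaussian Poincare inequality for the 1-homogeneous
   extension |x| k (x / |x|) of a function k of mean zero on the sphere: its
   gradient has squared norm k^2 + |grad_S k|^2, and the second moment of |x|
   is n.  By tensorization the Gaussian inequality reduces to dimension one,
   where it follows from (h a - h b)^2 <= (a - b) int_b^a h'^2 and from
   E (a - b) 1_(b < t <= a) = gpdf t, for a and b independent normal variables. *)
From HB Require Import structures.
Require Import Defs.
From mathcomp Require Import all_boot all_order all_algebra.
From mathcomp Require Import complex ring lra.
From mathcomp Require Import all_classical all_reals all_analysis.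
From mathcomp Require Import measurable_realfun.

Set Implicit Arguments.
Unset Strict Implicit.
Unset Printing Implicit Defensive.
Import Order.TTheory GRing.Theory Num.Theory.
Import numFieldNormedType.Exports.

Local Open Scope classical_set_scope.
Local Open Scope ring_scope.

(** * Integration on R^n *)

Section measurability.
Context {R : realType}.

(** [rellich_const_compl] equals (R + n - 1)^2 - R^2: the claim puts the constant R^2 on the radial
    part of f and (R + n - 1)^2 on its complement, n - 1 being the least positive eigenvalue of Lam
    on the unit sphere. The obstacle is P f. It is an integral over a sphere, of which only
    measurability, boundedness and support are established, so u = f - P f is never differentiated:
    Lam and the tangential Dirichlet form [T] act on f and on E f, and the Poincare inequality
    bounds B u u by T f f, which is right because P f is constant on every sphere. The degree 1 of
    the homogeneous extension makes the Gaussian inequality sharp here, linear functions being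
    extremal for both inequalities. It reads n avg k^2 <= avg k^2 + avg |grad_S k|^2, hence the
    constant n - 1, whereas degree 0 would only give n - 2. Variances appear as double integrals of
    (F x - F y)^2: all integrands are then nonnegative and Tonelli's theorem applies to them in the
    extended reals. *)

Lemma measurable_rV_box n (A : 'I_n -> set R) :
  (forall i, measurable (A i)) ->
  measurable [set x : 'rV[R]_n | forall i, A i (x ord0 i)].
Proof.
move=> mA; rewrite (_ : [set _ | _] = \bigcap_(i in [set: 'I_n])
    ((fun x : 'rV[R]_n => x ord0 i) @^-1` A i)).
  apply: fin_bigcap_measurable => // i _.
  by rewrite -[X in measurable X]setTI; exact: measurable_rV_coord.
by apply/seteqP; split => x /= h i; [move=> _; exact: h|exact: h].
Qed.

(** Half-open cubes of the grid of mesh 1/(p.1 + 1). The floor makes membership a condition on each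
    coordinate, and the index type is countable. *)
Let cube n (p : nat * 'rV[int]_n) : set 'rV[R]_n :=
  [set x | forall i, [set t : R | Num.floor (p.1.+1%:R * t) = p.2 ord0 i] (x ord0 i)].

Let measurable_cube n p : measurable (@cube n p).
Proof.
apply: (@measurable_rV_box n (fun i => [set t : R | Num.floor (p.1.+1%:R * t) = p.2 ord0 i])) => i.
rewrite (_ : mkset _ = (fun t : R => p.1.+1%:R * t) @^-1`
    `[(p.2 ord0 i)%:~R, (p.2 ord0 i + 1)%:~R[).
  rewrite -[X in measurable X]setTI.
  suff h : measurable_fun setT (fun t : R => p.1.+1%:R * t) by exact: h.
  exact: measurable_funM.
apply/seteqP; split => t /=; rewrite in_itv /=.
  by move=> <-; rewrite floor_itv.
by move=> h; apply: floor_def.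
Qed.

(** The sigma-algebra is generated by the coordinates, not by the open sets. In the sup norm an open
    set is the countable union of the grid cubes that it contains: a cube of mesh below [e] through
    a point stays in the [e]-ball of that point. *)
Lemma open_measurable_rV n (U : set 'rV[R]_n) : open U -> measurable U.
Proof.
move=> oU.
rewrite (_ : U = \bigcup_p (if `[< @cube n p `<=` U >] then cube p else set0)).
  apply: countable_bigcupT_measurable; first exact: countableP.
  by move=> p; case: ifP => // _; exact: measurable_cube.
apply/seteqP; split => x; last by case=> p _; case: asboolP => // pU /pU.
move=> Ux; have /nbhs_ballP[e /= e0 xeU] := oU _ Ux.
have [k ke] : exists k : nat, (k.+1%:R)^-1 < e :> R.
  have /cvgrPdist_lt/(_ e e0) := @cvg_harmonic R.
  move=> [k _ /(_ k (leqnn k))]; rewrite sub0r normrN ger0_norm; last by rewrite /harmonic /= invr_ge0.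
  by exists k.
exists (k, \row_i Num.floor (k.+1%:R * x ord0 i)); first by [].
have -> : `[< cube (k, \row_i Num.floor (k.+1%:R * x ord0 i)) `<=` U >].
  apply/asboolP => y cy; apply: xeU; split => // i j.
  have := cy j; rewrite /= mxE ord1 => fl.
  have k0 : 0 < k.+1%:R :> R by rewrite ltr0n.
  rewrite /ball /= (lt_trans _ ke)// -(ltr_pM2l k0) divff ?gt_eqF//.
  rewrite -{1}(ger0_norm (ltW k0)) -normrM mulrBr.
  have /andP[] := floor_itv (k.+1%:R * x ord0 j).
  have /andP[] := floor_itv (k.+1%:R * y ord0 j).
  rewrite fl !intrD; set z := (Num.floor _)%:~R.
  rewrite (ord1 i) -[1%:~R]/(1 : R) => h1 h2 h3 h4; rewrite ltr_norml; apply/andP; split; lra.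
by move=> i; rewrite /= mxE.
Qed.

Lemma continuous_measurable_rV n (g : 'rV[R]_n -> R) :
  continuous g -> measurable_fun setT g.
Proof.
move=> cg; apply: (measurability _ (RGenOInfty.measurableE R)).
move=> /= _ [_ [x ->] <-]; rewrite setTI.
apply: open_measurable_rV; apply: (@open_comp _ _ g) => [y _|]; first exact: cg.
exact: interval_open.
Qed.

End measurability.

Section tonelli.
Context {R : realType}.
Notation mu := (@lebesgue_rV R).
Notation leb := (@lebesgue_measure R).
Local Open Scope ereal_scope.

Lemma measurable_rV_cons_slice n (F : 'rV[R]_n.+1 -> \bar R) :
  measurable_fun setT F -> measurable_fun setT (F \o rV_cons).
Proof. by move=> mF; apply: measurableT_comp mF (measurable_rV_cons (n := n)). Qed.

Lemma integral_rV_cons n (F : 'rV[R]_n.+1 -> \bar R) :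
  measurable_fun setT F -> (forall x, 0 <= F x) ->
  \int[mu n.+1]_x F x = \int[leb]_t \int[mu n]_y F (rV_cons (t, y)).
Proof.
move=> mF F0; rewrite -(@fubini_tonelli1 _ _ _ _ _ leb (mu n) (F \o rV_cons)) //.
- rewrite (ge0_integral_pushforward (measurable_rV_cons (n := n))
    (leb \x mu n)%E measurableT mF) //.
- exact: measurable_rV_cons_slice.
- by move=> x; exact: F0.
Qed.

Lemma integral_rV0 (F : 'rV[R]_0 -> \bar R) :
  measurable_fun setT F -> \int[mu 0]_x F x = F 0%R.
Proof. by move=> mF; rewrite /= integral_dirac// diracT mul1e. Qed.

(** By uniqueness of Lebesgue measure: its push-forward by the substitution, scaled by [a], has the
    right value on half-open intervals. *)
Lemma integral_affine1 (a b : R) (G : R -> \bar R) : (0 < a)%R ->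
  measurable_fun setT G -> (forall t, 0 <= G t) ->
  \int[leb]_t G t = a%:E * \int[leb]_t G (a * t + b)%R.
Proof.
move=> a0 mG G0.
pose phi : measurableTypeR R -> measurableTypeR R := fun t => (a * t + b)%R.
have mphi : measurable_fun setT phi.
  by apply: measurable_funD => //; exact: measurable_funM.
pose pm : {measure set (measurableTypeR R) -> \bar R} :=
  pushforward leb phi.
pose m : {measure set (measurableTypeR R) -> \bar R} :=
  mscale (NngNum (ltW a0)) (pm mphi).
have mE A : measurable A -> leb A = m A.
  apply: lebesgue_measure_unique => X [[c d] /= cd <-].
  rewrite /m /mscale/= /pushforward.
  have -> : phi @^-1` `]c, d]%classic = `]((c - b) / a)%R, ((d - b) / a)%R]%classic.
    apply/seteqP; split => t /=; rewrite !in_itv /= /phi.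
      by rewrite ltr_pdivrMr// ler_pdivlMr// mulrC ltrBlDr lerBrDr.
    by rewrite ltr_pdivrMr// ler_pdivlMr// mulrC ltrBlDr lerBrDr.
  rewrite !lebesgue_measure_itv/= !lte_fin ltr_pM2r ?invr_gt0// ltrD2r.
  case: ifPn => _; rewrite ?mule0// -!EFinD -EFinM; congr EFin.
  by field; rewrite gt_eqF.
rewrite (eq_measure_integral m)/=; last first.
  by move=> A mA _; exact: mE.
rewrite ge0_integral_mscale//.
by rewrite (ge0_integral_pushforward mphi).
Qed.

Lemma rV_cons_affine n (a t : R) (y : 'rV[R]_n) (b : 'rV[R]_n.+1) :
  (a *: rV_cons (t, y) + b = rV_cons (a * t + b ord0 ord0, a *: y + (rV_uncons b).2))%R.
Proof.
apply/rowP => i; case: (unliftP ord0 i) => [j ->|->]; apply: esym.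
  apply: etrans (rV_consS _ _) _.
  have := rV_consS (t, y) j; move: (rV_cons (t, y)) => v /= vE.
  by rewrite !mxE vE; congr (_ + b _ _)%R; exact: val_inj.
apply: etrans (rV_cons0 _) _.
have := rV_cons0 (t, y); move: (rV_cons (t, y)) => v /= vE.
by rewrite !mxE vE.
Qed.

(** Induction on the dimension by Tonelli, each coordinate contributing one factor [a]. *)
Lemma integral_affine n (a : R) (b : 'rV[R]_n) (G : 'rV[R]_n -> \bar R) :
  (0 < a)%R -> measurable_fun setT G -> (forall x, 0 <= G x) ->
  \int[mu n]_x G x = (a ^+ n)%:E * \int[mu n]_x G (a *: x + b)%R.
Proof.
move=> a0; elim: n b G => [|n IH] b G mG G0.
  rewrite expr0 mul1e; apply: eq_integral => x _; congr G.
  by apply/rowP => -[].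
have maff : measurable_fun setT (fun x : 'rV[R]_n.+1 => a *: x + b)%R.
  apply: measurable_fun_rVP => i.
  rewrite (_ : (fun _ => _) = fun x : 'rV[R]_n.+1 => (a * x ord0 i + b ord0 i)%R).
    by apply: measurable_funD => //; apply: measurable_funM => //;
      exact: measurable_rV_coord.
  by apply/funext => x; rewrite !mxE.
rewrite [in RHS]integral_rV_cons//; last exact: measurableT_comp mG maff.
rewrite integral_rV_cons//.
have mGs : measurable_fun setT (G \o rV_cons) by exact: measurable_rV_cons_slice.
have mK : measurable_fun setT (fun t => \int[mu n]_y G (rV_cons (t, y))).
  apply: (@measurable_fun_fubini_tonelli_F _ _ _ _ _ (mu n) (G \o rV_cons) mGs) => p.
  exact: G0.
have K0 t : 0 <= \int[mu n]_y G (rV_cons (t, y)) by exact: integral_ge0.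
rewrite (integral_affine1 (b ord0 ord0) a0 mK K0).
have sl t : \int[mu n]_y G (rV_cons (a * t + b ord0 ord0, y))%R =
    (a ^+ n)%:E * \int[mu n]_y G (a *: rV_cons (t, y) + b)%R.
  rewrite (IH (rV_uncons b).2 (fun y => G (rV_cons (a * t + b ord0 ord0, y))%R))//.
    by congr (_ * _); apply: eq_integral => y _; rewrite rV_cons_affine.
  exact: measurableT_comp mGs (measurable_pair1 _).
under eq_integral => t _ do rewrite sl.
rewrite ge0_integralZl//.
- by rewrite muleA -EFinM -exprS.
- have mGs' : measurable_fun setT ((fun x => G (a *: x + b)%R) \o rV_cons).
    by apply: measurable_rV_cons_slice; exact: measurableT_comp mG maff.
  apply: (@measurable_fun_fubini_tonelli_F _ _ _ _ _ (mu n) _ mGs') => p.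
  exact: G0.
- by move=> t _; exact: integral_ge0.
- by rewrite lee_fin exprn_ge0// ltW.
Qed.

End tonelli.

(** * Polar coordinates *)

Lemma sum_sqr_ge0 (R : realDomainType) n (x : 'rV[R]_n) :
  0 <= \sum_(i < n) x ord0 i ^+ 2.
Proof. by apply: sumr_ge0 => i _; exact: sqr_ge0. Qed.

Section enorm.
Context {R : realType} {n : nat}.
Implicit Types x : 'rV[R]_n.

Lemma enorm_ge0 x : 0 <= enorm x.
Proof. exact: sqrtr_ge0. Qed.

Lemma enorm_sqr x : enorm x ^+ 2 = \sum_(i < n) x ord0 i ^+ 2.
Proof. by rewrite sqr_sqrtr// sum_sqr_ge0. Qed.

Lemma enorm_eq0 x : (enorm x == 0) = (x == 0).
Proof.
apply/eqP/eqP => [x0|->]; last first.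
  by rewrite /enorm big1 ?sqrtr0// => i _; rewrite mxE expr0n.
apply/rowP => i; rewrite mxE.
have /eqP : \sum_(i < n) x ord0 i ^+ 2 = 0 by rewrite -enorm_sqr x0 expr0n.
rewrite psumr_eq0; last by move=> j _; exact: sqr_ge0.
by move=> /allP/(_ i (mem_index_enum _)); rewrite sqrf_eq0 => /eqP.
Qed.

Lemma enorm_gt0 x : (0 < enorm x) = (x != 0).
Proof. by rewrite lt0r enorm_ge0 andbT enorm_eq0. Qed.

Lemma enormZ (c : R) x : 0 <= c -> enorm (c *: x) = c * enorm x.
Proof.
move=> c0; rewrite /enorm -{2}(ger0_norm c0) -sqrtr_sqr -sqrtrM ?sqr_ge0//.
by rewrite mulr_sumr; congr Num.sqrt; apply: eq_bigr => i _; rewrite mxE exprMn.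
Qed.

Lemma enormV_scale x : x != 0 -> enorm x *: normalize x = x.
Proof.
by move=> x0; rewrite /normalize scalerA divff ?scale1r// gt_eqF// enorm_gt0.
Qed.

Lemma enorm_normalize x : x != 0 -> enorm (normalize x) = 1.
Proof.
move=> x0; rewrite /normalize enormZ ?invr_ge0 ?enorm_ge0//.
by rewrite mulVf// gt_eqF// enorm_gt0.
Qed.

Lemma normalizeZ (c : R) x : 0 < c -> normalize (c *: x) = normalize x.
Proof.
move=> c0; rewrite /normalize enormZ ?ltW// scalerA invfM -mulrA [_ * c]mulrC mulrA.
by rewrite mulVf ?mul1r// gt_eqF.
Qed.

Lemma ler_enorm_coord x i : `|x ord0 i| <= enorm x.
Proof.
rewrite -sqrtr_sqr ler_sqrt ?sum_sqr_ge0// (bigD1 i)//= lerDl.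
by apply: sumr_ge0 => j _; exact: sqr_ge0.
Qed.

End enorm.

Section polar.
Context {R : realType}.
Notation mu := (@lebesgue_rV R).
Notation leb := (@lebesgue_measure R).
Local Open Scope ereal_scope.

Lemma lebesgue_rV_coord0 n (i : 'I_n) (c : R) :
  (2 <= n)%N -> mu n [set x | x ord0 i = c] = 0.
Proof.
move=> n2; pose A j : set R := if j == i then [set c] else setT.
rewrite (_ : [set _ | _] = [set x | forall j, A j (x ord0 j)]); last first.
  apply/seteqP; split => x /= h; last by have := h i; rewrite /A eqxx.
  by move=> j; rewrite /A; case: eqVneq => // ->.
rewrite lebesgue_rV_box; last by move=> j; rewrite /A; case: ifP.
rewrite (bigD1 i)//= {1}/A eqxx.
by rewrite [X in X * _](lebesgue_measure_set1 c) mul0e.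
Qed.

Lemma rV_set1_box n (c : 'rV[R]_n) :
  [set c] = [set x | forall j, [set c ord0 j] (x ord0 j)].
Proof.
apply/seteqP; split => x /= h; first by rewrite h.
by apply/rowP => j; exact: h.
Qed.

Lemma measurable_rV_set1 n (c : 'rV[R]_n) : measurable [set c].
Proof.
rewrite rV_set1_box.
by apply: (@measurable_rV_box _ _ (fun j => [set c ord0 j])) => j; exact: measurable_set1.
Qed.

Lemma lebesgue_rV_point0 n (c : 'rV[R]_n) : (0 < n)%N -> mu n [set c] = 0.
Proof.
case: n c => // n c _; rewrite rV_set1_box.
have mA j : measurable [set c ord0 j] by exact: measurable_set1.
apply: (etrans (lebesgue_rV_box mA)); rewrite (bigD1 ord0)//=.
by rewrite [X in X * _](lebesgue_measure_set1 (c ord0 ord0)) mul0e.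
Qed.

Lemma integral_powerN n (a : R) : (0 < n)%N -> (0 < a)%R ->
  \int[leb]_(s in `[a, +oo[) (n%:R * (s ^+ n.+1)^-1)%:E = ((a ^+ n)^-1)%:E.
Proof.
move=> n0 a0.
have dF x : (a <= x)%R -> is_derive x 1%R (fun s : R => - (s ^+ n)^-1)%R
    (n%:R * (x ^+ n.+1)^-1)%R.
  move=> ax; have x0 : (0 < x)%R by exact: lt_le_trans ax.
  have xn0 : (x ^+ n != 0)%R by rewrite expf_neq0// gt_eqF.
  have h1 := derivableP (@exprn_derivable _ n x (1%R : R)).
  have h := is_deriveN (@is_deriveV _ (fun s => s ^+ n)%R x _ _ xn0 h1).
  apply: is_derive_eq h _.
  rewrite exp_derive /GRing.scale /= mulr1; case: n n0 xn0 {h1} => // m _ xn0.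
  rewrite /= !exprS; field.
  by rewrite expf_neq0 ?gt_eqF// gt_eqF.
rewrite (@ge0_continuous_FTC2y _ _ (fun s => - (s ^+ n)^-1)%R a 0%R).
- by rewrite -EFinB sub0r opprK.
- move=> x ax; apply: mulr_ge0; rewrite ?ler0n// invr_ge0 exprn_ge0//.
  exact: le_trans (ltW a0) ax.
- apply/continuous_within_itvcyP; split.
    move=> x; rewrite in_itv/= andbT => ax.
    have x0 : (0 < x)%R by exact: lt_trans ax.
    apply: cvgM; first exact: cvg_cst.
    apply: cvgV; first by rewrite expf_neq0// gt_eqF.
    exact: exprn_continuous.
  apply: cvgM; first exact: cvg_cst.
  apply: cvgV; first by rewrite expf_neq0// gt_eqF.
  by apply: cvg_at_right_filter; exact: exprn_continuous.
- rewrite -oppr0; apply: cvgN; apply/gtr0_cvgV0.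
    by near=> s; rewrite exprn_gt0.
  apply: (@ger_cvgy _ _ _ _ id) => //.
  by near=> s; rewrite ler_eXnr.
- by move=> x ax; have [] := dF x (ltW ax).
- apply: cvg_at_right_filter.
  have [d _] := dF a (lexx a).
  by have /derivable1_diffP/differentiable_continuous := d; apply.
- move=> x; rewrite in_itv/= andbT => ax.
  by rewrite derive1E; have [_] := dF x (ltW ax).
Unshelve. all: by end_near. Qed.

Lemma measurable_scale_pair n : measurable_fun setT
  (fun p : measurableTypeR R * 'rV[R]_n => p.1 *: p.2)%R.
Proof.
apply: measurable_fun_rVP => i.
rewrite (_ : (fun _ => _) = fun p : measurableTypeR R * 'rV[R]_n => (p.1 * p.2 ord0 i)%R).
  by apply: measurable_funM; [exact: measurable_fst|
    exact: measurableT_comp (@measurable_rV_coord R n i) measurable_snd].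
by apply/funext => p; rewrite mxE.
Qed.

Section polar_proof.
Variables (n : nat) (F : 'rV[R]_n.+1 -> \bar R).
Hypotheses (mF : measurable_fun setT F) (F0 : forall x, 0 <= F x).

Let T := (measurableTypeR R * 'rV[R]_n.+1)%type.

(* [K1] and [K2] have the same integral by [r = s * enorm y] in the first
   variable, [K2] and [K3] by [z = s *: y] in the second, and integrating [K3]
   over [s] first gives [F z]. *)
Let K1 (p : T) : \bar R := if ((0 < p.1) && (0 < enorm p.2 <= 1))%R
  then (n.+1%:R * p.1 ^+ n)%:E * F (p.1 *: normalize p.2)%R else 0.
Let K2 (p : T) : \bar R := if ((0 < p.1) && (0 < enorm p.2 <= 1))%R
  then (n.+1%:R * p.1 ^+ n * enorm p.2 ^+ n.+1)%:E * F (p.1 *: p.2)%R else 0.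
Let K3 (p : T) : \bar R := if ((0 < p.1) && (0 < enorm p.2 <= p.1))%R
  then (n.+1%:R * (p.1 ^+ n.+2)^-1 * enorm p.2 ^+ n.+1)%:E * F p.2 else 0.

Let m1 : measurable_fun setT (fun p : T => p.1).
Proof. exact: measurable_fst. Qed.
Let m2 : measurable_fun setT (fun p : T => enorm p.2).
Proof. exact: measurableT_comp (@measurable_enorm R n.+1) measurable_snd. Qed.
Let mscal : measurable_fun setT (fun p : T => p.1 *: p.2)%R.
Proof. exact: measurable_scale_pair. Qed.

Let mK1 : measurable_fun setT K1.
Proof.
apply: measurable_fun_ifT => //.
  apply: measurable_and; first by apply: measurable_fun_ltr.
  by apply: measurable_and; [exact: measurable_fun_ltr|exact: measurable_fun_ler].
apply: emeasurable_funM.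
  by apply/measurable_EFinP; apply: measurable_funM => //; exact: measurable_funX.
apply: measurableT_comp mF _.
apply: (@measurableT_comp _ _ _ _ _ _ (fun p : T => p.1 *: p.2)%R _
  (fun p : T => (p.1, normalize p.2))) => //.
apply: measurable_fun_pair => //.
exact: measurableT_comp (@measurable_normalize R n.+1) measurable_snd.
Qed.

Let mK2 : measurable_fun setT K2.
Proof.
apply: measurable_fun_ifT => //.
  apply: measurable_and; first by apply: measurable_fun_ltr.
  by apply: measurable_and; [exact: measurable_fun_ltr|exact: measurable_fun_ler].
apply: emeasurable_funM.
  apply/measurable_EFinP; apply: measurable_funM; last exact: measurable_funX.
  by apply: measurable_funM => //; exact: measurable_funX.
exact: measurableT_comp mF mscal.
Qed.

Let mK3 : measurable_fun setT K3.
Proof.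
apply: measurable_fun_ifT => //.
  apply: measurable_and; first by apply: measurable_fun_ltr.
  by apply: measurable_and; [exact: measurable_fun_ltr|exact: measurable_fun_ler].
apply: emeasurable_funM.
  apply/measurable_EFinP; apply: measurable_funM; last exact: measurable_funX.
  apply: measurable_funM => //.
  by apply: measurableT_comp (@measurable_invr R) _; exact: measurable_funX.
exact: measurableT_comp mF measurable_snd.
Qed.

Let K10 p : 0 <= K1 p.
Proof.
rewrite /K1; case: ifPn => // /andP[r0 _].
by rewrite mule_ge0// lee_fin mulr_ge0// exprn_ge0// ltW.
Qed.

Let K20 p : 0 <= K2 p.
Proof.
rewrite /K2; case: ifPn => // /andP[r0 /andP[e0 _]].
by rewrite mule_ge0// lee_fin !mulr_ge0// exprn_ge0// ltW.
Qed.

Let K30 p : 0 <= K3 p.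
Proof.
rewrite /K3; case: ifPn => // /andP[r0 /andP[e0 _]].
by rewrite mule_ge0// lee_fin !mulr_ge0// ?invr_ge0 exprn_ge0// ltW.
Qed.

Let K12 y : \int[leb]_r K1 (r, y) = \int[leb]_r K2 (r, y).
Proof.
have [yB|yB] := boolP (0 < enorm y <= 1)%R; last first.
  by apply: eq_integral => r _; rewrite /K1 /K2 /= (negbTE yB) andbF.
have y0 : (0 < enorm y)%R by case/andP: yB.
have mK1y : measurable_fun setT (fun r => K1 (r, y)).
  exact: measurableT_comp mK1 (measurable_pair2 _).
rewrite (integral_affine1 0%R y0 mK1y)//.
rewrite -ge0_integralZl//; last 2 first.
  - by apply: (measurableT_comp mK1y); apply: measurable_funD.
  - by rewrite lee_fin ltW.
apply: eq_integral => r _; rewrite /K1 /K2 /= yB !andbT addr0 pmulr_rgt0//.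
case: ifPn => r0; last by rewrite mule0.
rewrite muleA -EFinM; congr (_%:E * F _); first by rewrite exprMn exprS; ring.
by rewrite [(enorm y * r)%R]mulrC -scalerA enormV_scale// -enorm_gt0.
Qed.

Let K23 s : \int[mu n.+1]_y K2 (s, y) = \int[mu n.+1]_y K3 (s, y).
Proof.
have [s0|s0] := boolP (0 < s)%R; last first.
  by apply: eq_integral => y _; rewrite /K2 /K3 /= (negbTE s0).
have mK3s : measurable_fun setT (fun y => K3 (s, y)).
  exact: measurableT_comp mK3 (measurable_pair1 _).
rewrite [RHS](integral_affine (n := n.+1) 0%R s0 mK3s)//.
rewrite -ge0_integralZl//; last 2 first.
  - apply: (measurableT_comp mK3s); apply: measurable_fun_rVP => i.
    rewrite (_ : (fun _ => _) = fun x : 'rV[R]_n.+1 => (s * x ord0 i)%R).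
      by apply: measurable_funM => //; exact: measurable_rV_coord.
    by apply/funext => x; rewrite !mxE addr0.
  - by rewrite lee_fin exprn_ge0// ltW.
apply: eq_integral => y _; rewrite /K2 /K3 /= s0 addr0 enormZ; last exact: ltW.
rewrite pmulr_rgt0// (_ : (s * enorm y <= s) = (enorm y <= 1))%R; last first.
  by rewrite -{2}(mulr1 s) ler_pM2l.
case: ifPn => _; last by rewrite mule0.
rewrite muleA -EFinM; congr (_%:E * F _).
by rewrite !exprMn !exprS; field; rewrite expf_neq0 ?gt_eqF.
Qed.

Let K3F z : z != 0%R -> \int[leb]_s K3 (s, z) = F z.
Proof.
rewrite -enorm_gt0 => z0.
transitivity (\int[leb]_(s in `[enorm z, +oo[)
    ((enorm z ^+ n.+1)%:E * F z * (n.+1%:R * (s ^+ n.+2)^-1)%:E)).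
  rewrite [RHS]integral_mkcond; apply: eq_integral => s _.
  rewrite patchE /K3 /= z0 /= mem_setE in_itv /= andbT.
  have [sz|sz] := leP (enorm z) s; last by rewrite andbF.
  rewrite (lt_le_trans z0 sz) /= muleAC; congr (_ * _).
  by rewrite -EFinM mulrC.
rewrite ge0_integralZl//.
- rewrite integral_powerN// muleAC -EFinM divff ?mul1e//.
  by rewrite expf_neq0// gt_eqF.
- apply: measurable_funTS; apply/measurable_EFinP; apply: measurable_funM => //.
  by apply: measurableT_comp (@measurable_invr R) _; exact: measurable_funX.
- move=> s; rewrite /= in_itv/= andbT => zs.
  rewrite lee_fin mulr_ge0// invr_ge0 exprn_ge0//.
  exact: le_trans (ltW z0) zs.
- by rewrite mule_ge0// lee_fin exprn_ge0// ltW.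
Qed.

(** The sphere is replaced by the punctured unit ball seen through [normalize]: the integral of a
    0-homogeneous function over the ball is 1/(dimension) times its integral over the sphere, so
    Lebesgue measure alone carries the polar coordinates. *)
Lemma integral_polar_succ :
  \int[mu n.+1]_x F x = \int[leb]_(r in `]0%R, +oo[)
    ((n.+1%:R * r ^+ n)%:E *
     \int[mu n.+1]_(y in @punctured_ball R n.+1) F (r *: normalize y)%R).
Proof.
transitivity (\int[leb]_r \int[mu n.+1]_y K1 (r, y)); last first.
  rewrite [RHS]integral_mkcond; apply: eq_integral => r _.
  rewrite patchE mem_setE in_itv /= andbT.
  case: ifPn => r0; last first.
    by rewrite integral0_eq// => y _; rewrite /K1 /= (negbTE r0).
  rewrite -ge0_integralZl//.
  - rewrite [RHS]integral_mkcond; apply: eq_integral => y _.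
    by rewrite patchE /K1 /= r0 mem_setE.
  - exact: measurable_punctured_ball.
  - apply: measurable_funTS; apply: (measurableT_comp mF).
    apply: (@measurableT_comp _ _ _ _ _ _ (fun p : T => p.1 *: p.2)%R _
      (fun y => (r, normalize y))) => //.
    by apply: measurable_fun_pair => //; exact: measurable_normalize.
  - by rewrite lee_fin mulr_ge0// exprn_ge0// ltW.
rewrite (@fubini_tonelli _ _ _ _ _ leb (mu n.+1) K1)//.
transitivity (\int[mu n.+1]_y \int[leb]_r K2 (r, y)); last first.
  by apply: eq_integral => y _; rewrite -K12.
rewrite -(@fubini_tonelli _ _ _ _ _ leb (mu n.+1) K2)//.
transitivity (\int[leb]_s \int[mu n.+1]_z K3 (s, z)); last first.
  by apply: eq_integral => s _; rewrite -K23.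
rewrite (@fubini_tonelli _ _ _ _ _ leb (mu n.+1) K3)//.
(* [K3F] recovers [F z] except at the origin, where [K3] vanishes; a point is a null set. *)
apply: ae_eq_integral => //.
  exact: (@measurable_fun_fubini_tonelli_G _ _ _ _ _ leb K3 mK3 K30).
exists [set 0%R]; split.
- exact: measurable_rV_set1.
- exact: lebesgue_rV_point0.
- move=> z /=; apply: contra_notP => /eqP z0 _.
  by rewrite K3F.
Qed.

End polar_proof.

Lemma integral_polar n (F : 'rV[R]_n -> \bar R) : (0 < n)%N ->
  measurable_fun setT F -> (forall x, 0 <= F x) ->
  \int[mu n]_x F x = \int[leb]_(r in `]0%R, +oo[)
    ((n%:R * r ^+ n.-1)%:E *
     \int[mu n]_(y in @punctured_ball R n) F (r *: normalize y)%R).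
Proof. by case: n F => // n F _ mF F0; exact: integral_polar_succ. Qed.

End polar.
(** * Integration by parts *)

Section continuous_at.
Context {R : realType} {T : topologicalType}.
Implicit Types (f g : T -> R) (x : T).

Lemma continuous_at_add f g x : {for x, continuous f} -> {for x, continuous g} ->
  {for x, continuous (fun y => f y + g y)}.
Proof. exact: continuousD. Qed.

Lemma continuous_at_sub f g x : {for x, continuous f} -> {for x, continuous g} ->
  {for x, continuous (fun y => f y - g y)}.
Proof. exact: continuousB. Qed.

Lemma continuous_at_mul f g x : {for x, continuous f} -> {for x, continuous g} ->
  {for x, continuous (fun y => f y * g y)}.
Proof. exact: continuousM. Qed.

Lemma continuous_at_inv f x : f x != 0 -> {for x, continuous f} ->
  {for x, continuous (fun y => (f y)^-1)}.
Proof. exact: continuousV. Qed.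

Lemma continuous_at_sum n (F : 'I_n -> T -> R) x :
  (forall i, {for x, continuous (F i)}) ->
  {for x, continuous (fun y => \sum_(i < n) F i y)}.
Proof.
elim: n F => [|n IH] F cF.
  rewrite (_ : (fun y => _) = cst 0); first exact: cst_continuous.
  by apply/funext => y; rewrite big_ord0.
rewrite (_ : (fun y => _) = fun y =>
    \sum_(i < n) F (widen_ord (leqnSn n) i) y + F ord_max y).
  by apply: continuous_at_add => //; exact: IH.
by apply/funext => y; rewrite big_ord_recr.
Qed.

End continuous_at.

Section integrable_support.
Context {R : realType} {n : nat}.
Notation V := 'rV[R]_n.
Notation mu := (@lebesgue_rV R n).

Lemma enorm_continuous : continuous (@enorm R n).
Proof.
move=> x; apply: (@continuous_comp _ _ _ (fun x : V => \sum_(i < n) x ord0 i ^+ 2) Num.sqrt).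
  apply: continuous_big => [y|i _ y]; first exact: add_continuous.
  apply: (@continuous_comp _ _ _ (fun z : V => z ord0 i) (fun t : R => t ^+ 2)).
    exact: coord_continuous.
  exact: exprn_continuous.
exact: sqrt_continuous.
Qed.

Lemma lebesgue_rV_cube_fin (b : R) :
  (mu [set x | forall i, `[(- b)%R, b]%classic (x ord0 i)] < +oo)%E.
Proof.
rewrite (@lebesgue_rV_box _ _ (fun i => `[- b, b]%classic)); last first.
  by move=> i; exact: measurable_itv.
rewrite (eq_bigr (fun=> (if - b < b then b - - b else 0)%:E)) ?prodEFin ?ltry//.
by move=> i _; rewrite lebesgue_measure_itv/= lte_fin; case: ifP.
Qed.

Lemma bounded_support_integrable (M b : R) (g : V -> R) :
  measurable_fun setT g -> (forall x, `|g x| <= M) ->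
  (forall x i, g x != 0 -> `|x ord0 i| <= b) -> mu.-integrable setT (EFin \o g).
Proof.
move=> mg gM gb.
pose C := [set x : V | forall i, `[- b, b]%classic (x ord0 i)].
have mC : measurable C.
  by apply: (@measurable_rV_box _ _ (fun i => `[- b, b]%classic)) => i; exact: measurable_itv.
apply: (@le_integrable _ _ _ _ _ _ _ (fun x => (M * \1_C x)%:E)) => //.
- by apply/measurable_EFinP.
- move=> x _ /=; rewrite lee_fin.
  have [gx|gx] := eqVneq (g x) 0; first by rewrite gx normr0 normr_ge0.
  have Cx : C x.
    by move=> i; rewrite /= in_itv /= -ler_norml; exact: gb.
  by rewrite indicE mem_set// mulr1 (le_trans (gM x))// ler_norm.
- apply/integrableP; split.
    by apply/measurable_EFinP; apply: measurable_funM => //; exact: measurable_indic.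
  under eq_integral do rewrite EFinM abseM.
  rewrite ge0_integralZl//; last first.
    by do 2 apply: measurableT_comp => //; exact: measurable_indic.
  apply: lte_mul_pinfty => //.
  rewrite (eq_integral (fun x => (\1_C x)%:E)); last first.
    by move=> x _; rewrite gee0_abs// lee_fin.
  by rewrite integral_indic// setIT; exact: lebesgue_rV_cube_fin.
Qed.

(** Stands for compact support in the complement of the origin: the upper bound gives integrability,
    the lower one keeps weights such as |x|^-4 harmless. It says nothing about regularity, so that
    radial averages qualify. *)
Definition annular (g : V -> R) :=
  exists ab : R * R, 0 < ab.1 /\ forall x, g x != 0 -> ab.1 <= enorm x <= ab.2.

Lemma annular_continuous_bounded (g : V -> R) : continuous g -> annular g ->
  exists M, forall x, `|g x| <= M.
Proof.
move=> cg [[a b] /= [a0 gab]].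
pose C := [set x : V | enorm x <= b].
have [C0|C0] := pselect (C !=set0); last first.
  exists 0 => x; have [->|/gab/andP[_ xb]] := eqVneq (g x) 0; first by rewrite normr0.
  by exfalso; apply: C0; exists x.
have kC : compact C.
  apply: bounded_closed_compact; last first.
    apply: (@closed_comp _ _ (@enorm R n) [set t | t <= b]); last exact: closed_le.
    by move=> x _; exact: enorm_continuous.
  exists b; split; first exact: num_real.
  move=> M bM x /= xb; rewrite /Num.norm/= mx_normrE.
  apply: bigmax_le => [|[i j] _]; last first.
    by rewrite (ord1 i) (le_trans (ler_enorm_coord x j))// (le_trans xb)// ltW.
  by rewrite (le_trans (enorm_ge0 x))// (le_trans xb)// ltW.
have [c _ cmax] := @EVT_max_rV _ _ (fun x => `|g x|) C C0 kC
  (continuous_subspaceT (fun x => continuous_comp (cg x) (@norm_continuous _ _ _))).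
exists `|g c| => x; have [->|/gab/andP[_ xb]] := eqVneq (g x) 0; first by rewrite normr0.
by apply: cmax; rewrite inE.
Qed.

Lemma annular_integrable (g : V -> R) : continuous g -> annular g ->
  mu.-integrable setT (EFin \o g).
Proof.
move=> cg ag; have [M gM] := annular_continuous_bounded cg ag.
have [[a b] /= [a0 gab]] := ag.
apply: (@bounded_support_integrable M b) => //; first exact: continuous_measurable_rV.
by move=> x i /gab /andP[_]; apply: le_trans; exact: ler_enorm_coord.
Qed.

Lemma integral_shift (b : V) (f : V -> \bar R) : measurable_fun setT f ->
  (\int[mu]_x f x = \int[mu]_x f (x + b)%R)%E.
Proof.
move=> mf; rewrite [LHS]integralE [RHS]integralE.
have sh (h : V -> \bar R) : measurable_fun setT h -> (forall x, 0 <= h x)%E ->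
    (\int[mu]_x h x = \int[mu]_x h (x + b)%R)%E.
  move=> mh h0; rewrite (integral_affine b ltr01 mh h0) expr1n mul1e.
  by apply: eq_integral => x _; rewrite scale1r.
congr (_ - _)%E.
  apply: etrans (sh f^\+%E (measurable_funepos mf) (funepos_ge0 f)) _.
  by apply: eq_integral => x _; rewrite !funeposE.
apply: etrans (sh f^\-%E (measurable_funeneg mf) (funeneg_ge0 f)) _.
by apply: eq_integral => x _; rewrite !funenegE.
Qed.

Lemma is_derive_line (g : V -> R) (x v : V) (s : R) :
  derivable g (x + s *: v) v ->
  is_derive s 1 (fun t : R => g (x + t *: v)) ('D_v g (x + s *: v)).
Proof.
move=> dg.
have E : (fun h : R => h^-1 *: (((fun t : R => g (x + t *: v)) \o shift s) (h *: 1) -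
            g (x + s *: v))) =
    (fun h : R => h^-1 *: ((g \o shift (x + s *: v)) (h *: v) - g (x + s *: v))).
  apply/funext => h /=; congr (_ *: (g _ - _)).
  by rewrite (_ : h *: (1 : R) = h) ?scalerDl 1?addrCA//; exact: mulr1.
by split; rewrite /derivable /derive E.
Qed.

(** The complement of the closed shell is open and [g] vanishes on it, hence so do its derivatives;
    the same radii serve. *)
Lemma annular_derive (g : V -> R) (v : V) : annular g -> annular ('D_v g).
Proof.
move=> [[a b] /= [a0 gab]]; exists (a, b); split => // x Dx /=.
apply: contraT => xab; move/negP: Dx; case; apply/eqP.
rewrite (@near_eq_derive _ _ _ _ (cst 0)); first exact: derive_cst.
pose U := [set y : V | enorm y < a \/ b < enorm y].
have oU : open U.
  apply: openU.
    apply: (@open_comp _ _ (@enorm R n) [set t | t < a]); last exact: open_lt.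
    by move=> y _; exact: enorm_continuous.
  apply: (@open_comp _ _ (@enorm R n) [set t | b < t]); last exact: open_gt.
  by move=> y _; exact: enorm_continuous.
have Ux : U x by move: xab; rewrite negb_and -!ltNge => /orP.
near=> y; have : U y by near: y; exact: open_nbhs_nbhs.
move=> Uy; apply/eqP; apply: contraT => /gab /andP[ay yb].
by case: Uy; rewrite ltNge ?ay ?yb.
Unshelve. all: by end_near. Qed.

Lemma continuous_shift_rV (b : V) : continuous (fun x : V => x + b).
Proof.
move=> x; apply: (@continuousD _ _ _ id (cst b)); [exact: id|exact: cst_continuous].
Qed.

Lemma continuous_line_rV (x v : V) : continuous (fun s : R => x + s *: v).
Proof.
move=> s.
exact: (continuousD (@cst_continuous _ _ x s) (@scalel_continuous _ _ v s)).
Qed.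

Lemma derivable_seq_cvg (g : V -> R) (x v : V) (t : R^nat) :
  derivable g x v -> (forall k, t k != 0) -> t k @[k --> \oo] --> 0 ->
  ((t k)^-1 * (g (x + t k *: v) - g x)) @[k --> \oo] --> 'D_v g x.
Proof.
move=> dg t0 tc; pose q (h : R) : R := h^-1 *: ((g \o shift x) (h *: v) - g x).
have qc : q h @[h --> 0^'] --> 'D_v g x by exact: dg.
have := (cvgr_dnbhsP q 0 ('D_v g x)).1 qc t (conj t0 tc).
apply: cvg_trans; apply: near_eq_cvg; near=> k.
by rewrite /q /= [x + _]addrC.
Unshelve. all: by end_near. Qed.

Section difference_quotient.
Variables (g : V -> R) (v : V).
Hypotheses (ag : annular g) (cg : continuous g).
Hypotheses (dg : forall x, derivable g x v) (cDg : continuous ('D_v g)).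

Let t k : R := k.+1%:R^-1.
Let t0 k : 0 < t k. Proof. by rewrite invr_gt0. Qed.
Let t1 k : t k <= 1. Proof. by rewrite invf_le1// ler1n. Qed.
Let tc : t k @[k --> \oo] --> 0. Proof. exact: cvg_harmonic. Qed.

Let F k x := (t k)^-1 * (g (x + t k *: v) - g x).

Let cgs k : continuous (fun x : V => g (x + t k *: v)).
Proof.
by move=> x; apply: (continuous_comp (@continuous_shift_rV (t k *: v) x)); exact: cg.
Qed.

Let cF k : continuous (F k).
Proof.
move=> x; exact: (continuous_at_mul (@cst_continuous _ _ (t k)^-1 x)
  (continuous_at_sub (@cgs k x) (@cg x))).
Qed.

Let shift_bound (a b : R) (k : nat) (x : V) (i : 'I_n) :
  (forall x, g x != 0 -> a <= enorm x <= b) ->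
  g (x + t k *: v) != 0 -> `|x ord0 i| <= b + enorm v.
Proof.
move=> gab /gab/andP[_ xb].
rewrite -[x ord0 i](addrK (t k * v ord0 i)) (le_trans (ler_normB _ _))// lerD//.
  by rewrite (le_trans _ xb)// (le_trans _ (ler_enorm_coord _ i))// !mxE.
rewrite normrM (ger0_norm (ltW (t0 k))) (le_trans _ (ler_enorm_coord _ i))//.
by rewrite ler_piMl.
Qed.

Let igs k : mu.-integrable setT (EFin \o (fun x => g (x + t k *: v))).
Proof.
have [M gM] := annular_continuous_bounded cg ag.
have [[a b] /= [_ gab]] := ag.
apply: (@bounded_support_integrable M (b + enorm v)) => //.
  exact: continuous_measurable_rV.
by move=> x i; exact: shift_bound gab.
Qed.

Let IF0 k : (\int[mu]_x (F k x)%:E = 0)%E.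
Proof.
have ig := annular_integrable cg ag.
rewrite /F; under eq_integral do rewrite EFinM EFinB.
rewrite integralZl//; last exact: (integrableB measurableT (igs k) ig).
rewrite (integralB measurableT (igs k) ig).
have mg : measurable_fun setT (EFin \o g).
  by apply/measurable_EFinP; exact: continuous_measurable_rV.
rewrite -[X in (_ * (X - _))%E](integral_shift (t k *: v) mg).
rewrite subee ?mule0//.
exact: integrable_fin_num.
Qed.

(** Mean value theorem on the segment from [x] to [x + t k *: v]. The bound is uniform in [k] and
    will dominate the quotients. *)
Let FM M k x : (forall x, `|'D_v g x| <= M) -> `|F k x| <= M.
Proof.
move=> DM.
have [||c _] := @MVT_segment R (fun s => g (x + s *: v)) (fun s => 'D_v g (x + s *: v)) 0 (t k) (ltW (t0 k)).
- by move=> s _; exact: is_derive_line.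
- apply: continuous_subspaceT => s.
  by apply: (continuous_comp (@continuous_line_rV x v s)); exact: cg.
rewrite scale0r addr0 subr0 /F => ->.
by rewrite mulrC mulfK ?gt_eqF.
Qed.

(* The integral of a difference quotient vanishes by translation invariance. *)
Lemma integral_derive0 : \int[mu]_x 'D_v g x = 0.
Proof.
have [M DM] := annular_continuous_bounded cDg (annular_derive v ag).
have M0 : 0 <= M by rewrite (le_trans _ (DM 0)).
have [[a b] /= [a0 gab]] := ag.
have Fb k x i : F k x != 0 -> `|x ord0 i| <= b + enorm v.
  have [gx|/gab/andP[_ xb] _] := eqVneq (g x) 0; last first.
    by rewrite (le_trans (ler_enorm_coord _ _))// (le_trans xb)// lerDl enorm_ge0.
  rewrite /F gx subr0 mulf_eq0 negb_or => /andP[_].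
  exact: shift_bound gab.
(* As [t k <= 1], the translations move the support by at most [enorm v], so one cube carries all
   the difference quotients. *)
pose C := [set x : V | forall i, `[(- (b + enorm v))%R, b + enorm v]%classic (x ord0 i)].
have mC : measurable C.
  apply: (@measurable_rV_box _ _ (fun i => `[(- (b + enorm v))%R, b + enorm v]%classic)) => i.
  exact: measurable_itv.
have [|||||_ _] := @dominated_convergence _ _ _ mu setT measurableT
  (fun k x => (F k x)%:E) (EFin \o 'D_v g) (fun x => (M * \1_C x)%:E).
- by move=> k; apply/measurable_EFinP; exact: continuous_measurable_rV.
- by apply/measurable_EFinP; exact: continuous_measurable_rV.
- apply: aeW => x _; apply: cvg_EFin; first by near=> k.
  by apply: derivable_seq_cvg => // k; rewrite gt_eqF.
- apply: (@bounded_support_integrable M (b + enorm v)).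
  + by apply: measurable_funM => //; exact: measurable_indic.
  + move=> x; rewrite normrM ger0_norm// ler_piMr// indicE; case: (_ \in _) => /=;
    by rewrite ?normr1 ?normr0.
  + move=> x i; rewrite indicE; case: (boolP (x \in C)); last by rewrite mulr0 eqxx.
    by rewrite inE => /(_ i); rewrite /= in_itv /= -ler_norml.
- apply: aeW => x k _; rewrite /= lee_fin.
  have [Fx|Fx] := eqVneq (F k x) 0.
    by rewrite Fx normr0 mulr_ge0.
  rewrite indicE mem_set ?mulr1; first exact: FM.
  by move=> i; rewrite /= in_itv /= -ler_norml (Fb k).
rewrite (_ : (fun k => _) = cst 0%E); last by apply/funext => k; rewrite IF0.
move=> /cvg_lim; rewrite lim_cst// => /(_ (@ereal_hausdorff _)) h.
by rewrite /Rintegral -h.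
Unshelve. all: by end_near. Qed.

End difference_quotient.

End integrable_support.
(** * The Gaussian Poincare inequality *)

Section weighted_integral.
Local Open Scope ereal_scope.
Context {R : realType} d (T : measurableType d).
Variables (m : {sigma_finite_measure set T -> \bar R}) (w : T -> R).
Hypotheses (mw : measurable_fun setT w) (w0 : forall x, (0 <= w x)%R).

(** An expectation when [w] has integral 1. The integrand is extended-valued: Tonelli applies to
    nonnegative ones, and the value +oo is allowed. *)
Definition wint (f : T -> \bar R) : \bar R := \int[m]_x ((w x)%:E * f x).

Let mwE : measurable_fun setT (fun x => (w x)%:E).
Proof. exact/measurable_EFinP. Qed.

Lemma wint_ge0 f : (forall x, 0 <= f x) -> 0 <= wint f.
Proof. by move=> f0; apply: integral_ge0 => x _; rewrite mule_ge0// lee_fin. Qed.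

Lemma eq_wint f g : f =1 g -> wint f = wint g.
Proof. by move=> fg; apply: eq_integral => x _; rewrite fg. Qed.

Lemma measurable_weight f : measurable_fun setT f ->
  measurable_fun setT (fun x => (w x)%:E * f x).
Proof. by move=> mf; exact: emeasurable_funM. Qed.

Lemma le_wint f g : measurable_fun setT f -> measurable_fun setT g ->
  (forall x, 0 <= f x) -> (forall x, f x <= g x) -> wint f <= wint g.
Proof.
move=> mf mg f0 fg; apply: ge0_le_integral => //.
- by move=> x _; rewrite mule_ge0// lee_fin.
- exact: measurable_weight.
- exact: measurable_weight.
- by move=> x _; rewrite lee_wpmul2l// lee_fin.
Qed.

Lemma wintD f g : measurable_fun setT f -> measurable_fun setT g ->
  (forall x, 0 <= f x) -> (forall x, 0 <= g x) ->
  wint (fun x => f x + g x) = wint f + wint g.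
Proof.
move=> mf mg f0 g0; rewrite /wint -ge0_integralD//.
- by apply: eq_integral => x _; rewrite ge0_muleDr.
- by move=> x _; rewrite mule_ge0// lee_fin.
- exact: measurable_weight.
- by move=> x _; rewrite mule_ge0// lee_fin.
- exact: measurable_weight.
Qed.

Lemma wintZl (c : \bar R) f : 0 <= c -> measurable_fun setT f -> (forall x, 0 <= f x) ->
  wint (fun x => c * f x) = c * wint f.
Proof.
move=> c0 mf f0; rewrite /wint -ge0_integralZl//.
- by apply: eq_integral => x _; rewrite muleCA.
- exact: measurable_weight.
- by move=> x _; rewrite mule_ge0// lee_fin.
Qed.

Lemma wint_cst (c : \bar R) : \int[m]_x (w x)%:E = 1 -> 0 <= c -> wint (fun=> c) = c.
Proof.
move=> w1 c0; rewrite /wint; under eq_integral do rewrite muleC.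
by rewrite ge0_integralZl// ?w1 ?mule1// => x _; rewrite lee_fin.
Qed.

Lemma wint_sum (I : Type) (s : seq I) (f : I -> T -> \bar R) :
  (forall i, measurable_fun setT (f i)) -> (forall i x, 0 <= f i x) ->
  wint (fun x => \sum_(i <- s) f i x) = \sum_(i <- s) wint (f i).
Proof.
move=> mf f0; rewrite /wint -ge0_integral_sum//.
- apply: eq_integral => x _; rewrite ge0_sume_distrr//.
- by move=> i; exact: measurable_weight.
- by move=> i x _; rewrite mule_ge0// lee_fin.
Qed.

Lemma measurable_wint d' (T' : measurableType d') (f : T' * T -> \bar R) :
  measurable_fun setT f -> (forall p, 0 <= f p) ->
  measurable_fun setT (fun x => wint (fun y => f (x, y))).
Proof.
move=> mf f0.
have mg : measurable_fun setT (fun p : T' * T => (w p.2)%:E * f p).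
  apply: emeasurable_funM => //.
  exact: measurableT_comp mwE measurable_snd.
apply: (@measurable_fun_fubini_tonelli_F _ _ _ _ _ m _ mg) => p.
by rewrite mule_ge0// lee_fin.
Qed.

Lemma measurable_wint_comp d1 (T1 : measurableType d1) (f : T1 -> T -> \bar R) :
  measurable_fun setT (fun p : T1 * T => f p.1 p.2) -> (forall x y, 0 <= f x y) ->
  measurable_fun setT (fun x => wint (f x)).
Proof. by move=> mf f0; apply: (@measurable_wint _ T1 (fun p => f p.1 p.2)). Qed.

End weighted_integral.

Section wint_swap.
Local Open Scope ereal_scope.
Context {R : realType} d1 d2 (T1 : measurableType d1) (T2 : measurableType d2).
Variables (m1 : {sigma_finite_measure set T1 -> \bar R}) (w1 : T1 -> R).
Variables (m2 : {sigma_finite_measure set T2 -> \bar R}) (w2 : T2 -> R).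
Hypotheses (mw1 : measurable_fun setT w1) (w10 : forall x, (0 <= w1 x)%R).
Hypotheses (mw2 : measurable_fun setT w2) (w20 : forall x, (0 <= w2 x)%R).

Lemma wint_swap (f : T1 -> T2 -> \bar R) :
  measurable_fun setT (fun p : T1 * T2 => f p.1 p.2) -> (forall x y, 0 <= f x y) ->
  wint m1 w1 (fun x => wint m2 w2 (f x)) = wint m2 w2 (fun y => wint m1 w1 (f ^~ y)).
Proof.
move=> mf f0.
pose g (p : T1 * T2) := (w1 p.1 * w2 p.2)%:E * f p.1 p.2.
have mg : measurable_fun setT g.
  apply: emeasurable_funM => //; apply/measurable_EFinP; apply: measurable_funM.
    exact: measurableT_comp mw1 measurable_fst.
  exact: measurableT_comp mw2 measurable_snd.
have g0 p : 0 <= g p by rewrite mule_ge0// lee_fin mulr_ge0.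
have := @fubini_tonelli _ _ _ _ _ m1 m2 g mg g0.
congr (_ = _); apply: eq_integral => x _; rewrite -ge0_integralZl//.
- by apply: eq_integral => y _; rewrite muleA -EFinM.
- apply: measurable_weight => //.
  exact: (measurableT_comp mf (measurable_pair1 x)).
- by move=> y _; rewrite mule_ge0// lee_fin.
- by rewrite lee_fin.
- by apply: eq_integral => y _; rewrite muleA -EFinM mulrC.
- apply: measurable_weight => //.
  exact: (measurableT_comp mf (measurable_pair2 x)).
- by move=> y _; rewrite mule_ge0// lee_fin.
- by rewrite lee_fin.
Qed.

Let sec (f : T1 -> T2 -> \bar R) x : measurable_fun setT (fun p : T1 * T2 => f p.1 p.2) ->
  measurable_fun setT (f x).
Proof. by move=> mf; exact: (measurableT_comp mf (measurable_pair1 x)). Qed.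

Lemma wint2D (f g : T1 -> T2 -> \bar R) :
  measurable_fun setT (fun p : T1 * T2 => f p.1 p.2) -> (forall x y, 0 <= f x y) ->
  measurable_fun setT (fun p : T1 * T2 => g p.1 p.2) -> (forall x y, 0 <= g x y) ->
  wint m1 w1 (fun x => wint m2 w2 (fun y => f x y + g x y)) =
  wint m1 w1 (fun x => wint m2 w2 (f x)) + wint m1 w1 (fun x => wint m2 w2 (g x)).
Proof.
move=> mf f0 mg g0; rewrite -wintD//.
- apply: eq_wint => x; rewrite wintD//; exact: sec.
- exact: measurable_wint_comp.
- exact: measurable_wint_comp.
- by move=> x; exact: wint_ge0.
- by move=> x; exact: wint_ge0.
Qed.

Lemma le_wint2 (f g : T1 -> T2 -> \bar R) :
  measurable_fun setT (fun p : T1 * T2 => f p.1 p.2) -> (forall x y, 0 <= f x y) ->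
  measurable_fun setT (fun p : T1 * T2 => g p.1 p.2) -> (forall x y, f x y <= g x y) ->
  wint m1 w1 (fun x => wint m2 w2 (f x)) <= wint m1 w1 (fun x => wint m2 w2 (g x)).
Proof.
move=> mf f0 mg fg; have g0 x y : 0 <= g x y by exact: le_trans (f0 x y) (fg x y).
apply: le_wint => //.
- exact: measurable_wint_comp.
- exact: measurable_wint_comp.
- by move=> x; exact: wint_ge0.
- move=> x; apply: le_wint => //; exact: sec.
Qed.

End wint_swap.

Section tensorization.
Local Open Scope ereal_scope.
Context {R : realType} d1 d2 (T1 : measurableType d1) (T2 : measurableType d2).
Variables (m1 : {sigma_finite_measure set T1 -> \bar R}) (w1 : T1 -> R).
Variables (m2 : {sigma_finite_measure set T2 -> \bar R}) (w2 : T2 -> R).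
Hypotheses (mw1 : measurable_fun setT w1) (w10 : forall x, (0 <= w1 x)%R).
Hypotheses (mw2 : measurable_fun setT w2) (w20 : forall x, (0 <= w2 x)%R).
Hypotheses (w11 : \int[m1]_x (w1 x)%:E = 1) (w21 : \int[m2]_x (w2 x)%:E = 1).

Notation E1 := (wint m1 w1).
Notation E2 := (wint m2 w2).

(** Its expectation over two independent copies is twice the variance. In this form no mean is
    subtracted and every integrand is nonnegative. *)
Definition sqd (x y : R) : \bar R := ((x - y) ^+ 2)%:E.

Lemma sqd_ge0 x y : 0 <= sqd x y. Proof. by rewrite lee_fin sqr_ge0. Qed.

Lemma sqdC x y : sqd x y = sqd y x.
Proof. by rewrite /sqd -sqrrN opprB. Qed.

Lemma sqdE x y : sqd x y = ((x - y) ^+ 2)%:E. Proof. by []. Qed.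

Lemma measurable_sqd d (T : measurableType d) (f g : T -> R) :
  measurable_fun setT f -> measurable_fun setT g ->
  measurable_fun setT (fun x => sqd (f x) (g x)).
Proof.
move=> mf mg; apply/measurable_EFinP; apply: measurable_funX.
exact: measurable_funB.
Qed.

Local Opaque sqd wint.

(* The quadrilateral inequality (X-Y)^2 + (Z-W)^2 <= (X-Z)^2 + (Z-Y)^2 + (Y-W)^2 + (W-X)^2
   at the four vertices of a rectangle. *)
Lemma wint_quadrilateral (f g : T2 -> R) :
  measurable_fun setT f -> measurable_fun setT g ->
  2%:E * E2 (fun u => E2 (fun v => sqd (f u) (g v))) <=
  E2 (fun u => E2 (fun v => sqd (f u) (f v))) +
  E2 (fun u => E2 (fun v => sqd (g u) (g v))) +
  2%:E * E2 (fun v => sqd (f v) (g v)).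
Proof.
move=> mf mg.
have two (x : \bar R) : 2%:E * x = x + x by rewrite (_ : 2%:E = 1 + 1)// ge0_muleDl// mul1e.
have mc (h k : T2 -> R) : measurable_fun setT h -> measurable_fun setT k ->
    measurable_fun setT (fun p : T2 * T2 => sqd (h p.1) (k p.2)).
  move=> mh mk; apply: measurable_sqd.
    exact: measurableT_comp mh measurable_fst.
  exact: measurableT_comp mk measurable_snd.
have S0 (h k : T2 -> R) u v : 0 <= sqd (h u) (k v) by exact: sqd_ge0.
have mc' (h k : T2 -> R) : measurable_fun setT h -> measurable_fun setT k ->
    measurable_fun setT (fun p : T2 * T2 => sqd (h p.2) (k p.1)).
  move=> mh mk; apply: measurable_sqd.
    exact: measurableT_comp mh measurable_snd.
  exact: measurableT_comp mk measurable_fst.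
have mb (h k : T2 -> R) : measurable_fun setT h -> measurable_fun setT k ->
    measurable_fun setT (fun p : T2 * T2 => sqd (h p.2) (k p.2)).
  move=> mh mk; apply: measurable_sqd.
    exact: measurableT_comp mh measurable_snd.
  exact: measurableT_comp mk measurable_snd.
have ma (h k : T2 -> R) : measurable_fun setT h -> measurable_fun setT k ->
    measurable_fun setT (fun p : T2 * T2 => sqd (h p.1) (k p.1)).
  move=> mh mk; apply: measurable_sqd.
    exact: measurableT_comp mh measurable_fst.
  exact: measurableT_comp mk measurable_fst.
(* Exchanging the copies turns twice the left-hand side into the sum over both diagonals of the
   rectangle. *)
have sw : E2 (fun u => E2 (fun v => sqd (f u) (g v))) =
          E2 (fun u => E2 (fun v => sqd (f v) (g u))).
  by rewrite (@wint_swap _ _ _ _ _ _ _ _ _ mw2 w20 mw2 w20 (fun u v => sqd (f u) (g v)) (mc f g mf mg)).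
have A := @wint2D _ _ _ _ _ m2 w2 m2 w2 mw2 w20 mw2 w20.
rewrite !two {2}sw.
rewrite -(A (fun u v => sqd (f u) (g v)) (fun u v => sqd (f v) (g u))
  (mc f g mf mg) (S0 f g) (mc' f g mf mg) (fun u v => S0 f g v u)).
have D1 : E2 (fun v => sqd (f v) (g v)) = E2 (fun u => E2 (fun v => sqd (f v) (g v))).
  by rewrite (@wint_cst _ _ _ m2 w2) => //; exact: wint_ge0.
have D2 : E2 (fun v => sqd (f v) (g v)) = E2 (fun u => E2 (fun v => sqd (f u) (g u))).
  by apply: eq_wint => u; rewrite (@wint_cst _ _ _ m2 w2).
rewrite [X in _ <= _ + (X + _)]D1 [X in _ <= _ + (_ + X)]D2.
rewrite -(A (fun u v => sqd (f u) (f v)) (fun u v => sqd (g u) (g v))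
  (mc f f mf mf) (S0 f f) (mc g g mg mg) (S0 g g)).
rewrite -(A (fun u v => sqd (f v) (g v)) (fun u v => sqd (f u) (g u))
  (mb f g mf mg) (fun u v => S0 f g v v) (ma f g mf mg) (fun u v => S0 f g u u)).
rewrite -(A (fun u v => sqd (f u) (f v) + sqd (g u) (g v)) (fun u v => sqd (f v) (g v) + sqd (f u) (g u))
  (emeasurable_funD (mc f f mf mf) (mc g g mg mg)) (fun u v => adde_ge0 (S0 f f u v) (S0 g g u v))
  (emeasurable_funD (mb f g mf mg) (ma f g mf mg)) (fun u v => adde_ge0 (S0 f g v v) (S0 f g u u))).
apply: (@le_wint2 _ _ _ _ _ m2 w2 m2 w2 mw2 w20 mw2 w20).
- by apply: emeasurable_funD; [exact: mc|exact: mc'].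
- by move=> u v; rewrite adde_ge0.
- apply: emeasurable_funD; apply: emeasurable_funD; [exact: mc|exact: mc|exact: mb|exact: ma].
move=> u v; rewrite !sqdE -!EFinD lee_fin.
(* The gap between the two sides is exactly this square. *)
have := sqr_ge0 (f u + g v - f v - g u)%R; nra.
Qed.

(* [E1 E1 E2 E2] orders the four variables so that the two copies of each factor are adjacent. *)
Lemma wint_tensor (F : T1 -> T2 -> R) :
  measurable_fun setT (fun p : T1 * T2 => F p.1 p.2) ->
  E1 (fun a => E2 (fun u => E1 (fun b => E2 (fun v => sqd (F a u) (F b v))))) <=
  E1 (fun a => E2 (fun u => E2 (fun v => sqd (F a u) (F a v)))) +
  E2 (fun v => E1 (fun a => E1 (fun b => sqd (F a v) (F b v)))).
Proof.
move=> mF.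
have mFc d (T : measurableType d) (f : T -> T1) (g : T -> T2) :
    measurable_fun setT f -> measurable_fun setT g ->
    measurable_fun setT (fun t => F (f t) (g t)).
  by move=> mf mg; exact: (measurableT_comp mF (measurable_fun_pair mf mg)).
have f1 d d' (T : measurableType d) (T' : measurableType d') := @measurable_fst _ _ T T'.
have f2 d d' (T : measurableType d) (T' : measurableType d') := @measurable_snd _ _ T T'.
have co d d' d'' (T : measurableType d) (T' : measurableType d') (T'' : measurableType d'')
   := @measurableT_comp d d' d'' T T' T''.
pose Q a b := E2 (fun u => E2 (fun v => sqd (F a u) (F b v))).
pose D a b := E2 (fun v => sqd (F a v) (F b v)).
have Q0 a b : 0 <= Q a b.
  by apply: wint_ge0 => // u; apply: wint_ge0 => // v; exact: sqd_ge0.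
have D0 a b : 0 <= D a b by apply: wint_ge0 => // u; exact: sqd_ge0.
have mQ : measurable_fun setT (fun p : T1 * T1 => Q p.1 p.2).
  apply: (@measurable_wint_comp _ _ _ m2 w2 mw2 w20 _ (T1 * T1)%type
    (fun p u => E2 (fun v => sqd (F p.1 u) (F p.2 v)))); last first.
    by move=> p u; apply: wint_ge0 => // v; exact: sqd_ge0.
  apply: (@measurable_wint_comp _ _ _ m2 w2 mw2 w20 _ ((T1 * T1) * T2)%type
    (fun p v => sqd (F p.1.1 p.2) (F p.1.2 v))); last by move=> *; exact: sqd_ge0.
  apply: measurable_sqd; apply: mFc.
  - by apply: (co _ _ _ _ _ _ fst) => //; apply: (co _ _ _ _ _ _ fst) => //.
  - by apply: (co _ _ _ _ _ _ snd) => //.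
  - by apply: (co _ _ _ _ _ _ snd) => //; apply: (co _ _ _ _ _ _ fst) => //.
  - by [].
have mD : measurable_fun setT (fun p : T1 * T1 => D p.1 p.2).
  apply: (@measurable_wint_comp _ _ _ m2 w2 mw2 w20 _ (T1 * T1)%type
    (fun p v => sqd (F p.1 v) (F p.2 v))); last by move=> *; exact: sqd_ge0.
  apply: measurable_sqd; apply: mFc => //.
  - by apply: (co _ _ _ _ _ _ fst).
  - by apply: (co _ _ _ _ _ _ snd).
have mV : measurable_fun setT (fun a => Q a a).
  apply: (co _ _ _ _ _ _ (fun p : T1 * T1 => Q p.1 p.2) setT (fun a => (a, a)) mQ).
  exact: measurable_fun_pair.
have mFu u : measurable_fun setT (F ^~ u) by apply: mFc.
have mFa a : measurable_fun setT (F a) by apply: mFc.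
have -> : E1 (fun a => E2 (fun u => E1 (fun b => E2 (fun v => sqd (F a u) (F b v))))) =
    E1 (fun a => E1 (fun b => Q a b)).
  apply: eq_wint => a.
  rewrite (@wint_swap _ _ _ _ _ m2 w2 m1 w1 mw2 w20 mw1 w10
    (fun u b => E2 (fun v => sqd (F a u) (F b v))))//.
    apply: (@measurable_wint_comp _ _ _ m2 w2 mw2 w20 _ (T2 * T1)%type
      (fun p v => sqd (F a p.1) (F p.2 v))); last by move=> *; exact: sqd_ge0.
    apply: measurable_sqd; apply: mFc => //.
    - by apply: (co _ _ _ _ _ _ fst).
    - by apply: (co _ _ _ _ _ _ snd).
  by move=> u b; apply: wint_ge0 => // v; exact: sqd_ge0.
have -> : E2 (fun v => E1 (fun a => E1 (fun b => sqd (F a v) (F b v)))) =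
    E1 (fun a => E1 (fun b => D a b)).
  apply: esym; transitivity (E1 (fun a => E2 (fun v => E1 (fun b => sqd (F a v) (F b v))))).
    apply: eq_wint => a.
    rewrite (@wint_swap _ _ _ _ _ m1 w1 m2 w2 mw1 w10 mw2 w20
      (fun b v => sqd (F a v) (F b v)))//; last by move=> *; exact: sqd_ge0.
    apply: measurable_sqd; apply: mFc => //.
  rewrite (@wint_swap _ _ _ _ _ m1 w1 m2 w2 mw1 w10 mw2 w20
    (fun a v => E1 (fun b => sqd (F a v) (F b v))))//.
    apply: (@measurable_wint_comp _ _ _ m1 w1 mw1 w10 _ (T1 * T2)%type
      (fun p b => sqd (F p.1 p.2) (F b p.2))); last by move=> *; exact: sqd_ge0.
    apply: measurable_sqd; apply: mFc => //.
    - by apply: (co _ _ _ _ _ _ fst).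
    - by apply: (co _ _ _ _ _ _ snd).
    - by apply: (co _ _ _ _ _ _ snd).
  by move=> a v; apply: wint_ge0 => // b; exact: sqd_ge0.
have A := @wint2D _ _ _ _ _ m1 w1 m1 w1 mw1 w10 mw1 w10.
(* [wint_quadrilateral] gives 2 Q a b <= Q a a + Q b b + 2 D a b. Averaged over [a] and [b], the
   first two terms on the right become equal, hence the doubling. *)
rewrite -(@lee_pmul2l _ 2%:E)//.
have Z (c : \bar R) (f : T1 -> T1 -> \bar R) : 0 <= c ->
    measurable_fun setT (fun p : T1 * T1 => f p.1 p.2) -> (forall a b, 0 <= f a b) ->
    E1 (fun a => E1 (fun b => c * f a b)) = c * E1 (fun a => E1 (f a)).
  move=> c0 mf f0; rewrite -wintZl//.
  - apply: eq_wint => a; rewrite wintZl//.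
    exact: (measurableT_comp mf (measurable_pair1 a)).
  - exact: measurable_wint_comp.
  - by move=> a; exact: wint_ge0.
rewrite -Z//.
have := @le_wint2 _ _ _ _ _ m1 w1 m1 w1 mw1 w10 mw1 w10 (fun a b => 2%:E * Q a b)
  (fun a b => Q a a + Q b b + 2%:E * D a b).
have mVa : measurable_fun setT (fun p : T1 * T1 => Q p.1 p.1).
  exact: (co _ _ _ _ _ _ (fun a => Q a a) setT fst mV).
have mVb : measurable_fun setT (fun p : T1 * T1 => Q p.2 p.2).
  exact: (co _ _ _ _ _ _ (fun a => Q a a) setT snd mV).
move=> /(_ _ _ _ _)/le_trans; apply.
- exact: (emeasurable_funM (measurable_cst 2%:E) mQ).
- by move=> a b; rewrite mule_ge0.
- exact: (emeasurable_funD (emeasurable_funD mVa mVb) (emeasurable_funM (measurable_cst 2%:E) mD)).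
- by move=> a b; exact: wint_quadrilateral.
rewrite (A (fun a b => Q a a + Q b b) (fun a b => 2%:E * D a b))//; first last.
- by move=> a b; rewrite mule_ge0.
- exact: (emeasurable_funM (measurable_cst 2%:E) mD).
- by move=> a b; rewrite adde_ge0.
- exact: (emeasurable_funD mVa mVb).
rewrite (A (fun a b => Q a a) (fun a b => Q b b) mVa (fun a b => Q0 a a) mVb (fun a b => Q0 b b)).
rewrite (Z 2%:E D _ mD D0); last by rewrite lee_fin.
rewrite [X in _ <= X]ge0_muleDr; first last.
- by apply: wint_ge0 => // x; apply: wint_ge0.
- by apply: wint_ge0 => // x; exact: Q0.
rewrite leeD2r//.
have cstE c : 0 <= c -> E1 (fun=> c) = c by move=> c0; exact: wint_cst.
have V0 : 0 <= E1 (fun b => Q b b) by exact: wint_ge0.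
rewrite [X in _ + X](cstE _ V0).
have -> : E1 (fun x => E1 (fun=> Q x x)) = E1 (fun b => Q b b).
  by apply: eq_wint => a; exact: cstE.
by rewrite (_ : 2%:E = 1 + 1)// ge0_muleDl// mul1e.
Qed.

End tensorization.

(** * Half-line moments of the Gaussian *)

Section gauss1.
Local Open Scope ereal_scope.
Context {R : realType}.
Notation leb := (@lebesgue_measure R).

Definition gpdf (t : R) : R := normal_pdf 0%R 1%R t.

Lemma gpdfE t : gpdf t = (normal_peak 1%R * expR (- (t ^+ 2 / 2)))%R.
Proof.
rewrite /gpdf normal_pdfE// /normal_fun subr0 expr1n; congr (_ * expR _)%R.
by rewrite mulNr.
Qed.

Lemma gpdf_gt0 t : (0 < gpdf t)%R.
Proof. by rewrite gpdfE mulr_gt0 ?expR_gt0// normal_peak_gt0. Qed.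

Lemma gpdf_ge0 t : (0 <= gpdf t)%R. Proof. exact/ltW/gpdf_gt0. Qed.

Lemma measurable_gpdf : measurable_fun setT gpdf.
Proof. exact: measurable_normal_pdf. Qed.

Lemma integral_gpdf : \int[leb]_t (gpdf t)%:E = 1.
Proof. exact: integral_normal_pdf. Qed.

Lemma gpdfN t : gpdf (- t)%R = gpdf t. Proof. by rewrite !gpdfE sqrrN. Qed.

Definition betw (a b t : R) : R := ((b < t) && (t <= a))%R%:R * (a - b).

Lemma betw_ge0 a b t : (0 <= betw a b t)%R.
Proof.
rewrite /betw; case: (boolP (_ && _)) => [/andP[bt ta]|_]; last by rewrite mul0r.
by rewrite mul1r subr_ge0 ltW// (lt_le_trans bt).
Qed.

(** Writes a - b as (a - t) + (t - b). Each summand is a function of [a] times a function of [b], so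
    its double expectation factors. *)
Lemma betw_split (a b t : R) : betw a b t =
  (Num.max (a - t) 0 * (b < t)%R%:R + (t <= a)%R%:R * Num.max (t - b) 0)%R.
Proof.
rewrite /betw; case: (ltP b t) => bt; case: (leP t a) => ta /=;
  rewrite ?(mul0r, mul1r, mulr1, mulr0, addr0, add0r)//.
- by rewrite max_l ?subr_ge0// max_l ?subr_ge0 ?(ltW bt)//; ring.
- by rewrite max_r// subr_le0 ltW.
- by rewrite max_r// subr_le0.
Qed.

(** The difference of the identities y^+ - (-y)^+ = y at y = a + t and at y = a, arranged without
    subtraction so that the terms can be integrated in the extended reals. *)
Lemma maxr_reflect (a t : R) : (0 <= t)%R ->
  (Num.max (a - - t) 0 + Num.max (- a - 0) 0 = Num.max (- a - t) 0 + Num.max (a - 0) 0 + t)%R.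
Proof.
move=> t0; have [h1|h1] := leP (a - - t)%R 0%R; have [h2|h2] := leP (- a - 0)%R 0%R;
  have [h3|h3] := leP (- a - t)%R 0%R; have [h4|h4] := leP (a - 0)%R 0%R; lra.
Qed.

Lemma is_derive_gpdf (x : R) : is_derive x 1%R gpdf (- (x * gpdf x))%R.
Proof.
have E : gpdf = (fun t => normal_peak 1 *: expR (- 2^-1 * (t ^+ 2)))%R.
  by apply/funext => t; rewrite gpdfE /GRing.scale/= mulNr mulrC [in RHS]mulrC [(2^-1 * _)%R]mulrC.
have d0 := derivableP (@exprn_derivable _ 2 x (1%R : R)).
have d2 := is_derive1_comp (is_derive_expR _) (is_deriveZ (- 2^-1)%R d0).
have d3 := is_deriveZ (normal_peak 1%R) d2.
rewrite {1}E; apply: is_derive_eq d3 _.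
by rewrite exp_derive E /GRing.scale/= !expr1; field.
Qed.

Lemma continuous_gpdf : continuous gpdf.
Proof. by apply: continuous_normal_pdf. Qed.

Lemma gpdf_cvgy : gpdf x @[x --> +oo%R] --> 0%R.
Proof.
rewrite (_ : gpdf = (fun t => normal_peak 1 * expR (- (t ^+ 2 / 2)))%R); last first.
  by apply/funext => t; exact: gpdfE.
rewrite -(mulr0 (normal_peak 1)); apply: cvgM; first exact: cvg_cst.
apply: (@cvg_comp _ _ _ _ (fun t => expR (- t))%R _ (+oo%R)%classic); last exact: cvgr_expR.
apply: (@ger_cvgy _ _ _ _ (fun t => t / 2)%R).
  near=> t; rewrite ler_pM2r// expr2 ler_peMl//.
apply: gt0_cvgMly => //.
Unshelve. all: by end_near. Qed.

(** The antiderivative is [- gpdf], and [t >= 0] makes the integrand nonnegative. *)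
Lemma integral_xgpdf (t : R) : (0 <= t)%R ->
  \int[leb]_(a in `[t, +oo[) (a * gpdf a)%:E = (gpdf t)%:E.
Proof.
move=> t0; rewrite (@ge0_continuous_FTC2y _ _ (fun s => - gpdf s)%R t 0%R).
- by rewrite -EFinB sub0r opprK.
- by move=> x tx; rewrite mulr_ge0 ?gpdf_ge0// (le_trans t0).
- apply: continuous_subspaceT => x.
  by apply: continuous_at_mul; [exact: id|exact: continuous_gpdf].
- by rewrite -oppr0; apply: cvgN; exact: gpdf_cvgy.
- by move=> x _; have [] := is_deriveN (is_derive_gpdf x).
- by apply: cvgN; apply: cvg_at_right_filter; exact: continuous_gpdf.
- move=> x _; rewrite derive1E; have [_ ->] := is_deriveN (is_derive_gpdf x).
  by rewrite opprK.
Qed.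

Lemma integral_oppr (G : R -> \bar R) :
  measurable_fun [set: measurableTypeR R] G -> (forall t, 0 <= G t) ->
  \int[leb]_t G t = \int[leb]_t G (- t)%R.
Proof.
move=> mG G0.
pose phi : measurableTypeR R -> measurableTypeR R := fun t => (- t)%R.
have mphi : measurable_fun setT phi by apply: continuous_measurable_fun; exact: opp_continuous.
pose pm : {measure set (measurableTypeR R) -> \bar R} := pushforward leb phi.
have mE A : measurable A -> leb A = pm mphi A.
  apply: lebesgue_measure_unique => X [[c d] /= cd <-].
  rewrite /pm /pushforward.
  have -> : phi @^-1` `]c, d]%classic = `[(- d)%R, (- c)%R[%classic.
    by apply/seteqP; split => t /=; rewrite !in_itv /= /phi lerNl ltrNr andbC.
  rewrite !lebesgue_measure_itv/= !lte_fin ltrN2.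
  by case: ifPn => _; rewrite // -!EFinD opprK addrC.
rewrite (eq_measure_integral (pm mphi))/=; last by move=> A mA _; exact: mE.
by rewrite (ge0_integral_pushforward mphi).
Qed.

Notation E := (wint leb gpdf).
Let RR := measurableTypeR R.
Let mw : measurable_fun [set: RR] gpdf. Proof. exact: measurable_gpdf. Qed.
Let w0 := gpdf_ge0.

Lemma wint_gpdfN (G : R -> \bar R) :
  measurable_fun [set: RR] G -> (forall t, 0 <= G t) -> E G = E (fun t => G (- t)%R).
Proof.
move=> mG G0; rewrite /wint integral_oppr.
- by apply: eq_integral => t _; rewrite gpdfN.
- exact: measurable_weight.
- by move=> t; rewrite mule_ge0// lee_fin.
Qed.

Let P t (a : R) : R := Num.max (a - t)%R 0%R.
Let X t (a : R) : R := (t <= a)%R%:R.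
Let Y t (a : R) : R := (a < t)%R%:R.

Let mP t : measurable_fun [set: RR] (fun a => (P t a)%:E).
Proof.
by apply/measurable_EFinP; apply: measurable_maxr => //; exact: measurable_funB.
Qed.
Let mX t : measurable_fun [set: RR] (fun a => (X t a)%:E).
Proof.
apply/measurable_EFinP; rewrite (_ : X t = \1_`[t, +oo[); first exact: measurable_indic.
by apply/funext => a; rewrite indicE /X mem_setE in_itv/= andbT.
Qed.
Let mY t : measurable_fun [set: RR] (fun a => (Y t a)%:E).
Proof.
apply/measurable_EFinP; rewrite (_ : Y t = \1_`]-oo, t[); first exact: measurable_indic.
by apply/funext => a; rewrite indicE /Y mem_setE in_itv/=.
Qed.
Let P0 t a : 0 <= (P t a)%:E. Proof. by rewrite lee_fin le_max lexx orbT. Qed.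
Let X0 t a : 0 <= (X t a)%:E. Proof. by rewrite lee_fin. Qed.
Let Y0 t a : 0 <= (Y t a)%:E. Proof. by rewrite lee_fin. Qed.

(** For a standard normal variable [a], this is the mean of (a - t)^+, and [H t] is the probability
    of the tail t <= a. *)
Let A t := E (fun a => (P t a)%:E).
Let H t := E (fun a => (X t a)%:E).

Let A0 t : 0 <= A t. Proof. exact: wint_ge0. Qed.
Let H0 t : 0 <= H t. Proof. exact: wint_ge0. Qed.

Let HY t : H t + E (fun a => (Y t a)%:E) = 1.
Proof.
rewrite /H -wintD// -[RHS](wint_cst mw w0 integral_gpdf (@lee01 R)).
apply: eq_wint => a; rewrite -EFinD /X /Y; congr (_%:E).
by case: leP => _; rewrite ?addr0 ?add0r.
Qed.

(** (a - t)^+ + t 1_(t <= a) = a 1_(t <= a), whose mean is the tail integral [integral_xgpdf]. *)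
Let A_pos t : (0 <= t)%R -> A t + t%:E * H t = (gpdf t)%:E.
Proof.
move=> t0.
have -> : t%:E * H t = E (fun a => t%:E * (X t a)%:E) by rewrite wintZl.
rewrite -wintD//; last 2 first.
- exact: emeasurable_funM.
- by move=> a; rewrite mule_ge0.
rewrite -(integral_xgpdf t0) [RHS]integral_mkcond; apply: eq_integral => a _.
rewrite patchE mem_setE in_itv/= andbT /P /X -!(EFinM, EFinD).
case: leP => ta; last first.
  by rewrite mulr0 addr0 max_r ?mulr0// subr_le0 ltW.
by rewrite mulr1 max_l ?subr_ge0// subrK mulrC.
Qed.

Let A_neg t : (0 <= t)%R -> A (- t) = A t + t%:E.
Proof.
move=> t0.
have AE s : A s = E (fun a => (P s (- a)%R)%:E) by rewrite /A wint_gpdfN.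
have finA s : (0 <= s)%R -> A s \is a fin_num.
  move=> s0; rewrite ge0_fin_numE//; apply: (@le_lt_trans _ _ (gpdf s)%:E); last exact: ltry.
  by rewrite -(A_pos s0) leeDl// mule_ge0.
have mPN s : measurable_fun [set: RR] (fun a => (P s (- (a : R))%R)%:E).
  apply: (measurableT_comp (mP s)).
  by apply: continuous_measurable_fun; exact: opp_continuous.
(* [A 0] is added on both sides so that [maxr_reflect] can be averaged, once the variable is
   reflected in [A 0] on the left and in [A t] on the right. Being finite, it cancels afterwards. *)
have : A (- t)%R + A 0%R = A t + A 0%R + t%:E.
  rewrite [in LHS](AE 0%R) [A t in RHS]AE.
  rewrite -[X in _ = _ + X](wint_cst mw w0 integral_gpdf); last by rewrite lee_fin.
  rewrite /A -!wintD//; last 2 first.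
  - exact: emeasurable_funD.
  - by move=> a; rewrite adde_ge0.
  apply: eq_wint => a; rewrite -!EFinD /P; congr (_%:E).
  exact: maxr_reflect.
rewrite -[A 0%R]fineK ?finA// -[A t]fineK ?finA// -!EFinD.
move=> /(congr1 (fun z => z - (fine (A 0%R))%:E)).
by rewrite addeK// -EFinB => ->; congr (_%:E); ring.
Qed.

(** After reflection the two events cover the line and share only the point [a = t], which is
    negligible. *)
Let H_neg t : H t + H (- t)%R = 1.
Proof.
rewrite -(HY t); congr (_ + _); rewrite /H wint_gpdfN//.
have -> : E (fun a => (X (- t)%R (- a)%R)%:E) = E (fun a => (Y t a)%:E + ((a == t)%:R)%:E).
  apply: eq_wint => a; rewrite -EFinD /X /Y lerN2 le_eqVlt; congr (_%:E).
  by case: ltgtP; rewrite ?addr0 ?add0r.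
have mS : measurable_fun [set: RR] (fun a : R => ((a == t)%:R)%:E : \bar R).
  apply/measurable_EFinP; rewrite (_ : (fun _ => _) = \1_[set t]).
    exact: measurable_indic.
  apply/funext => a; rewrite indicE; case: eqVneq => [->|/eqP ne]; first by rewrite mem_set.
  by rewrite memNset.
rewrite wintD// (_ : E (fun a => ((a == t)%:R)%:E) = 0) ?adde0//.
transitivity (\int[leb]_(a in [set t]) (gpdf a)%:E); last by rewrite integral_set1.
rewrite [RHS]integral_mkcond; apply: eq_integral => a _.
rewrite patchE; case: eqVneq => [->|ne]; first by rewrite mem_set// mule1.
by rewrite memNset ?mule0//; apply/eqP.
Qed.

(** For t >= 0 the left-hand side is A (1 - H) + H (A + t) = A + t H, and [A_pos] concludes. For t <
    0 the same computation is made at - t, with [H_neg] to come back. *)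
Let K t : A t * E (fun a => (Y t a)%:E) + H t * A (- t)%R = (gpdf t)%:E.
Proof.
have finH s : H s \is a fin_num.
  by rewrite ge0_fin_numE// (@le_lt_trans _ _ 1) ?ltry// -(HY s) leeDl// wint_ge0.
have finY : E (fun a => (Y t a)%:E) \is a fin_num.
  by rewrite ge0_fin_numE ?wint_ge0// (@le_lt_trans _ _ 1) ?ltry// -(HY t) leeDr.
have finA s : (0 <= s)%R -> A s \is a fin_num.
  move=> s0; rewrite ge0_fin_numE//; apply: (@le_lt_trans _ _ (gpdf s)%:E); last exact: ltry.
  by rewrite -(A_pos s0) leeDl// mule_ge0.
have := HY t; rewrite -(fineK (finH t)) -(fineK finY) -EFinD => -[hY].
have [t0|t0] := leP 0%R t.
  rewrite A_neg//; have := A_pos t0.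
  rewrite -(fineK (finH t)) -(fineK (finA t t0)) -!(EFinM, EFinD) => -[hA].
  congr (_%:E); rewrite -hA.
  have -> : fine (E (fun a => (Y t a)%:E)) = (1 - fine (H t))%R by rewrite -hY; ring.
  ring.
have s0 : (0 <= - t)%R by lra.
have := A_neg s0; rewrite opprK => ->; have := A_pos s0; have := H_neg t.
rewrite gpdfN -(fineK (finH t)) -(fineK (finH (- t)%R)) -(fineK (finA _ s0)).
rewrite -!(EFinM, EFinD) => -[hH] [hA]; congr (_%:E); rewrite -hA.
have -> : fine (E (fun a => (Y t a)%:E)) = (1 - fine (H t))%R by rewrite -hY; ring.
have -> : fine (H (- t)%R) = (1 - fine (H t))%R by rewrite -hH; ring.
ring.
Qed.

(* Splitting a - b at t reduces to the half-line moments of the Gaussian. *)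
Lemma wint_betw t : E (fun a => E (fun b => (betw a b t)%:E)) = (gpdf t)%:E.
Proof.
rewrite -(K t).
have EN : A (- t)%R = E (fun b => (Num.max (t - b) 0)%:E).
  rewrite /A wint_gpdfN//; apply: eq_wint => b; rewrite /P; congr ((Num.max _ _)%:E); ring.
have mN : measurable_fun [set: RR] (fun b : R => (Num.max (t - b) 0)%:E).
  by apply/measurable_EFinP; apply: measurable_maxr => //; exact: measurable_funB.
have N0 (b : R) : 0 <= (Num.max (t - b) 0)%:E by rewrite lee_fin le_max lexx orbT.
transitivity (E (fun a => (P t a)%:E * E (fun b => (Y t b)%:E) + (X t a)%:E * A (- t)%R)).
  apply: eq_wint => a; rewrite EN -!wintZl// -wintD//.
  - apply: eq_wint => b; rewrite -!EFinM -EFinD /P /X /Y; congr (_%:E).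
    exact: betw_split.
  - exact: emeasurable_funM.
  - exact: emeasurable_funM.
  - by move=> b; rewrite mule_ge0.
  - by move=> b; rewrite mule_ge0.
have EY0 : 0 <= E (fun b => (Y t b)%:E) by exact: wint_ge0.
rewrite wintD//.
- congr (_ + _); first by rewrite muleC -wintZl//; apply: eq_wint => a; rewrite muleC.
  by rewrite muleC -wintZl//; apply: eq_wint => a; rewrite muleC.
- exact: emeasurable_funM.
- exact: emeasurable_funM.
- by move=> a; rewrite mule_ge0.
- by move=> a; rewrite mule_ge0.
Qed.

End gauss1.

(** * The Gaussian inequality on the line, then in every dimension *)

Section gauss_poincare.
Local Open Scope ereal_scope.
Context {R : realType}.
Notation leb := (@lebesgue_measure R).
Notation RR := (measurableTypeR R).
Notation E := (wint leb (@gpdf R)).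
Notation L := (wint leb (fun=> 1%R : R)).

Let mw : measurable_fun [set: RR] (@gpdf R). Proof. exact: measurable_gpdf. Qed.
Let w0 := @gpdf_ge0 R.
Let mo : measurable_fun [set: RR] (fun=> 1%R : R). Proof. exact: measurable_cst. Qed.
Let o0 (x : RR) : (0 <= (1 : R))%R. Proof. exact: ler01. Qed.

Let le_mul2_of_split (x y z v : \bar R) :
  x = z -> y = z -> v = x + y -> 0 <= z -> v <= 2%:E * z.
Proof.
move=> -> -> -> z0; rewrite (_ : 2%:E = 1 + 1)//.
by rewrite ge0_muleDl// mul1e.
Qed.

(** The bound [hG] on increments is written as an integral over [t] against the kernel [betw], and
    [wint_betw] integrates [a] and [b] out. The factor 2 comes from the two orders of [a] and [b];
    it matches the left-hand side, which is twice a variance. *)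
Lemma gauss_poincare1 (h : RR -> R) (G : RR -> \bar R) :
  measurable_fun setT h -> measurable_fun setT G -> (forall t, 0 <= G t) ->
  (forall a b : R, (b < a)%R ->
     sqd (h a) (h b) <= (a - b)%:E * \int[leb]_(t in `]b, a]) G t) ->
  E (fun a => E (fun b => sqd (h a) (h b))) <= 2%:E * E G.
Proof.
move=> mh mG G0 hG.
have m1 : measurable_fun setT (fun p : (RR * RR) * RR => p.1.1).
  exact: measurableT_comp measurable_fst measurable_fst.
have m2 : measurable_fun setT (fun p : (RR * RR) * RR => p.1.2).
  exact: measurableT_comp measurable_snd measurable_fst.
have m3 : measurable_fun setT (fun p : (RR * RR) * RR => p.2).
  exact: measurable_snd.
have mB : measurable_fun setT (fun p : (RR * RR) * RR => (betw p.1.1 p.1.2 p.2)%:E).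
  apply/measurable_EFinP; apply: measurable_funM; last exact: measurable_funB.
  have mb : measurable_fun setT (fun p : (RR * RR) * RR => (p.1.2 < p.2) && (p.2 <= p.1.1))%R.
    by apply: measurable_and; [exact: measurable_fun_ltr|exact: measurable_fun_ler].
  rewrite (_ : (fun _ => _) = fun p : (RR * RR) * RR =>
     if ((p.1.2 < p.2) && (p.2 <= p.1.1))%R then (1 : R)%R else 0%R).
    exact: measurable_fun_ifT.
  by apply/funext => p; case: ifP.
have perm (f : (RR * RR) * RR -> \bar R) (g : (RR * RR) * RR -> (RR * RR) * RR) :
    measurable_fun setT f -> measurable_fun setT g -> measurable_fun setT (f \o g).
  by move=> mf mg; exact: measurableT_comp.
pose K a b t := (betw a b t)%:E * G t.
have K0 a b t : 0 <= K a b t by rewrite mule_ge0// lee_fin betw_ge0.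
have mK : measurable_fun setT (fun p : (RR * RR) * RR => K p.1.1 p.1.2 p.2).
  by apply: emeasurable_funM => //; exact: measurableT_comp mG m3.
have mK' : measurable_fun setT (fun p : (RR * RR) * RR => K p.1.2 p.1.1 p.2).
  apply: (perm _ (fun p => ((p.1.2, p.1.1), p.2)) mK).
  by apply: measurable_fun_pair => //; exact: measurable_fun_pair.
have mK2 : measurable_fun setT (fun p : (RR * RR) * RR => K p.1.1 p.2 p.1.2).
  apply: (perm _ (fun p => ((p.1.1, p.2), p.1.2)) mK).
  by apply: measurable_fun_pair => //; exact: measurable_fun_pair.
have LK0 a b : 0 <= L (K a b) by exact: wint_ge0.
have mLK : measurable_fun setT (fun p : RR * RR => L (K p.1 p.2)).
  by apply: (@measurable_wint_comp _ _ _ leb (fun=> 1%R) mo o0 _ (RR * RR)%type (fun p t => K p.1 p.2 t)).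
have mLK' : measurable_fun setT (fun p : RR * RR => L (K p.2 p.1)).
  by apply: (@measurable_wint_comp _ _ _ leb (fun=> 1%R) mo o0 _ (RR * RR)%type (fun p t => K p.2 p.1 t)).
have hK a b : sqd (h a) (h b) <= L (K a b) + L (K b a).
  wlog ba : a b / (b <= a)%R.
    move=> H; have [/H//|/ltW/H] := leP b a.
    by rewrite addeC sqdC.
  have [->|nab] := eqVneq b a; first by rewrite /sqd subrr expr0n adde_ge0.
  have {ba nab}ba : (b < a)%R by rewrite lt_neqAle nab.
  apply: (le_trans (hG _ _ ba)); rewrite -[leLHS]adde0 leeD//.
  rewrite -ge0_integralZl//; last 2 first.
    - by apply: measurable_funTS.
    - by rewrite lee_fin subr_ge0 ltW.
  rewrite integral_mkcond le_eqVlt; apply/orP; left; apply/eqP.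
  apply: eq_integral => t _; rewrite patchE mem_setE in_itv/= mul1e /K /betw.
  by case: ifP => _; rewrite ?mul1r// mul0r mul0e.
(* Tonelli brings the integral over [t] outside; the double mean of [betw a b t] then restores the
   Gaussian weight in front of [G t]. *)
have EK : E (fun a => E (fun b => L (K a b))) = E G.
  transitivity (E (fun a => L (fun t => E (fun b => K a b t)))).
    apply: eq_wint => a; apply: wint_swap => //.
    exact: (measurableT_comp mK (measurable_fun_pair (measurable_fun_pair (measurable_cst a) measurable_fst) measurable_snd)).
  rewrite (@wint_swap _ _ _ _ _ leb (@gpdf R) leb (fun=> 1%R) mw w0 mo o0 (fun a t => E (fun b => K a b t)))//; first last.
  - by move=> a t; exact: wint_ge0.
  - by apply: (@measurable_wint_comp _ _ _ leb (@gpdf R) mw w0 _ (RR * RR)%type (fun p b => K p.1 b p.2)).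
  rewrite /wint; apply: eq_integral => t _; rewrite mul1e.
  have mBt : measurable_fun setT (fun p : RR * RR => (betw p.1 p.2 t)%:E).
    apply: (@measurableT_comp _ _ _ _ _ _ _ _ (fun p : RR * RR => (p, t : RR)) mB).
    by apply: measurable_fun_pair.
  transitivity (E (fun a => G t * E (fun b => (betw a b t)%:E))).
    apply: eq_wint => a; rewrite -wintZl//.
    - by apply: eq_wint => b; rewrite /K muleC.
    - exact: (measurableT_comp mBt (measurable_pair1 a)).
    - by move=> b; rewrite lee_fin betw_ge0.
  rewrite wintZl ?wint_betw 1?muleC//.
  - by apply: (@measurable_wint_comp _ _ _ leb (@gpdf R) mw w0 _ RR (fun a b => (betw a b t)%:E)) => // a b; rewrite lee_fin betw_ge0.
  - by move=> a; apply: wint_ge0 => // b; rewrite lee_fin betw_ge0.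
apply: (@le_trans _ _ (E (fun a => E (fun b => L (K a b) + L (K b a))))).
  apply: (@le_wint2 _ _ _ _ _ leb (@gpdf R) leb (@gpdf R) mw w0 mw w0) => //.
  - by apply: measurable_sqd; exact: measurableT_comp.
  - by move=> a b; exact: sqd_ge0.
  - exact: emeasurable_funD.
have W := @wint2D _ _ _ _ _ leb (@gpdf R) leb (@gpdf R) mw w0 mw w0
  (fun a b => L (K a b)) (fun a b => L (K b a)) mLK LK0 mLK' (fun a b => LK0 b a).
have S := @wint_swap _ _ _ _ _ leb (@gpdf R) leb (@gpdf R) mw w0 mw w0
  (fun a b => L (K b a)) mLK' (fun a b => LK0 b a).
have EK' : E (fun a => E (fun b => L (K b a))) = E G by apply: etrans S EK.
have EG0 : 0 <= E G by exact: wint_ge0.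
exact (le_mul2_of_split EK EK' W EG0).
Qed.

Definition gdens n (x : 'rV[R]_n) : R := \prod_(i < n) gpdf (x ord0 i).

Notation EE n := (wint (@lebesgue_rV R n) (@gdens n)).

Lemma gdens_ge0 n x : (0 <= @gdens n x)%R.
Proof. by apply: prodr_ge0 => i _; exact: gpdf_ge0. Qed.

Lemma measurable_gdens n : measurable_fun setT (@gdens n).
Proof.
rewrite /gdens; apply: measurable_prod => i _.
exact: (measurableT_comp (@measurable_gpdf R) (@measurable_rV_coord R n i)).
Qed.

Lemma wint_rV_cons n (f : 'rV[R]_n.+1 -> \bar R) :
  measurable_fun setT f -> (forall x, 0 <= f x) ->
  EE n.+1 f = E (fun a => EE n (fun u => f (rV_cons (a, u)))).
Proof.
move=> mf f0; rewrite /wint integral_rV_cons; first last.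
- by move=> x; rewrite mule_ge0// lee_fin gdens_ge0.
- by apply: measurable_weight => //; exact: measurable_gdens.
apply: eq_integral => a _; rewrite -ge0_integralZl//; first last.
- by rewrite lee_fin gpdf_ge0.
- by move=> u _; rewrite mule_ge0// lee_fin gdens_ge0.
- apply: measurable_weight; first exact: measurable_gdens.
  exact: (measurableT_comp (measurable_rV_cons_slice mf) (measurable_pair1 a)).
apply: eq_integral => u _; rewrite muleA -EFinM; congr (_%:E * _).
rewrite /gdens big_ord_recl rV_cons0; congr (_ * _)%R.
by apply: eq_bigr => i _; rewrite rV_consS.
Qed.

Lemma integral_gdens n : \int[lebesgue_rV n]_x (@gdens n x)%:E = 1.
Proof.
elim: n => [|n IH].
  rewrite integral_rV0; last by apply/measurable_EFinP; exact: measurable_gdens.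
  by rewrite /gdens big_ord0.
have := @wint_rV_cons n (cst 1) (measurable_cst _) (fun=> @lee01 R).
have E1 : EE n (fun=> 1) = 1.
  by rewrite /wint -[RHS]IH; apply: eq_integral => x _; rewrite mule1.
rewrite /= (eq_wint _ _ (fun=> E1)) wint_cst// ?integral_gpdf// => <-.
by apply: eq_integral => x _; rewrite mule1.
Qed.

Lemma rV_cons_delta0 n (a t : R) (u : 'rV[R]_n) :
  (rV_cons (a, u) + t *: delta_mx ord0 ord0 = rV_cons (a + t, u))%R.
Proof.
apply/rowP => i; case: (unliftP ord0 i) => [j ->|->].
  have := rV_consS (a, u) j; have := rV_consS (a + t, u)%R j.
  move: (rV_cons (a, u)) (rV_cons (a + t, u)%R) => v v' /= E2 E1.
  by rewrite !mxE E1 E2 mulr0 addr0.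
have := rV_cons0 (a, u); have := rV_cons0 (a + t, u)%R.
move: (rV_cons (a, u)) (rV_cons (a + t, u)%R) => v v' /= E2 E1.
by rewrite !mxE E1 E2 mulr1.
Qed.

Lemma rV_cons_deltaS n (a t : R) (u : 'rV[R]_n) (j : 'I_n) :
  (rV_cons (a, u) + t *: delta_mx ord0 (lift ord0 j) = rV_cons (a, u + t *: delta_mx ord0 j))%R.
Proof.
apply/rowP => i; case: (unliftP ord0 i) => [k ->|->].
  have := rV_consS (a, u) k; have := rV_consS (a, u + t *: delta_mx ord0 j)%R k.
  move: (rV_cons (a, u)) (rV_cons (a, u + t *: delta_mx ord0 j)%R) => v v' /= E2 E1.
  by rewrite !mxE E1 E2 !mxE (inj_eq lift_inj).
have := rV_cons0 (a, u); have := rV_cons0 (a, u + t *: delta_mx ord0 j)%R.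
move: (rV_cons (a, u)) (rV_cons (a, u + t *: delta_mx ord0 j)%R) => v v' /= E2 E1.
by rewrite !mxE E1 E2 mulr0 addr0.
Qed.

(** Differentiability is replaced by an increment bound along coordinate lines, in which [G i] may
    be +oo. This admits the cone functions used on the sphere, which are singular at the origin. The
    induction splits off the first coordinate by [wint_tensor]. *)
Lemma gauss_poincare n (F : 'rV[R]_n -> R) (G : 'I_n -> 'rV[R]_n -> \bar R) :
  measurable_fun setT F -> (forall i, measurable_fun setT (G i)) ->
  (forall i x, 0 <= G i x) ->
  (forall i x (a b : R), (b < a)%R ->
     sqd (F (x + a *: delta_mx ord0 i)%R) (F (x + b *: delta_mx ord0 i)%R) <=
     (a - b)%:E * \int[leb]_(t in `]b, a]) G i (x + t *: delta_mx ord0 i)%R) ->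
  EE n (fun x => EE n (fun y => sqd (F x) (F y))) <=
  2%:E * \sum_(i < n) EE n (G i).
Proof.
elim: n F G => [|n IH] F G mF mG G0 hG.
  rewrite big_ord0 mule0 le_eqVlt; apply/orP; left; apply/eqP.
  rewrite /wint integral0_eq// => x _; rewrite integral0_eq ?mule0// => y _.
  rewrite (_ : y = x); last by apply/rowP => -[].
  by rewrite /sqd subrr expr0n mule0.
have mgn := @measurable_gdens n.
have gn0 := @gdens_ge0 n.
have mFc : measurable_fun setT (fun p : RR * 'rV[R]_n => F (rV_cons p)).
  exact: (measurableT_comp mF (measurable_rV_cons (n := n))).
have mGc i : measurable_fun setT (fun p : RR * 'rV[R]_n => G i (rV_cons p)).
  exact: measurable_rV_cons_slice.
pose H (a : RR) (u : 'rV[R]_n) := F (rV_cons (a, u)).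
have mH : measurable_fun setT (fun p : RR * 'rV[R]_n => H p.1 p.2).
  by rewrite (_ : (fun _ => _) = fun p => F (rV_cons p))//; apply/funext => -[].
have -> : EE n.+1 (fun x => EE n.+1 (fun y => sqd (F x) (F y))) =
    E (fun a => EE n (fun u => E (fun b => EE n (fun v => sqd (H a u) (H b v))))).
  rewrite wint_rV_cons; first last.
  - by move=> x; apply: wint_ge0; [exact: gdens_ge0|move=> y; exact: sqd_ge0].
  - apply: (@measurable_wint_comp _ _ _ _ _ (@measurable_gdens n.+1) (@gdens_ge0 n.+1)
      _ _ (fun x y => sqd (F x) (F y))); last by move=> *; exact: sqd_ge0.
    by apply: measurable_sqd; exact: measurableT_comp.
  apply: eq_wint => a; apply: eq_wint => u; rewrite wint_rV_cons//.
    exact: measurable_sqd.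
  by move=> x; exact: sqd_ge0.
apply: (le_trans (@wint_tensor _ _ _ _ _ leb (@gpdf R) (lebesgue_rV n) (@gdens n)
  mw w0 mgn gn0 (@integral_gpdf R) (integral_gdens n) _ mH)).
rewrite big_ord_recl ge0_muleDr; first last.
- by apply: sume_ge0 => i _; apply: wint_ge0; [exact: gdens_ge0|].
- by apply: wint_ge0; [exact: gdens_ge0|].
have mG2 i : measurable_fun setT (fun p : RR * 'rV[R]_n => G i (rV_cons (p.1, p.2))).
  by rewrite (_ : (fun _ => _) = fun p => G i (rV_cons p))//; apply/funext => -[].
have mG1 i (a : RR) : measurable_fun setT (fun u => G i (rV_cons (a, u))).
  exact: (measurableT_comp (mG2 i) (measurable_pair1 a)).
have mG3 i u : measurable_fun setT (fun a : RR => G i (rV_cons (a, u))).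
  exact: (measurableT_comp (mG2 i) (measurable_pair2 u)).
have mH1 a : measurable_fun setT (H a).
  exact: (measurableT_comp mH (measurable_pair1 a)).
have mH2 u : measurable_fun setT (H ^~ u).
  exact: (measurableT_comp mH (measurable_pair2 u)).
have mEG i : measurable_fun setT (fun a : RR => EE n (fun u => G i (rV_cons (a, u)))).
  by apply: (@measurable_wint_comp _ _ _ _ _ mgn gn0 _ RR (fun a u => G i (rV_cons (a, u)))).
have mHc d (T : measurableType d) (f : T -> RR) (g : T -> 'rV[R]_n) :
    measurable_fun setT f -> measurable_fun setT g ->
    measurable_fun setT (fun t => H (f t) (g t)).
  by move=> mf mg; exact: (measurableT_comp mH (measurable_fun_pair mf mg)).
have f1 d d' (T : measurableType d) (T' : measurableType d') := @measurable_fst _ _ T T'.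
have f2 d d' (T : measurableType d) (T' : measurableType d') := @measurable_snd _ _ T T'.
have co d d' d'' (T : measurableType d) (T' : measurableType d') (T'' : measurableType d'')
   := @measurableT_comp d d' d'' T T' T''.
(* The first coordinate is handled by the one-dimensional inequality with the others frozen, the
   others by the induction hypothesis with the first frozen. *)
rewrite addeC; apply: leeD.
  rewrite wint_rV_cons// (@wint_swap _ _ _ _ _ leb (@gpdf R) _ _ mw w0 mgn gn0
    (fun a u => G ord0 (rV_cons (a, u))))// -wintZl//; first last.
  - by move=> u; apply: wint_ge0.
  - by apply: (@measurable_wint_comp _ _ _ _ _ mw w0 _ _ (fun u a => G ord0 (rV_cons (a, u)))) => //;
      apply: (co _ _ _ _ _ _ _ setT (fun p => (p.2, p.1)) (mG2 ord0)); exact: measurable_fun_pair.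
  apply: le_wint => //.
  - apply: (@measurable_wint_comp _ _ _ _ _ mw w0 _ _
      (fun v a => E (fun b => sqd (H a v) (H b v)))); last first.
      by move=> v a; apply: wint_ge0 => // b; exact: sqd_ge0.
    apply: (@measurable_wint_comp _ _ _ _ _ mw w0 _ ('rV[R]_n * RR)%type
      (fun p b => sqd (H p.2 p.1) (H b p.1))); last by move=> *; exact: sqd_ge0.
    apply: measurable_sqd; apply: mHc => //.
    + by apply: (co _ _ _ _ _ _ snd).
    + by apply: (co _ _ _ _ _ _ fst).
    + by apply: (co _ _ _ _ _ _ fst).
  - apply: emeasurable_funM => //.
    by apply: (@measurable_wint_comp _ _ _ _ _ mw w0 _ _ (fun u a => G ord0 (rV_cons (a, u)))) => //;
      apply: (co _ _ _ _ _ _ _ setT (fun p => (p.2, p.1)) (mG2 ord0)); exact: measurable_fun_pair.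
  - by move=> v; apply: wint_ge0 => // a; apply: wint_ge0 => // b; exact: sqd_ge0.
  move=> v; apply: gauss_poincare1 => // a b ba.
  have := hG ord0 (rV_cons (0%R, v)) a b ba.
  rewrite !rV_cons_delta0 !add0r => /le_trans; apply.
  by under eq_integral => t _ do rewrite rV_cons_delta0 add0r.
rewrite (eq_bigr (fun i => E (fun a => EE n (fun u => G (lift ord0 i) (rV_cons (a, u)))))); last first.
  by move=> i _; rewrite wint_rV_cons.
rewrite -(@wint_sum _ _ _ _ _ mw w0 _ (index_enum 'I_n)
  (fun i a => EE n (fun u => G (lift ord0 i) (rV_cons (a, u)))))//; last first.
  by move=> i a; exact: wint_ge0.
rewrite -wintZl//; first last.
- by move=> a; apply: sume_ge0 => i _; exact: wint_ge0.
- by apply: emeasurable_sum.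
apply: le_wint => //.
- apply: (@measurable_wint_comp _ _ _ _ _ mgn gn0 _ _
    (fun a u => EE n (fun v => sqd (H a u) (H a v)))); last first.
    by move=> a u; apply: wint_ge0 => // v; exact: sqd_ge0.
  apply: (@measurable_wint_comp _ _ _ _ _ mgn gn0 _ (RR * 'rV[R]_n)%type
    (fun p v => sqd (H p.1 p.2) (H p.1 v))); last by move=> *; exact: sqd_ge0.
  apply: measurable_sqd; apply: mHc => //.
  + by apply: (co _ _ _ _ _ _ fst).
  + by apply: (co _ _ _ _ _ _ snd).
  + by apply: (co _ _ _ _ _ _ fst).
- by apply: emeasurable_funM => //; exact: emeasurable_sum.
- by move=> a; apply: wint_ge0 => // u; apply: wint_ge0 => // v; exact: sqd_ge0.
move=> a; apply: IH => // i u c b bc.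
have := hG (lift ord0 i) (rV_cons (a, u)) c b bc.
rewrite !rV_cons_deltaS => /le_trans; apply.
by under eq_integral => t _ do rewrite rV_cons_deltaS.
Qed.

End gauss_poincare.
(** * Calculus off the origin *)

Section Ck.
Context {R : realType} {n : nat}.
Notation V := 'rV[R]_n.
Implicit Types (f g : V -> R) (x : V) (i : 'I_n).

Definition pd i g : V -> R := 'D_(delta_mx ord0 i) g.

(** Class C^k on the complement of the origin, for functions defined everywhere: the value at 0 is
    arbitrary, so inverse powers of |x| qualify. Only iterated partial derivatives and their
    continuity are mentioned; [is_derive_chain] draws a chain rule from them. *)
Fixpoint Ck (k : nat) (g : V -> R) : Prop :=
  (forall x, x != 0 -> {for x, continuous g}) /\
  if k is k'.+1 then
    forall i, (forall x, x != 0 -> derivable g x (delta_mx ord0 i)) /\ Ck k' (pd i g)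
  else True.

Lemma near_neq0 x : x != 0 -> \forall y \near x, y != 0 :> V.
Proof.
move=> x0; have oU : open [set y : V | enorm y != 0].
  apply: (@open_comp _ _ (@enorm R n) [set t | t != 0]); last exact: open_neq.
  by move=> y _; exact: enorm_continuous.
have nU : nbhs x [set y : V | enorm y != 0].
  by apply: open_nbhs_nbhs; split => //=; rewrite enorm_eq0.
by apply: filterS nU => y /=; rewrite enorm_eq0.
Qed.

Lemma near_eq_neq0 f g x : x != 0 -> (forall y, y != 0 -> f y = g y) ->
  \forall y \near x, f y = g y.
Proof. by move=> /near_neq0 nx fg; apply: filterS nx => y; exact: fg. Qed.

Lemma continuous_at_ext f g x : x != 0 -> (forall y, y != 0 -> f y = g y) ->
  {for x, continuous f} -> {for x, continuous g}.
Proof.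
move=> x0 fg cf; have cf' : f y @[y --> x] --> g x by rewrite -fg.
suff : g y @[y --> x] --> g x by [].
apply: cvg_trans cf'; apply: (@near_eq_cvg _ _ (nbhs x) (nbhs_filter x)).
by apply: filterS (near_neq0 x0) => y y0; rewrite fg.
Qed.

Lemma pd_eq f g i x : x != 0 -> (forall y, y != 0 -> f y = g y) -> pd i f x = pd i g x.
Proof. by move=> x0 fg; apply: near_eq_derive; exact: near_eq_neq0. Qed.

Lemma Ck_cont k g x : Ck k g -> x != 0 -> {for x, continuous g}.
Proof. by case: k => [|k] [cg _]; exact: cg. Qed.

Lemma Ck_derivable k g i x : Ck k.+1 g -> x != 0 -> derivable g x (delta_mx ord0 i).
Proof. by move=> [_ /(_ i)[dg _]]; exact: dg. Qed.

Lemma Ck_pd k g i : Ck k.+1 g -> Ck k (pd i g).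
Proof. by move=> [_ /(_ i)[]]. Qed.

Lemma Ck_ext k f g : (forall x, x != 0 -> f x = g x) -> Ck k f -> Ck k g.
Proof.
elim: k f g => [|k IH] f g fg.
  by move=> [cf _]; split => // x x0; apply: continuous_at_ext (cf x x0).
move=> [cf df]; split; first by move=> x x0; apply: continuous_at_ext (cf x x0).
move=> i; have [dfi Ci] := df i; split.
  by move=> x x0; apply: near_eq_derivable (dfi x x0); apply: near_eq_neq0.
by apply: IH Ci => x x0; exact: pd_eq.
Qed.

Lemma CkW k g : Ck k.+1 g -> Ck k g.
Proof.
elim: k g => [|k IH] g [cg dg]; split => // i; have [dgi Ci] := dg i; split => //.
exact: IH.
Qed.

Lemma Ck_le k m g : (k <= m)%N -> Ck m g -> Ck k g.
Proof.
move=> /subnK <-; elim: (m - k)%N => // j IH; rewrite addSn => /CkW; exact: IH.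
Qed.

Lemma pd_cst c i x : pd i (fun=> c) x = 0.
Proof. exact: derive_cst. Qed.

Lemma Ck_cst k c : Ck k (fun=> c).
Proof.
elim: k c => [|k IH] c; first by split => // x _; exact: cst_continuous.
split=> [x _|i]; first exact: cst_continuous.
split=> [x _|]; first exact: derivable_cst.
by apply: Ck_ext (IH 0) => x _; rewrite pd_cst.
Qed.

Lemma pdD f g i x : Ck 1 f -> Ck 1 g -> x != 0 ->
  pd i (fun y => f y + g y) x = pd i f x + pd i g x.
Proof. by move=> Cf Cg x0; apply: deriveD; apply: (Ck_derivable (k := 0)). Qed.

Lemma pdM f g i x : Ck 1 f -> Ck 1 g -> x != 0 ->
  pd i (fun y => f y * g y) x = f x * pd i g x + g x * pd i f x.
Proof. by move=> Cf Cg x0; apply: deriveM; apply: (Ck_derivable (k := 0)). Qed.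

Lemma Ck_add k f g : Ck k f -> Ck k g -> Ck k (fun x => f x + g x).
Proof.
elim: k f g => [|k IH] f g Cf Cg.
  by split => // x x0; apply: continuous_at_add; [exact: Ck_cont Cf x0|exact: Ck_cont Cg x0].
split=> [x x0|i]; first by apply: continuous_at_add; [exact: Ck_cont Cf x0|exact: Ck_cont Cg x0].
split=> [x x0|].
  by apply: derivableD; [exact: Ck_derivable Cf x0|exact: Ck_derivable Cg x0].
apply: Ck_ext (IH _ _ (Ck_pd i Cf) (Ck_pd i Cg)) => x x0.
by rewrite pdD//; apply: Ck_le (_ : (1 <= k.+1)%N) _.
Qed.

Lemma Ck_mul k f g : Ck k f -> Ck k g -> Ck k (fun x => f x * g x).
Proof.
elim: k f g => [|k IH] f g Cf Cg.
  by split => // x x0; apply: continuous_at_mul; [exact: Ck_cont Cf x0|exact: Ck_cont Cg x0].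
split=> [x x0|i]; first by apply: continuous_at_mul; [exact: Ck_cont Cf x0|exact: Ck_cont Cg x0].
split=> [x x0|].
  by apply: derivableM; [exact: Ck_derivable Cf x0|exact: Ck_derivable Cg x0].
apply: Ck_ext (Ck_add (IH _ _ (CkW Cf) (Ck_pd i Cg)) (IH _ _ (CkW Cg) (Ck_pd i Cf))) => x x0.
by rewrite pdM//; apply: Ck_le (_ : (1 <= k.+1)%N) _.
Qed.

Lemma Ck_scale k c f : Ck k f -> Ck k (fun x => c * f x).
Proof. by move=> Cf; apply: Ck_mul => //; exact: Ck_cst. Qed.

Lemma pdZ c f i x : Ck 1 f -> x != 0 -> pd i (fun y => c * f y) x = c * pd i f x.
Proof. by move=> Cf x0; rewrite pdM ?pd_cst ?mulr0 ?addr0//; exact: Ck_cst. Qed.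

Lemma Ck_opp k f : Ck k f -> Ck k (fun x => - f x).
Proof. by move=> Cf; apply: Ck_ext (Ck_scale (-1) Cf) => x _; rewrite mulN1r. Qed.

Lemma pdN f i x : Ck 1 f -> x != 0 -> pd i (fun y => - f y) x = - pd i f x.
Proof.
by move=> Cf x0; rewrite (pd_eq (g := fun y => -1 * f y)) ?pdZ ?mulN1r// => y _; rewrite mulN1r.
Qed.

Lemma pdB f g i x : Ck 1 f -> Ck 1 g -> x != 0 ->
  pd i (fun y => f y - g y) x = pd i f x - pd i g x.
Proof. by move=> Cf Cg x0; rewrite (pdD i Cf (Ck_opp Cg) x0) (pdN i Cg x0). Qed.

Lemma Ck_sum k m (F : 'I_m -> V -> R) : (forall j, Ck k (F j)) ->
  Ck k (fun x => \sum_(j < m) F j x).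
Proof.
elim: m F => [|m IH] F CF.
  by apply: Ck_ext (Ck_cst k 0) => x _; rewrite big_ord0.
apply: Ck_ext (Ck_add (CF ord0) (IH (fun j => F (lift ord0 j)) _)) => // x _.
by rewrite big_ord_recl.
Qed.

Lemma pd_sum m (F : 'I_m -> V -> R) i x : (forall j, Ck 1 (F j)) -> x != 0 ->
  pd i (fun y => \sum_(j < m) F j y) x = \sum_(j < m) pd i (F j) x.
Proof.
elim: m F => [|m IH] F CF x0.
  rewrite big_ord0; transitivity (pd i (fun=> 0) x); last exact: pd_cst.
  by congr (pd i _ x); apply/funext => y; rewrite big_ord0.
rewrite big_ord_recl -IH// -pdD//; last exact: Ck_sum.
by congr (pd i _ x); apply/funext => y; rewrite big_ord_recl.
Qed.

Lemma is_derive_coord x v (j : 'I_n) : is_derive x v (fun y : V => y ord0 j) (v ord0 j).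
Proof.
have E : (fun h : R => h^-1 *: (((fun y : V => y ord0 j) \o shift x) (h *: v) - x ord0 j)) @ 0^' --> v ord0 j.
  apply: cvg_near_cst; near=> h; rewrite /= !mxE addrK.
  by rewrite /GRing.scale /= mulrA mulVf ?mul1r//; near: h; exact: nbhs_dnbhs_neq.
split; first by apply/cvg_ex; eexists; exact: E.
exact: cvg_lim E.
Unshelve. all: by end_near. Qed.

Lemma pd_coord (j i : 'I_n) x : pd i (fun y : V => y ord0 j) x = (j == i)%:R.
Proof.
rewrite /pd; have [_ ->] := is_derive_coord x (delta_mx ord0 i) j.
by rewrite mxE eqxx.
Qed.

Lemma Ck_coord k (j : 'I_n) : Ck k (fun y : V => y ord0 j).
Proof.
case: k => [|k]; first by split => // x _; exact: coord_continuous.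
split=> [x _|i]; first exact: coord_continuous.
split=> [x _|]; first by have [] := is_derive_coord x (delta_mx ord0 i) j.
by apply: Ck_ext (Ck_cst k (j == i)%:R) => x _; rewrite pd_coord.
Qed.

Definition nsq (x : V) : R := \sum_(j < n) x ord0 j * x ord0 j.

Lemma nsqE x : nsq x = enorm x ^+ 2.
Proof. by rewrite enorm_sqr; apply: eq_bigr => i _; rewrite expr2. Qed.

Lemma nsq_gt0 x : x != 0 -> 0 < nsq x.
Proof. by move=> x0; rewrite nsqE exprn_gt0// enorm_gt0. Qed.

Lemma Ck_nsq k : Ck k nsq.
Proof. by apply: Ck_sum => j; apply: Ck_mul; exact: Ck_coord. Qed.

Lemma pd_nsq i x : x != 0 -> pd i nsq x = 2 * x ord0 i.
Proof.
move=> x0; rewrite /nsq pd_sum//; last by move=> j; apply: Ck_mul; exact: Ck_coord.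
rewrite (bigD1 i)//= big1 ?addr0; last first.
  move=> j ji; rewrite (pdM i (Ck_coord 1 j) (Ck_coord 1 j) x0).
  by rewrite pd_coord (negbTE ji) !mulr0 addr0.
by rewrite (pdM i (Ck_coord 1 i) (Ck_coord 1 i) x0) pd_coord eqxx mulr1 -mulr2n mulr_natl.
Qed.

Definition q (x : V) : R := (nsq x)^-1.

Lemma nsq_sum x : nsq x = \sum_(j < n) x ord0 j * x ord0 j.
Proof. by []. Qed.

Lemma qE x : q x = (nsq x)^-1.
Proof. by []. Qed.

Lemma derivable_q i x : x != 0 -> derivable q x (delta_mx ord0 i).
Proof.
move=> x0; apply: derivableV; first by rewrite gt_eqF ?nsq_gt0.
exact: (@Ck_derivable 0 _ i _ (Ck_nsq 1)).
Qed.

Lemma pd_q i x : x != 0 -> pd i q x = - 2 * (x ord0 i * (q x * q x)).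
Proof.
move=> x0; have n0 : nsq x != 0 by rewrite gt_eqF ?nsq_gt0.
rewrite /pd deriveV//; last exact: (@Ck_derivable 0 _ i _ (Ck_nsq 1)).
rewrite -/(pd i nsq x) pd_nsq// /GRing.scale/= /q; field.
exact: n0.
Qed.

Lemma Ck_q k : Ck k q.
Proof.
have cq x : x != 0 -> {for x, continuous q}.
  move=> x0; apply: continuous_at_inv; first by rewrite gt_eqF ?nsq_gt0.
  exact: Ck_cont (Ck_nsq 0) x0.
elim: k => [|k IH]; split => // i; split; first by move=> x; exact: derivable_q.
apply: Ck_ext (Ck_scale (-2) (Ck_mul (Ck_coord k i) (Ck_mul IH IH))) => x x0.
by rewrite pd_q.
Qed.

Lemma smooth_Ck g k : smooth g -> Ck k g.
Proof.
move=> sg; suff h s : Ck k (partials s g) by exact: (h [::]).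
elim: k s => [|k IH] s; have [cs ds] := sg s; split => //.
- by move=> x _; exact: cs.
- by move=> x _; exact: cs.
move=> i.
split; first by move=> x _; exact: ds.
exact: (IH (i :: s)).
Qed.

End Ck.

(** * The chain rule and the symmetry of second derivatives *)

Lemma cvg_sum_ord (R : realType) (T : Type) (F : set_system T) (FF : Filter F) m
    (f : 'I_m -> T -> R) (l : 'I_m -> R) :
  (forall j, f j x @[x --> F] --> l j) ->
  (\sum_(j < m) f j x) @[x --> F] --> \sum_(j < m) l j.
Proof.
elim: m f l => [|m IH] f l fl.
  rewrite big_ord0 (_ : (fun x => _) = cst 0); first exact: cvg_cst.
  by apply/funext => x; rewrite big_ord0.
rewrite big_ord_recl (_ : (fun x => _) = fun x => f ord0 x + \sum_(j < m) f (lift ord0 j) x).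
  by apply: cvgD; [exact: fl|exact: (IH (fun j => f (lift ord0 j)))].
by apply/funext => x; rewrite big_ord_recl.
Qed.

Section chain_rule.
Context {R : realType} {n : nat}.
Notation V := 'rV[R]_n.
Implicit Types (f g : V -> R) (x y z : V) (i j : 'I_n).
Notation dl i := (delta_mx ord0 i : V).

Lemma nbhs_box y (P : set V) : nbhs y P ->
  exists2 d : R, 0 < d & forall z, (forall i, `|z ord0 i - y ord0 i| < d) -> P z.
Proof.
move=> /nbhs_ballP[d /= d0 dP]; exists d => // z zd; apply: dP; split => // i j.
by rewrite (ord1 i) /ball /= distrC.
Qed.

Lemma continuous_box g y (e : R) : {for y, continuous g} -> 0 < e ->
  exists2 d : R, 0 < d & forall z, (forall i, `|z ord0 i - y ord0 i| < d) -> `|g z - g y| < e.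
Proof.
move=> cg e0.
have /nbhs_box : nbhs y [set z | `|g z - g y| < e].
  have : nbhs (g y) (ball (g y) e) by exact: nbhsx_ballx.
  move=> /cg h; apply: (@filterS _ (nbhs y) (nbhs_filter y) _ _ _ h) => z /=.
  by rewrite /ball/= distrC.
by case=> d d0 h; exists d.
Qed.

Lemma MVT_line g i y (s : R) : Ck 1 g ->
  (forall t : R, `|t| <= `|s| -> y + t *: dl i != 0) ->
  exists2 t : R, `|t| <= `|s| & g (y + s *: dl i) - g y = s * pd i g (y + t *: dl i).
Proof.
move=> Cg y0.
have der (t : R) : `|t| <= `|s| ->
    is_derive t 1 (fun t : R => g (y + t *: dl i)) (pd i g (y + t *: dl i)).
  by move=> ts; apply: is_derive_line; apply: (@Ck_derivable _ _ 0) => //; exact: y0.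
have con (a b : R) : `|a| <= `|s| -> `|b| <= `|s| ->
    {within `[a, b], continuous (fun t : R => g (y + t *: dl i))}.
  move=> ha hb; apply: derivable_within_continuous => t.
  rewrite in_itv/= => /andP[at_ tb].
  have [|//] := der t; move: ha hb; rewrite !ler_norml => /andP[? ?] /andP[? ?].
  by apply/andP; split; [exact: le_trans at_|exact: le_trans tb _].
have [s0|s0] := leP 0 s.
  have [|||t] := @MVT_segment R (fun t => g (y + t *: dl i)) (fun t => pd i g (y + t *: dl i)) 0 s.
  - by [].
  - move=> t; rewrite in_itv/= => /andP[t0 ts]; apply: der.
    by rewrite !ger0_norm// ltW.
  - by apply: con; rewrite ?normr0.
  rewrite in_itv/= => /andP[t0 ts] E; exists t; first by rewrite !ger0_norm.
  by move: E; rewrite scale0r addr0 subr0 mulrC.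
have [|||t] := @MVT_segment R (fun t => g (y + t *: dl i)) (fun t => pd i g (y + t *: dl i)) s 0.
- exact: ltW.
- move=> t; rewrite in_itv/= => /andP[st t0]; apply: der.
  by rewrite !ltr0_norm// lerN2 ltW.
- by apply: con; rewrite ?normr0.
rewrite in_itv/= => /andP[st t0] E; exists t.
  by rewrite ler0_norm// ltr0_norm// lerN2.
move: E; rewrite scale0r addr0 sub0r mulrN => /(congr1 -%R).
by rewrite opprB opprK mulrC.
Qed.

(** Goes from [y] to [y + k] along axis-parallel segments, all inside the box, with the mean value
    theorem on each. *)
Lemma C1_increment g y (k : V) : Ck 1 g ->
  (forall z, (forall i, `|z ord0 i - y ord0 i| <= `|k ord0 i|) -> z != 0) ->
  exists2 xi : 'I_n -> V, (forall j i, `|xi j ord0 i - y ord0 i| <= `|k ord0 i|) &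
    g (y + k) - g y = \sum_(j < n) k ord0 j * pd j g (xi j).
Proof.
move=> Cg bx.
(* [P m] has the first [m] coordinates of [y + k] and the remaining ones of [y]. *)
pose P (m : nat) : V := y + \row_i (if (i < m)%N then k ord0 i else 0).
have P0 : P 0%N = y by apply/rowP => i; rewrite !mxE addr0.
have Pn : P n = y + k by apply/rowP => i; rewrite !mxE ltn_ord.
have PS (j : 'I_n) : P j.+1 = P j + k ord0 j *: dl j.
  apply/rowP => i; rewrite !mxE eqxx /= ltnS leq_eqVlt -addrA; congr (_ + _).
  have -> : (nat_of_ord i == nat_of_ord j) = (i == j) by [].
  by case: eqVneq => [->|] /=; rewrite ?ltnn ?mulr1 ?mulr0 ?add0r ?addr0.
have Pbox (j : 'I_n) t i : `|t| <= `|k ord0 j| ->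
    `|(P j + t *: dl j) ord0 i - y ord0 i| <= `|k ord0 i|.
  move=> tk; rewrite !mxE eqxx /= addrAC [y _ _ + _]addrC addrK.
  case: eqVneq => [->|_]; first by rewrite ltnn add0r mulr1.
  by rewrite mulr0 addr0; case: ifP => // _; rewrite normr0.
have step j : exists z, (forall i, `|z ord0 i - y ord0 i| <= `|k ord0 i|) /\
    g (P j.+1) - g (P j) = k ord0 j * pd j g z.
  have [t tk E] := @MVT_line g j (P j) (k ord0 j) Cg (fun t tk => bx _ (fun i => Pbox j t i tk)).
  by exists (P j + t *: dl j); split; [move=> i; exact: Pbox|rewrite PS].
have [xi xiP] := choice step; exists xi; first by move=> j; have [] := xiP j.
rewrite -Pn; have -> : g y = g (P 0%N) by rewrite P0.
rewrite -(telescope_sumr (fun m => g (P m)))// big_mkord.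
by apply: eq_bigr => j _; have [_] := xiP j.
Qed.

(** The increment is expanded by [C1_increment]; its intermediate points tend to [phi x], where the
    partial derivatives of [g] are continuous. *)
Lemma is_derive_chain g (phi : V -> V) x (v : V) (dphi : 'I_n -> R) :
  Ck 1 g -> phi x != 0 ->
  (forall j, is_derive x v (fun z => phi z ord0 j) (dphi j)) ->
  is_derive x v (fun z => g (phi z)) (\sum_(j < n) dphi j * pd j g (phi x)).
Proof.
move=> Cg phi0 dp; set y := phi x.
pose k (h : R) : V := phi (h *: v + x) - y.
have kc j : (h^-1 * k h ord0 j) @[h --> 0^'] --> dphi j.
  have [d1 d2] := dp j; rewrite -d2; apply: cvg_trans d1; apply: near_eq_cvg.
  by near=> h; rewrite /k /= !mxE.
have k0 j : k h ord0 j @[h --> 0^'] --> 0.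
  have : (h * (h^-1 * k h ord0 j)) @[h --> 0^'] --> 0 * dphi j.
    by apply: cvgM; [exact: cvg_within|exact: kc].
  rewrite mul0r; apply: cvg_trans; apply: near_eq_cvg; near=> h.
  by rewrite mulrA divff ?mul1r//; near: h; exact: nbhs_dnbhs_neq.
have [d d0 dU] := nbhs_box (near_neq0 phi0).
have kd (e : R) : 0 < e -> \forall h \near 0^', forall j, `|k h ord0 j| < e.
  move=> e0; apply: filter_forall => j.
  by have /cvgrPdist_lt/(_ e e0) := k0 j; apply: filterS => h; rewrite sub0r normrN.
(* Intermediate points are chosen for all [h] at once, with the dummy value 0 where the increment
   leaves the box on which [g] is differentiable. *)
have H (h : R) : exists xi : 'I_n -> V, (forall j, `|k h ord0 j| < d) ->
    (forall j i, `|xi j ord0 i - y ord0 i| <= `|k h ord0 i|) /\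
    g (y + k h) - g y = \sum_(j < n) k h ord0 j * pd j g (xi j).
  have [kh|] := pselect (forall j, `|k h ord0 j| < d); last by exists (fun=> 0).
  have [xi h1 h2] := @C1_increment g y (k h) Cg (fun z zk => dU z (fun i => le_lt_trans (zk i) (kh i))).
  by exists xi.
have [xi xiP] := choice H.
have C : (\sum_(j < n) (h^-1 * k h ord0 j) * pd j g (xi h j)) @[h --> 0^'] -->
    \sum_(j < n) dphi j * pd j g y.
  apply: cvg_sum_ord => j; apply: cvgM; first exact: kc.
  apply/cvgrPdist_lt => e e0.
  have [d' d'0 hd'] := continuous_box (Ck_cont (Ck_pd j Cg) phi0) e0.
  near=> h; rewrite distrC; apply: hd' => i.
  have kh : forall j, `|k h ord0 j| < d by near: h; exact: kd.
  have [h1 _] := xiP h kh; apply: le_lt_trans (h1 j i) _.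
  by move: i; near: h; exact: kd.
have E : h^-1 *: (((fun z => g (phi z)) \o shift x) (h *: v) - g (phi x)) @[h --> 0^'] -->
    \sum_(j < n) dphi j * pd j g y.
  apply: cvg_trans C; apply: near_eq_cvg; near=> h.
  have kh : forall j, `|k h ord0 j| < d by near: h; exact: kd.
  have [_ h2] := xiP h kh.
  have -> : ((fun z => g (phi z)) \o shift x) (h *: v) = g (y + k h).
    by rewrite /=; congr (g _); rewrite /k [RHS]addrC subrK.
  rewrite h2 /GRing.scale /= mulr_sumr; by apply: eq_bigr => j _; rewrite mulrA.
split; first by apply/cvg_ex; eexists; exact: E.
exact: cvg_lim E.
Unshelve. all: by end_near. Qed.

(** The second difference over a small square is symmetric in the two directions, and two uses of
    the mean value theorem make it h^2 times either mixed derivative at a nearby point. Continuity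
    then excludes distinct limits. *)
Lemma schwarz_pd g i j x : Ck 2 g -> x != 0 -> pd i (pd j g) x = pd j (pd i g) x.
Proof.
move=> Cg x0.
have swap4 (p a b c : R) : p - b - (a - c) = p - a - (b - c) by ring.
have quarter (u : R) : 0 < u -> u / 4 + u / 4 < u by lra.
have C1 l : Ck 1 (pd l g) := Ck_pd l Cg.
have Cg1 : Ck 1 g := CkW Cg.
have [d d0 dU] := nbhs_box (near_neq0 x0).
have inc a b (h : R) : 0 < h -> h + h < d -> exists z,
   (forall l, `|z ord0 l - x ord0 l| <= h + h) /\
   g (x + h *: dl a + h *: dl b) - g (x + h *: dl b) - (g (x + h *: dl a) - g x) =
   h * (h * pd b (pd a g) z).
  move=> h0 hd; have nh : `|h| = h by rewrite ger0_norm// ltW.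
  have hpos s : 0 <= s <= h -> `|s| <= h by case/andP=> s0 sh; rewrite ger0_norm.
  have bx (s t : R) : `|s| <= h -> `|t| <= h ->
      forall l, `|(x + s *: dl a + t *: dl b) ord0 l - x ord0 l| <= h + h.
    move=> sh th l; rewrite !mxE eqxx /=.
    have -> (u v w : R) : u + v + w - u = v + w by ring.
    rewrite (le_trans (ler_normD _ _))// lerD//.
      by case: (l == a); rewrite ?mulr1// mulr0 normr0 ltW.
    by case: (l == b); rewrite ?mulr1// mulr0 normr0 ltW.
  have bx0 (s t : R) : `|s| <= h -> `|t| <= h -> x + s *: dl a + t *: dl b != 0.
    by move=> sh th; apply: dU => l; apply: le_lt_trans hd; exact: bx.
  pose A (s : R) := g (x + h *: dl b + s *: dl a) - g (x + s *: dl a).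
  have dA (s : R) : 0 <= s <= h ->
      is_derive s 1 A (pd a g (x + h *: dl b + s *: dl a) - pd a g (x + s *: dl a)).
    move=> sh; apply: is_deriveB; apply: is_derive_line; apply: (@Ck_derivable _ _ 0) => //.
      by rewrite addrAC; apply: bx0; [exact: hpos|rewrite nh].
    have := bx0 s 0 (hpos _ sh); rewrite normr0 scale0r addr0; apply; exact: ltW.
  have [|||s] := @MVT_segment R A (fun s => pd a g (x + h *: dl b + s *: dl a) - pd a g (x + s *: dl a)) 0 h.
  - exact: ltW.
  - by move=> s; rewrite in_itv/= => /andP[s0 sh]; apply: dA; rewrite !ltW.
  - apply: derivable_within_continuous => s; rewrite in_itv/= => sh.
    by have [] := dA s sh.
  rewrite in_itv/= => sh; rewrite /A scale0r !addr0 subr0 => EA.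
  have [|t th Et] := @MVT_line (pd a g) b (x + s *: dl a) h (C1 a).
    by rewrite nh => t th; apply: bx0 => //; exact: hpos.
  exists (x + s *: dl a + t *: dl b); split.
    by apply: bx; [exact: hpos|rewrite -nh].
  rewrite -Et [x + s *: dl a + _]addrAC mulrC -EA.
  by rewrite [x + h *: dl a + _]addrAC; ring.
apply/eqP; apply: contraT => neq.
set e := `|pd i (pd j g) x - pd j (pd i g) x| / 2.
have e0 : 0 < e by rewrite divr_gt0// normr_gt0 subr_eq0.
have [d1 d10 hd1] := continuous_box (Ck_cont (Ck_pd i (C1 j)) x0) e0.
have [d2 d20 hd2] := continuous_box (Ck_cont (Ck_pd j (C1 i)) x0) e0.
pose m := Num.min d (Num.min d1 d2).
have m0 : 0 < m by rewrite !lt_min d0 d10.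
pose h := m / 4; have h0 : 0 < h by rewrite divr_gt0.
have hm : h + h < m by exact: quarter.
have [md md1 md2] : [/\ h + h < d, h + h < d1 & h + h < d2].
  by move: hm; rewrite !lt_min => /and3P[].
have [z1 [b1 E1]] := inc j i h h0 md.
have [z2 [b2 E2]] := inc i j h h0 md.
have Ez : pd i (pd j g) z1 = pd j (pd i g) z2.
  have hn0 : h != 0 by rewrite gt_eqF.
  apply: (mulfI hn0); apply: (mulfI hn0).
  apply: (etrans (esym E1)); apply: etrans _ E2.
  rewrite (addrAC x (h *: dl j) (h *: dl i)); exact: swap4.
have l1 := hd1 z1 (fun l => le_lt_trans (b1 l) md1).
have l2 := hd2 z2 (fun l => le_lt_trans (b2 l) md2).
have : `|pd i (pd j g) x - pd j (pd i g) x| < e + e.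
  rewrite -[X in `|X|](subrKA (pd i (pd j g) z1)) {2}Ez.
  apply: le_lt_trans (ler_normD _ _) _.
  by apply: ltrD; [rewrite distrC; exact: l1|exact: l2].
by rewrite /e -splitr ltxx.
Unshelve. all: by end_near. Qed.

End chain_rule.

(** * Differentiable functions supported in an annulus, and their integrals *)

Section annular_class.
Context {R : realType} {n : nat}.
Notation V := 'rV[R]_n.
Notation mu := (@lebesgue_rV R n).
Implicit Types (f g h : V -> R) (x : V) (i j : 'I_n).

(* Such a [g] is C^k across the origin as well, being zero around it. *)
Definition An k g := Ck k g /\ annular g.

Lemma annular0 g : annular g -> g 0 = 0.
Proof.
move=> [[a b] /= [a0 gab]]; apply/eqP; apply: contraT => /gab /andP[+ _].
have -> : enorm (0 : V) = 0 by apply/eqP; rewrite enorm_eq0.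
by rewrite leNgt a0.
Qed.

Lemma annular_mull f g : annular g -> annular (fun x => f x * g x).
Proof.
move=> [[a b] [a0 gab]]; exists (a, b); split => // x.
by rewrite mulf_eq0 negb_or => /andP[_ /gab].
Qed.

Lemma annular_mulr f g : annular g -> annular (fun x => g x * f x).
Proof.
by move=> /(annular_mull f); congr annular; apply/funext => x; rewrite mulrC.
Qed.

Lemma annular_cst0 : annular (fun _ : V => 0).
Proof. by exists (1, 1); split => // x; rewrite eqxx. Qed.

Lemma annular_add f g : annular f -> annular g -> annular (fun x => f x + g x).
Proof.
move=> [[a b] /= [a0 fab]] [[c d] /= [c0 gcd]].
exists (Num.min a c, Num.max b d) => /=; split; first by rewrite lt_min a0.
move=> x; have [fx|/fab/andP[ax xb] _] := eqVneq (f x) 0; last first.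
  by rewrite ge_min ax /= le_max xb.
by rewrite fx add0r => /gcd/andP[cx xd]; rewrite ge_min cx orbT le_max xd orbT.
Qed.

Lemma An_cont g : An 0 g -> continuous g.
Proof.
move=> [Cg ag] x; have [->|x0] := eqVneq x 0; last exact: Ck_cont Cg x0.
have [[a b] /= [a0 gab]] := ag.
have oU : open [set y : V | enorm y < a].
  apply: (@open_comp _ _ (@enorm R n) [set t | t < a]); last exact: open_lt.
  by move=> y _; exact: enorm_continuous.
have nU : nbhs (0 : V) [set y : V | enorm y < a].
  apply: open_nbhs_nbhs; split => //=.
  by have -> : enorm (0 : V) = 0 by apply/eqP; rewrite enorm_eq0.
suff : g y @[y --> (0 : V)] --> g 0 by [].
have c0 : (fun _ : V => 0 : R) y @[y --> (0 : V)] --> g 0.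
  by rewrite (annular0 ag); exact: (@cst_continuous V R 0 0).
apply: cvg_trans c0; apply: (@near_eq_cvg _ _ (nbhs (0 : V)) (nbhs_filter (0 : V))).
apply: filterS nU => y /= ya; apply/esym/eqP; apply: contraT => /gab /andP[ay _].
by move: ya; rewrite ltNge ay.
Qed.

Lemma An_derivable g i x : An 1 g -> derivable g x (delta_mx ord0 i).
Proof.
move=> [Cg ag]; have [->|x0] := eqVneq x 0; last exact: (@Ck_derivable _ _ 0).
have [[a b] /= [a0 gab]] := ag.
have oU : open [set y : V | enorm y < a].
  apply: (@open_comp _ _ (@enorm R n) [set t | t < a]); last exact: open_lt.
  by move=> y _; exact: enorm_continuous.
have nU : nbhs (0 : V) [set y : V | enorm y < a].
  apply: open_nbhs_nbhs; split => //=.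
  by have -> : enorm (0 : V) = 0 by apply/eqP; rewrite enorm_eq0.
apply: (@near_eq_derivable _ _ _ (cst 0)); last exact: derivable_cst.
apply: filterS nU => y /= ya; apply/esym/eqP; apply: contraT => /gab /andP[ay _].
by move: ya; rewrite ltNge ay.
Qed.

Lemma An_pd k g i : An k.+1 g -> An k (pd i g).
Proof. by move=> [Cg ag]; split; [exact: Ck_pd|exact: annular_derive]. Qed.

Lemma An_le k m g : (k <= m)%N -> An m g -> An k g.
Proof. by move=> km [Cg ag]; split => //; exact: Ck_le Cg. Qed.

Lemma An_mull k f g : Ck k f -> An k g -> An k (fun x => f x * g x).
Proof. by move=> Cf [Cg ag]; split; [exact: Ck_mul|exact: annular_mull]. Qed.

Lemma An_mulr k f g : An k g -> Ck k f -> An k (fun x => g x * f x).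
Proof. by move=> [Cg ag] Cf; split; [exact: Ck_mul|exact: annular_mulr]. Qed.

Lemma An_mul k f g : An k f -> An k g -> An k (fun x => f x * g x).
Proof. by move=> [Cf _]; exact: An_mull. Qed.

Lemma An_add k f g : An k f -> An k g -> An k (fun x => f x + g x).
Proof. by move=> [Cf af] [Cg ag]; split; [exact: Ck_add|exact: annular_add]. Qed.

Lemma An_scale k c g : An k g -> An k (fun x => c * g x).
Proof. by apply: An_mull; exact: Ck_cst. Qed.

Lemma An_opp k g : An k g -> An k (fun x => - g x).
Proof.
move=> /(An_scale (-1)); congr An; apply/funext => x; exact: mulN1r.
Qed.

Lemma An_sub k f g : An k f -> An k g -> An k (fun x => f x - g x).
Proof. by move=> Af Ag; apply: An_add => //; exact: An_opp. Qed.

Lemma An_sum k m (F : 'I_m -> V -> R) : (forall j : 'I_m, An k (F j)) ->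
  An k (fun x => \sum_(j < m) F j x).
Proof.
elim: m F => [|m IH] F AF.
  rewrite (_ : (fun x => _) = fun=> 0); last by apply/funext => x; rewrite big_ord0.
  by split; [exact: Ck_cst|exact: annular_cst0].
rewrite (_ : (fun x => _) = fun x => F ord0 x + \sum_(j < m) F (lift ord0 j) x).
  by apply: An_add => //; exact: (IH (fun j : 'I_m => F (lift ord0 j))).
by apply/funext => x; rewrite big_ord_recl.
Qed.

(** Both functions vanish at the origin, so pointwise identities are checked only where the
    differential calculus is valid. *)
Lemma An_eq k m f g : An k f -> An m g -> (forall x, x != 0 -> f x = g x) -> f = g.
Proof.
move=> [_ af] [_ ag] fg; apply/funext => x.
by have [->|/fg//] := eqVneq x 0; rewrite !annular0.
Qed.

Definition I g : R := \int[mu]_x g x.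

Lemma An_integrable k g : An k g -> mu.-integrable setT (EFin \o g).
Proof.
move=> Ag; apply: annular_integrable; last by case: Ag.
by apply: An_cont; exact: An_le Ag.
Qed.

Lemma I_add k f g : An k f -> An k g -> I (fun x => f x + g x) = I f + I g.
Proof. by move=> Af Ag; apply: RintegralD => //; [exact: (An_integrable Af)|exact: (An_integrable Ag)]. Qed.

Lemma I_scale k c f : An k f -> I (fun x => c * f x) = c * I f.
Proof. by move=> Af; apply: RintegralZl => //; exact: (An_integrable Af). Qed.

Lemma I_opp k f : An k f -> I (fun x => - f x) = - I f.
Proof.
move=> Af; rewrite -mulN1r -(I_scale _ Af); congr I.
by apply/funext => x; rewrite mulN1r.
Qed.

Lemma I_sub k f g : An k f -> An k g -> I (fun x => f x - g x) = I f - I g.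
Proof. by move=> Af Ag; rewrite (I_add Af (An_opp Ag)) (I_opp Ag). Qed.

Lemma I_sum k m (F : 'I_m -> V -> R) : (forall j : 'I_m, An k (F j)) ->
  I (fun x => \sum_(j < m) F j x) = \sum_(j < m) I (F j).
Proof.
elim: m F => [|m IH] F AF.
  rewrite big_ord0 -[RHS](mul0r (I (fun=> 0))) -(I_scale (k := 0)); last first.
    by split; [exact: Ck_cst|exact: annular_cst0].
  by congr I; apply/funext => x; rewrite big_ord0 mul0r.
rewrite big_ord_recl -(IH (fun j : 'I_m => F (lift ord0 j)))// -(I_add (AF ord0)); last exact: An_sum.
by congr I; apply/funext => x; rewrite big_ord_recl.
Qed.

Lemma I_ge0 g : (forall x, 0 <= g x) -> 0 <= I g.
Proof. by move=> g0; apply: Rintegral_ge0 => x _. Qed.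

Lemma I_pd g i : An 1 g -> I (pd i g) = 0.
Proof.
move=> Ag; apply: integral_derive0; first by case: Ag.
- by apply: An_cont; exact: An_le Ag.
- by move=> x; exact: An_derivable.
- by apply: An_cont; exact: An_pd.
Qed.

Lemma I_div (F : 'I_n -> V -> R) : (forall j, An 1 (F j)) ->
  I (fun x => \sum_(j < n) pd j (F j) x) = 0.
Proof.
move=> AF; rewrite (I_sum (k := 0)); last by move=> j; exact: An_pd.
by rewrite big1// => j _; exact: I_pd.
Qed.

End annular_class.

(** * The Euler field and its commutation relations *)

Section euler.
Context {R : realType} {n : nat}.
Notation V := 'rV[R]_n.
Implicit Types (f g h : V -> R) (x : V) (i j : 'I_n).
Notation q := (@q R n).
Notation nsq := (@nsq R n).
Local Opaque Ck pd.

Definition Eu g x : R := \sum_(i < n) x ord0 i * pd i g x.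
Definition Lap g x : R := \sum_(i < n) pd i (pd i g) x.
(* The spherical Laplacian -Delta_S, written with the Euler field. *)
Definition Lam g x : R := Eu (Eu g) x + (n%:R - 2) * Eu g x - nsq x * Lap g x.
Definition dotg g h x : R := \sum_(i < n) pd i g x * pd i h x.
(* [|x|^-4], with the value 0 at the origin. *)
Definition w x : R := q x * q x.

Lemma wE x : w x = q x * q x.
Proof. by []. Qed.

Lemma Ck_w k : Ck k w. Proof. by apply: Ck_mul; exact: Ck_q. Qed.

Lemma Ck_Eu k g : Ck k.+1 g -> Ck k (Eu g).
Proof.
by move=> Cg; apply: Ck_sum => i; apply: Ck_mul; [exact: Ck_coord|exact: Ck_pd].
Qed.

Lemma An_Eu k g : An k.+1 g -> An k (Eu g).
Proof.
by move=> Ag; apply: An_sum => i; apply: An_mull; [exact: Ck_coord|exact: An_pd].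
Qed.

Lemma An_Lap k g : An k.+2 g -> An k (Lap g).
Proof. by move=> Ag; apply: An_sum => i; do 2 apply: An_pd. Qed.

Lemma Ck_Lap k g : Ck k.+2 g -> Ck k (Lap g).
Proof. by move=> Ag; apply: Ck_sum => i; do 2 apply: Ck_pd. Qed.

Lemma An_Lam k g : An k.+2 g -> An k (Lam g).
Proof.
move=> Ag; apply: An_sub; last by apply: An_mull; [exact: Ck_nsq|exact: An_Lap].
apply: An_add; first by do 2 apply: An_Eu.
by apply: An_scale; apply: An_Eu; exact: An_le Ag.
Qed.

Lemma An_dotg k g h : An k.+1 g -> Ck k.+1 h -> An k (dotg g h).
Proof. by move=> Ag Ch; apply: An_sum => i; apply: An_mulr; [exact: An_pd|exact: Ck_pd]. Qed.

Lemma EuD g h x : Ck 1 g -> Ck 1 h -> x != 0 ->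
  Eu (fun y => g y + h y) x = Eu g x + Eu h x.
Proof.
by move=> Cg Ch x0; rewrite -big_split; apply: eq_bigr => i _; rewrite pdD// mulrDr.
Qed.

Lemma EuM g h x : Ck 1 g -> Ck 1 h -> x != 0 ->
  Eu (fun y => g y * h y) x = g x * Eu h x + h x * Eu g x.
Proof.
move=> Cg Ch x0; rewrite !mulr_sumr -big_split; apply: eq_bigr => i _.
by rewrite pdM//=; ring.
Qed.

Lemma EuZ c g x : Ck 1 g -> x != 0 -> Eu (fun y => c * g y) x = c * Eu g x.
Proof. by move=> Cg x0; rewrite mulr_sumr; apply: eq_bigr => i _; rewrite pdZ//; ring. Qed.

Lemma EuB g h x : Ck 1 g -> Ck 1 h -> x != 0 ->
  Eu (fun y => g y - h y) x = Eu g x - Eu h x.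
Proof.
by move=> Cg Ch x0; rewrite -sumrB; apply: eq_bigr => i _; rewrite pdB// mulrBr.
Qed.

Lemma Eu_sum m (F : 'I_m -> V -> R) x : (forall j : 'I_m, Ck 1 (F j)) -> x != 0 ->
  Eu (fun y => \sum_(j < m) F j y) x = \sum_(j < m) Eu (F j) x.
Proof.
move=> CF x0; rewrite exchange_big; apply: eq_bigr => i _.
by rewrite pd_sum// mulr_sumr.
Qed.

Lemma qK x : x != 0 -> nsq x * q x = 1.
Proof. by move=> x0; rewrite divff// gt_eqF// nsq_gt0. Qed.

Lemma Eu_nsq x : x != 0 -> Eu nsq x = 2 * nsq x.
Proof.
by move=> x0; rewrite mulr_sumr; apply: eq_bigr => i _; rewrite pd_nsq//; ring.
Qed.

Lemma Eu_q x : x != 0 -> Eu q x = - 2 * q x.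
Proof.
move=> x0; transitivity (- 2 * (nsq x * q x) * q x); last by rewrite qK// mulr1.
rewrite /nsq !mulr_suml !mulr_sumr !mulr_suml; apply: eq_bigr => i _.
by rewrite pd_q//; ring.
Qed.

Lemma Eu_w x : x != 0 -> Eu w x = - 4 * w x.
Proof.
move=> x0; rewrite /w (EuM (Ck_q 1) (Ck_q 1) x0) Eu_q//; ring.
Qed.

Lemma div_Eu g x : Ck 1 g -> x != 0 ->
  \sum_(j < n) pd j (fun y => y ord0 j * g y) x = n%:R * g x + Eu g x.
Proof.
move=> Cg x0; rewrite (eq_bigr (fun j => g x + x ord0 j * pd j g x)).
  by rewrite big_split/= sumr_const card_ord mulr_natl.
by move=> j _; rewrite (pdM j (Ck_coord 1 j) Cg x0) pd_coord eqxx mulr1 addrC.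
Qed.

(** The commutator of a partial derivative with the Euler field is that derivative; the symmetry of
    second derivatives enters here. *)
Lemma pd_Eu g j x : Ck 2 g -> x != 0 -> pd j (Eu g) x = pd j g x + Eu (pd j g) x.
Proof.
move=> Cg x0; rewrite /Eu pd_sum//; last first.
  by move=> i; apply: Ck_mul; [exact: Ck_coord|exact: Ck_pd].
rewrite (eq_bigr (fun i => (i == j)%:R * pd i g x + x ord0 i * pd i (pd j g) x)).
  rewrite big_split/=; congr (_ + _).
  by rewrite (bigD1 j)//= eqxx mul1r big1 ?addr0// => i /negbTE ->; rewrite mul0r.
move=> i _; rewrite (pdM j (Ck_coord 1 i) (Ck_pd i Cg) x0) pd_coord.
by rewrite schwarz_pd//; ring.
Qed.

Lemma Lap_Eu g x : Ck 3 g -> x != 0 -> Lap (Eu g) x = 2 * Lap g x + Eu (Lap g) x.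
Proof.
move=> Cg x0; rewrite /Lap Eu_sum//; last by move=> j; do 2 apply: Ck_pd.
rewrite mulr_sumr -big_split; apply: eq_bigr => j _ /=.
have Cj : Ck 2 (pd j g) by exact: Ck_pd.
rewrite (pd_eq (g := fun y => pd j g y + Eu (pd j g) y) j x0); last first.
  by move=> y y0; exact (pd_Eu j (CkW Cg) y0).
rewrite (pdD j (CkW Cj) (Ck_Eu Cj) x0) (pd_Eu j Cj x0); ring.
Qed.

(** Lam is homogeneous of degree 0: the term 2 nsq Lap g due to the degree of [nsq] is the one that
    the commutator in [Lap_Eu] produces. *)
Lemma Eu_Lam g x : Ck 4 g -> x != 0 -> Eu (Lam g) x = Lam (Eu g) x.
Proof.
move=> Cg x0.
have C3 : Ck 3 (Eu g) by exact: Ck_Eu.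
have C2 : Ck 2 (Eu (Eu g)) by exact: Ck_Eu.
have CL : Ck 2 (Lap g) by exact: Ck_Lap.
have CA : Ck 1 (fun y => (n%:R - 2) * Eu g y) by apply: Ck_scale; exact: Ck_le C3.
have CB : Ck 1 (fun y => nsq y * Lap g y) by apply: Ck_mul; [exact: Ck_nsq|exact: CkW].
have CC : Ck 1 (Eu (Eu g)) by exact: CkW.
have C1 : Ck 1 (Eu g) := CkW (CkW C3).
have -> : Eu (Lam g) x = Eu (fun y => Eu (Eu g) y + (n%:R - 2) * Eu g y) x -
    Eu (fun y => nsq y * Lap g y) x := EuB (Ck_add CC CA) CB x0.
rewrite (EuD CC CA x0) (EuZ _ C1 x0) (EuM (Ck_nsq 1) (CkW CL) x0) (Eu_nsq x0).
rewrite {1}/Lam (Lap_Eu (CkW Cg) x0).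
move: (Eu (Eu (Eu g)) x) (Eu (Eu g) x) (Eu (Lap g) x) (Lap g x) (nsq x) => a b c d e.
ring.
Qed.

End euler.
(** * The Euler field and the spherical Laplacian *)

Section integral_identities.
Context {R : realType} {n : nat}.
Notation V := 'rV[R]_n.
Implicit Types (f g h : V -> R) (x : V) (i j : 'I_n).
Notation q := (@q R n).
Notation nsq := (@nsq R n).
Notation w := (@w R n).
Local Opaque Ck pd Eu Lap Lam.

Definition B g h : R := I (fun x => w x * (g x * h x)).

Lemma BC g h : B g h = B h g.
Proof. by congr I; apply/funext => x; rewrite (mulrC (g x)). Qed.

Lemma An_w k g h : An k g -> Ck k h -> An k (fun x => w x * (g x * h x)).
Proof. by move=> Ag Ch; apply: An_mull; [exact: Ck_w|exact: An_mulr]. Qed.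

Lemma BDr k f g h : An k f -> An k g -> An k h ->
  B f (fun x => g x + h x) = B f g + B f h.
Proof.
move=> Af [Cg _] [Ch _]; rewrite -(I_add (An_w Af Cg) (An_w Af Ch)).
by congr I; apply/funext => x; ring.
Qed.

Lemma BZr k c f g : An k f -> An k g -> B f (fun x => c * g x) = c * B f g.
Proof.
move=> Af [Cg _]; rewrite -(I_scale _ (An_w Af Cg)).
by congr I; apply/funext => x; ring.
Qed.

Lemma BDl k f g h : An k f -> An k g -> An k h ->
  B (fun x => g x + h x) f = B g f + B h f.
Proof. by move=> Af Ag Ah; rewrite BC (BDr Af Ag Ah) (BC f g) (BC f h). Qed.

Lemma BZl k c f g : An k f -> An k g -> B (fun x => c * g x) f = c * B g f.
Proof. by move=> Af Ag; rewrite BC (BZr _ Af Ag) (BC f g). Qed.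

Lemma B_ge0 f : 0 <= B f f.
Proof. by apply: I_ge0 => x; rewrite -!expr2 mulr_ge0// sqr_ge0. Qed.

Lemma B_sqr_add k c f g : An k f -> An k g ->
  0 <= B f f + 2 * c * B f g + c ^+ 2 * B g g.
Proof.
move=> Af Ag; have Acg := An_scale c Ag; have Ah := An_add Af Acg.
have := B_ge0 (fun x => f x + c * g x).
rewrite (BDr Ah Af Acg) (BZr _ Ah Ag) (BDl Af Af Acg) (BDl Ag Af Acg).
rewrite (BZl _ Af Ag) (BZl _ Ag Ag) (BC g f).
by congr (_ <= _); ring.
Qed.

(* The divergence theorem for [w g h x]. *)
Lemma B_Eu g h : An 1 g -> An 1 h -> B g (Eu h) + B h (Eu g) = - (n%:R - 4) * B g h.
Proof.
move=> Ag Ah.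
have [Cg _] := Ag; have [Ch _] := Ah.
have Agh := An_mul Ag Ah; have [Cgh _] := Agh.
have Aw : An 1 (fun x => w x * (g x * h x)) by exact: An_w.
have [Cw _] := Aw.
have A1 : An 0 (fun x => w x * (g x * Eu h x)).
  by apply: An_w; [exact: An_le Ag|exact: Ck_Eu].
have A2 : An 0 (fun x => w x * (h x * Eu g x)).
  by apply: An_w; [exact: An_le Ah|exact: Ck_Eu].
have A3 : An 0 (fun x => (n%:R - 4) * (w x * (g x * h x))).
  by apply: An_scale; exact: An_le Aw.
have AF i : An 1 (fun x : V => x ord0 i * (w x * (g x * h x))).
  exact (An_mull (Ck_coord 1 i) Aw).
have := I_div AF.
rewrite (_ : (fun x => _) = fun x => w x * (g x * Eu h x) + w x * (h x * Eu g x)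
   + (n%:R - 4) * (w x * (g x * h x))).
  rewrite (I_add (An_add A1 A2) A3) (I_add A1 A2) (I_scale _ Aw) => /eqP.
  by rewrite addr_eq0 => /eqP; rewrite mulNr.
apply: (@An_eq _ _ 0 0).
- by apply: An_sum => j; apply: An_pd.
- by apply: An_add => //; exact: An_add.
(* The divergence of x contributes n, and the degree of [w] contributes -4. *)
move=> x x0; rewrite (div_Eu Cw x0) (EuM (Ck_w 1) Cgh x0) (EuM Cg Ch x0) (Eu_w x0).
ring.
Qed.

(* The Dirichlet form of the part of the gradient tangent to the spheres. *)
Definition T g h : R := I (fun x => q x * dotg g h x - w x * (Eu g x * Eu h x)).

Lemma dotgC g h x : dotg g h x = dotg h g x.
Proof. by apply: eq_bigr => i _; rewrite mulrC. Qed.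

Lemma T_C g h : T g h = T h g.
Proof. by congr I; apply/funext => x; rewrite dotgC (mulrC (Eu g x)). Qed.

Lemma An_T g h : An 1 g -> Ck 1 h ->
  An 0 (fun x => q x * dotg g h x - w x * (Eu g x * Eu h x)).
Proof.
move=> Ag Ch; apply: An_sub.
  by apply: An_mull; [exact: Ck_q|exact: An_dotg].
by apply: An_w; [exact: An_Eu|exact: Ck_Eu].
Qed.

(** Green's formula on spheres: the divergence theorem for [w h (Eu g) x - q h grad g], which is - h
    |x|^-2 times the part of grad g tangent to the spheres. The symmetry of Lam for [B] is then that
    of [T]. *)
Lemma B_Lam g h : An 2 g -> An 1 h -> B h (Lam g) = T h g.
Proof.
move=> Ag Ah; rewrite T_C; have [Cg _] := Ag; have [Ch _] := Ah.
have Cg1 : Ck 1 g := CkW Cg.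
have CE : Ck 1 (Eu g) := Ck_Eu Cg.
have AhE : An 1 (fun x => h x * Eu g x) := An_mulr Ah CE.
have [ChE _] := AhE.
have AwE : An 1 (fun x => w x * (h x * Eu g x)) := An_mull (Ck_w 1) AhE.
have [CwE _] := AwE.
have Cqh : Ck 1 (fun x => q x * h x) := Ck_mul (Ck_q 1) Ch.
have Ap i : An 1 (pd i g) := An_pd i Ag.
have Aq i : An 1 (fun x => (q x * h x) * pd i g x) := An_mull Cqh (Ap i).
have A1 i : An 1 (fun x : V => x ord0 i * (w x * (h x * Eu g x))).
  exact (An_mull (Ck_coord 1 i) AwE).
have AT := An_T (An_le (isT : (1 <= 2)%N) Ag) Ch.
have AL : An 0 (fun x => w x * (h x * Lam g x)).
  by apply: An_mull; [exact: Ck_w|apply: An_mull; [exact: Ck_le Ch|exact: An_Lam]].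
apply/eqP; rewrite -subr_eq0; apply/eqP.
have := I_div (fun i => An_sub (A1 i) (Aq i)).
rewrite (_ : (fun x => _) = fun x => w x * (h x * Lam g x)
   - (q x * dotg g h x - w x * (Eu g x * Eu h x))).
  by rewrite (I_sub AL AT).
apply: (@An_eq _ _ 0 0).
- by apply: An_sum => j; apply: An_pd; exact: An_sub.
- exact: An_sub.
move=> x x0.
transitivity (\sum_(j < n) (pd j (fun y : V => y ord0 j * (w y * (h y * Eu g y))) x
   - pd j (fun y => (q y * h y) * pd j g y) x)).
  apply: eq_bigr => j _; have [C1 _] := A1 j; have [C2 _] := Aq j.
  exact: (pdB j C1 C2 x0).
rewrite sumrB (div_Eu CwE x0) (EuM (Ck_w 1) ChE x0) (EuM Ch CE x0) (Eu_w x0).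
have -> : \sum_(j < n) pd j (fun y => (q y * h y) * pd j g y) x =
    q x * h x * Lap g x + q x * dotg g h x - 2 * (h x * (w x * Eu g x)).
  transitivity (\sum_(j < n) (q x * h x * pd j (pd j g) x + q x * (pd j g x * pd j h x)
     - 2 * (h x * (w x * (x ord0 j * pd j g x))))).
    apply: eq_bigr => j _; have [C2 _] := Ap j.
    by rewrite (pdM j Cqh C2 x0) (pdM j (Ck_q 1) Ch x0) (pd_q j x0) !wE; ring.
  by rewrite sumrB big_split/= -!mulr_sumr.
have qE : q x = w x * nsq x.
  by rewrite !wE -mulrA [q x * nsq x]mulrC qK// mulr1.
rewrite {1}qE.
have -> : Lam g x = Eu (Eu g) x + (n%:R - 2) * Eu g x - nsq x * Lap g x by [].
move: (dotg g h x) (Eu (Eu g) x) (Eu g x) (Eu h x) (Lap g x) (nsq x) (w x) (q x) (h x) => *.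
ring.
Qed.

(** The density is |x|^-2 times the squared length of the tangential gradient; at the origin both
    weights are 0. *)
Lemma T_density_ge0 g x : 0 <= q x * dotg g g x - w x * (Eu g x * Eu g x).
Proof.
rewrite !wE.
have [->|x0] := eqVneq x 0.
  have -> : q 0 = 0 by rewrite qE nsq_sum big1 ?invr0// => i _; rewrite mxE mul0r.
  by rewrite !mul0r subrr.
(* Cauchy-Schwarz: the square of the component of the gradient orthogonal to x. *)
have : 0 <= q x ^+ 3 * \sum_(i < n) (nsq x * pd i g x - x ord0 i * Eu g x) ^+ 2.
  rewrite mulr_ge0 ?exprn_ge0 ?invr_ge0 ?(ltW (nsq_gt0 x0))//.
  by apply: sumr_ge0 => i _; exact: sqr_ge0.
have -> : \sum_(i < n) (nsq x * pd i g x - x ord0 i * Eu g x) ^+ 2 =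
    nsq x ^+ 2 * dotg g g x - 2 * (nsq x * Eu g x) * Eu g x + nsq x * Eu g x ^+ 2.
  transitivity (\sum_(i < n) (nsq x ^+ 2 * (pd i g x * pd i g x)
      - 2 * (nsq x * Eu g x) * (x ord0 i * pd i g x)
      + (x ord0 i * x ord0 i) * Eu g x ^+ 2)).
    by apply: eq_bigr => i _; ring.
  by rewrite big_split/= sumrB -!mulr_sumr -mulr_suml.
have := qK x0; move: (dotg g g x) (Eu g x) (nsq x) (q x) => d e a b ab.
have -> : b ^+ 3 * (a ^+ 2 * d - 2 * (a * e) * e + a * e ^+ 2) =
  (a * b) ^+ 2 * (b * d) - (a * b) * (b * b * (e * e)) by ring.
by rewrite ab expr1n !mul1r.
Qed.

Lemma T_ge0 g : 0 <= T g g.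
Proof. by apply: I_ge0 => x; exact: T_density_ge0. Qed.

Lemma T_lin_ge0 g h (c : R) : An 2 g -> An 2 h ->
  0 <= T g g + 2 * c * T g h + c ^+ 2 * T h h.
Proof.
move=> Ag Ah.
have Ag1 := An_le (isT : (1 <= 2)%N) Ag; have Ah1 := An_le (isT : (1 <= 2)%N) Ah.
have [Cg _] := Ag1; have [Ch _] := Ah1.
have Ach := An_scale c Ah1; have [Cch _] := Ach.
have AH := An_add Ag1 Ach; have [CH _] := AH.
have := T_ge0 (fun x => g x + c * h x).
pose t (u v : V -> R) x := q x * dotg u v x - w x * (Eu u x * Eu v x).
rewrite (_ : T _ _ = I (fun x => t g g x + (2 * c * t g h x + c ^+ 2 * t h h x))).
  rewrite (I_add (An_T Ag1 Cg) (An_add (An_scale _ (An_T Ag1 Ch)) (An_scale _ (An_T Ah1 Ch)))).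
  rewrite (I_add (An_scale (2 * c) (An_T Ag1 Ch)) (An_scale (c ^+ 2) (An_T Ah1 Ch))).
  by rewrite (I_scale _ (An_T Ag1 Ch)) (I_scale _ (An_T Ah1 Ch)) addrA.
congr I; apply: (An_eq (An_T AH CH)
  (An_add (An_T Ag1 Cg) (An_add (An_scale _ (An_T Ag1 Ch)) (An_scale _ (An_T Ah1 Ch))))) => x x0.
rewrite (EuD Cg Cch x0) (EuZ c Ch x0) /t.
have -> : dotg (fun y => g y + c * h y) (fun y => g y + c * h y) x =
    dotg g g x + 2 * c * dotg g h x + c ^+ 2 * dotg h h x.
  rewrite /dotg !mulr_sumr -!big_split; apply: eq_bigr => i _ /=.
  by rewrite (pdD i Cg Cch x0) (pdZ c i Ch x0); ring.
by move: (dotg g g x) (dotg g h x) (dotg h h x) (Eu g x) (Eu h x) (q x) (w x) => *; ring.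
Qed.

End integral_identities.

(** * The inequality before projecting *)

Section rellich_core.
Context {R : realType} {n : nat}.
Notation V := 'rV[R]_n.
Notation q := (@q R n).
Notation nsq := (@nsq R n).
Notation w := (@w R n).
Local Opaque Ck pd Eu Lap Lam.
Variable f : V -> R.
Hypothesis Af : forall k, An k f.

Let E1 := Eu f.
Let E2 := Eu (Eu f).
Let L := Lam f.
Let m : R := n%:R - 4.
Let AE1 k : An k E1. Proof. exact: An_Eu. Qed.
Let AE2 k : An k E2. Proof. exact: An_Eu. Qed.
Let AL k : An k L. Proof. exact: An_Lam. Qed.

(** By definition of Lam, |x|^2 Lap f = E2 + (n - 2) E1 - L, and [w] absorbs the factor |x|^4. *)
Let I_Lap2 : I (fun x => Lap f x ^+ 2) =
  B E2 E2 + 2 * (n%:R - 2) * B E2 E1 - 2 * B E2 L + (n%:R - 2) ^+ 2 * B E1 E1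
  - 2 * (n%:R - 2) * B E1 L + B L L.
Proof.
have [CL _] := An_Lap (Af 2).
have A0 : An 0 (fun x => Lap f x ^+ 2) by apply: (An_mull CL); exact: An_Lap (Af 2).
pose G x := E2 x + ((n%:R - 2) * E1 x + -1 * L x).
have Ac := An_scale (n%:R - 2) (AE1 0).
have Am := An_scale (-1) (AL 0).
have Acm := An_add Ac Am.
have AG : An 0 G := An_add (AE2 0) Acm.
have -> : I (fun x => Lap f x ^+ 2) = B G G.
  congr I; apply: (An_eq A0 (An_w AG AG.1)) => x x0.
  have -> : G x = nsq x * Lap f x.
    rewrite /G /L (_ : Lam f x = E2 x + (n%:R - 2) * E1 x - nsq x * Lap f x)//.
    move: (E2 x) (E1 x) (nsq x) (Lap f x) => *; ring.
  have := qK x0; rewrite !wE; move: (nsq x) (q x) (Lap f x) => a b c ab.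
  have -> : b * b * (a * c * (a * c)) = (a * b) ^+ 2 * c ^+ 2 by ring.
  by rewrite ab expr1n mul1r.
rewrite (BDr AG (AE2 0) Acm) (BDr AG Ac Am) (BZr _ AG (AE1 0)) (BZr _ AG (AL 0)).
rewrite (BDl (AE2 0) (AE2 0) Acm) (BDl (AE2 0) Ac Am) (BZl _ (AE2 0) (AE1 0)) (BZl _ (AE2 0) (AL 0)).
rewrite (BDl (AE1 0) (AE2 0) Acm) (BDl (AE1 0) Ac Am) (BZl _ (AE1 0) (AE1 0)) (BZl _ (AE1 0) (AL 0)).
rewrite (BDl (AL 0) (AE2 0) Acm) (BDl (AL 0) Ac Am) (BZl _ (AL 0) (AE1 0)) (BZl _ (AL 0) (AL 0)).
rewrite (BC E1 E2) (BC L E2) (BC L E1).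
move: (B E2 E2) (B E2 E1) (B E2 L) (B E1 E1) (B E1 L) (B L L) => *; ring.
Qed.

Lemma B_Lam_T : B f (Lam f) = T f f.
Proof. exact: B_Lam (Af 2) (Af 1). Qed.

(** Put A = E + m / 2, which is antisymmetric for [B]. The difference of the two sides is exactly |A
    E f|^2 + (n^2 / 4) |A f|^2 + 2 T (A f) (A f), with the norm of [B]; the facts [pM], [pN] and
    [pT] say that these three terms are nonnegative. *)
Lemma rellich_core : rellich_const R n ^+ 2 * B f f
  + 2 * rellich_const R n * B f (Lam f) + B (Lam f) (Lam f) <= I (fun x => Lap f x ^+ 2).
Proof.
have e21 : B E2 E1 + B E2 E1 = - m * B E1 E1.
  rewrite (BC E2 E1); exact (B_Eu (AE1 1) (AE1 1)).
have e01 : B f E1 + B f E1 = - m * B f f by exact (B_Eu (Af 1) (Af 1)).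
have LE : Eu L = Lam E1.
  apply: (An_eq (An_Eu (AL 1)) (An_Lam (AE1 2))) => x x0.
  exact: (Eu_Lam (Af 4).1 x0).
(* T E1 E1 = B E1 (Lam E1) = B E1 (Eu L), since Eu commutes with Lam; [B_Eu] then moves Eu onto
   E1. *)
have eS : T E1 E1 + B E2 L = - m * B E1 L.
  rewrite -(B_Lam (AE1 2) (AE1 1)) -LE (BC E2 L); exact (B_Eu (AE1 1) (AL 1)).
(* Symmetry of Lam, obtained through that of [T]. *)
have h1 : B f (Eu L) = B E1 L.
  rewrite LE (B_Lam (AE1 2) (Af 1)) T_C; exact (esym (B_Lam (Af 2) (AE1 1))).
have eP : B E1 L + B E1 L = - m * B f L.
  rewrite -{1}h1 (BC E1 L); exact (B_Eu (Af 1) (AL 1)).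
have pT : 0 <= T E1 E1 + m * B E1 L + m ^+ 2 / 4 * B f L.
  have := T_lin_ge0 (m / 2) (AE1 2) (Af 2).
  rewrite -(B_Lam (Af 2) (AE1 1)) -/L -(B_Lam (Af 2) (Af 1)) -/L.
  by congr (_ <= _); move: (T E1 E1) (B E1 L) (B f L) m => *; field.
have pN := B_sqr_add (m / 2) (AE1 0) (Af 0).
have pM := B_sqr_add (m / 2) (AE2 0) (AE1 0).
rewrite I_Lap2 -/L.
move: e21 e01 eS eP pT pN pM; rewrite (BC E1 f).
move: (B E2 E2) (B E2 E1) (B E2 L) (B E1 E1) (B E1 L) (B L L) (B f f) (B f E1) (B f L) (T E1 E1).
move=> M e s N P Q X a D Z e21 e01 eS eP pT pN pM.
have n0 : (0 : R) <= n%:R by [].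
have -> : rellich_const R n = (m + 4) * m / 4 by rewrite /rellich_const /m; ring.
have -> : n%:R - 2 = m + 2 :> R by rewrite /m; ring.
have {n0}n0 : 0 <= m + 4 by rewrite /m subrK.
have hN : m ^+ 2 / 4 * X <= N.
  rewrite -subr_ge0; suff -> : N - m ^+ 2 / 4 * X = N + 2 * (m / 2) * a + (m / 2) ^+ 2 * X by [].
  have -> : 2 * (m / 2) * a = m / 2 * (a + a) by field.
  by rewrite e01; field.
have hM : m ^+ 2 / 4 * N <= M.
  rewrite -subr_ge0; suff -> : M - m ^+ 2 / 4 * N = M + 2 * (m / 2) * e + (m / 2) ^+ 2 * N by [].
  have -> : 2 * (m / 2) * e = m / 2 * (e + e) by field.
  by rewrite e21; field.
have hZ : m ^+ 2 / 4 * D <= Z.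
  rewrite -subr_ge0; suff -> : Z - m ^+ 2 / 4 * D = Z + m * P + m ^+ 2 / 4 * D by [].
  have -> : m * P = m / 2 * (P + P) by field.
  by rewrite eP; field.
rewrite -subr_ge0.
(* The integrations by parts express [s], [P] and [e] by the other quantities; after substitution
   this is an identity in [m]. *)
have -> : M + 2 * (m + 2) * e - 2 * s + (m + 2) ^+ 2 * N - 2 * (m + 2) * P + Q
    - (((m + 4) * m / 4) ^+ 2 * X + 2 * ((m + 4) * m / 4) * D + Q) =
    (M - m ^+ 2 / 4 * N) + (m + 4) ^+ 2 / 4 * (N - m ^+ 2 / 4 * X)
    + 2 * (Z - m ^+ 2 / 4 * D).
  have -> : s = - m * P - Z by rewrite -eS; ring.
  have -> : P = - m / 2 * D by apply: (@mulfI _ 2) => //; rewrite mulr_natl mulr2n eP; field.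
  have -> : e = - m / 2 * N by apply: (@mulfI _ 2) => //; rewrite mulr_natl mulr2n e21; field.
  by field.
have p1 : 0 <= M - m ^+ 2 / 4 * N by rewrite subr_ge0.
have p2 : 0 <= N - m ^+ 2 / 4 * X by rewrite subr_ge0.
have p3 : 0 <= Z - m ^+ 2 / 4 * D by rewrite subr_ge0.
have p4 : 0 <= (m + 4) ^+ 2 / 4 by rewrite divr_ge0// sqr_ge0.
by apply: addr_ge0; [apply: addr_ge0 => //|]; rewrite mulr_ge0.
Qed.

End rellich_core.
(** * Functions on spheres *)

Section radial_calculus.
Context {R : realType} {n : nat}.
Notation V := 'rV[R]_n.
Implicit Types (f g h : V -> R) (x y z : V) (i j : 'I_n).
Notation q := (@q R n).
Notation nsq := (@nsq R n).
Notation dl i := (delta_mx ord0 i : V).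

Lemma continuous_rV (T : topologicalType) (phi : T -> V) (t : T) :
  (forall j, {for t, continuous (fun s => phi s ord0 j)}) -> {for t, continuous phi}.
Proof.
move=> cphi P /nbhs_box[d d0 dP].
suff : \forall s \near t, forall j, `|phi s ord0 j - phi t ord0 j| < d.
  by apply: filterS => s; exact: dP.
apply: filter_forall => j.
have /cvgrPdist_lt/(_ d d0) := cphi j.
by apply: filterS => s; rewrite distrC.
Qed.

Lemma is_derive_of_line g x (v : V) (a : R) :
  is_derive (0 : R) (1 : R) (fun t : R => g (x + t *: v)) a -> is_derive x v g a.
Proof.
have E : (fun h : R => h^-1 *: (((fun t : R => g (x + t *: v)) \o shift (0 : R)) (h *: (1 : R)) -
            g (x + (0 : R) *: v))) =
    (fun h : R => h^-1 *: ((g \o shift x) (h *: v) - g x)).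
  apply/funext => h /=; rewrite scale0r !addr0; congr (_ *: (g _ - _)).
  by rewrite (_ : h *: (1 : R) = h) 1?addrC//; exact: mulr1.
by case=> d1 d2; split; [move: d1; rewrite /derivable E|move: d2; rewrite /derive E].
Qed.

Lemma is_derive_comp_scalar g (phi : R -> R) x (v : V) (a b : R) :
  is_derive x v g a -> is_derive (g x) 1 phi b -> is_derive x v (phi \o g) (b * a).
Proof.
move=> [dg <-] dphi; apply: is_derive_of_line.
have x0 : x = x + (0 : R) *: v by rewrite scale0r addr0.
have dl0 : is_derive (0 : R) 1 (fun t : R => g (x + t *: v)) ('D_v g (x + (0 : R) *: v)).
  by apply: is_derive_line; rewrite -x0.
rewrite {2}x0.
apply: (is_derive1_comp (f := phi) (g := fun t : R => g (x + t *: v))) => //.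
by rewrite -x0.
Qed.

Lemma enormE x : enorm x = Num.sqrt (nsq x).
Proof. by rewrite nsqE sqrtr_sqr ger0_norm// enorm_ge0. Qed.

Lemma is_derive_enorm i x : x != 0 ->
  is_derive x (dl i) (@enorm R n) (x ord0 i * (enorm x)^-1).
Proof.
move=> x0; have e0 : enorm x != 0 by rewrite enorm_eq0.
have -> : @enorm R n = Num.sqrt \o nsq by apply/funext => z; exact: enormE.
have dn : is_derive x (dl i) nsq (2 * x ord0 i).
  rewrite -(pd_nsq i x0); apply/derivableP; exact: (@Ck_derivable _ _ 0 _ i _ (Ck_nsq 1)).
have ds := is_derive1_sqrt (nsq_gt0 x0).
apply: is_derive_eq (is_derive_comp_scalar dn ds) _.
by rewrite -[(Num.sqrt \o nsq) x]/(Num.sqrt (nsq x)) -!enormE; field.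
Qed.

Lemma pd_enorm i x : x != 0 -> pd i (@enorm R n) x = x ord0 i * (enorm x)^-1.
Proof. by move=> x0; have [_] := is_derive_enorm i x0. Qed.

Lemma continuous_at_enormV x : x != 0 -> {for x, continuous (fun z : V => (enorm z)^-1)}.
Proof.
by move=> x0; apply: continuous_at_inv; [rewrite enorm_eq0|exact: enorm_continuous].
Qed.

Lemma Ck1_enorm : Ck 1 (@enorm R n).
Proof.
split=> [x _|i]; first exact: enorm_continuous.
split=> [x x0|]; first by have [] := is_derive_enorm i x0.
split => // x x0.
apply: (@continuous_at_ext _ _ (fun z : V => z ord0 i * (enorm z)^-1)) => //.
  by move=> y y0; rewrite pd_enorm.
by apply: continuous_at_mul; [exact: coord_continuous|exact: continuous_at_enormV].
Qed.

Lemma normalize_coord x j : normalize x ord0 j = (enorm x)^-1 * x ord0 j.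
Proof. by rewrite /normalize mxE. Qed.

Lemma enormV_q x : x != 0 -> (enorm x)^-1 = enorm x * q x.
Proof.
move=> x0; rewrite ?qE nsqE; field.
by rewrite enorm_eq0.
Qed.

Lemma Ck1_normalize j : Ck 1 (fun x : V => normalize x ord0 j).
Proof.
apply: (@Ck_ext _ _ _ (fun x : V => (enorm x * q x) * x ord0 j)).
  by move=> x x0; rewrite normalize_coord enormV_q.
by apply: Ck_mul; [apply: Ck_mul; [exact: Ck1_enorm|exact: Ck_q]|exact: Ck_coord].
Qed.

Lemma pd_normalize i j x : x != 0 -> pd i (fun x : V => normalize x ord0 j) x =
  ((j == i)%:R - normalize x ord0 j * normalize x ord0 i) * (enorm x)^-1.
Proof.
move=> x0; have e0 : enorm x != 0 by rewrite enorm_eq0.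
rewrite (pd_eq (g := fun x : V => (enorm x * q x) * x ord0 j) i x0); last first.
  by move=> y y0; rewrite normalize_coord enormV_q.
rewrite (pdM i (Ck_mul Ck1_enorm (Ck_q 1)) (Ck_coord 1 j) x0).
rewrite (pdM i Ck1_enorm (Ck_q 1) x0) pd_coord (pd_q i x0) (pd_enorm i x0).
rewrite !normalize_coord ?qE nsqE; field.
exact: e0.
Qed.

Lemma continuous_at_normalize x : x != 0 -> {for x, continuous (@normalize R n)}.
Proof.
by move=> x0; apply: continuous_rV => j; exact: (Ck_cont (Ck1_normalize j) x0).
Qed.

Lemma normalize_neq0 x : x != 0 -> normalize x != 0.
Proof. by move=> x0; rewrite -enorm_gt0 enorm_normalize// ltr01. Qed.

Lemma sum_normalize_sqr x : x != 0 -> \sum_(i < n) normalize x ord0 i * normalize x ord0 i = 1.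
Proof.
by move=> x0; rewrite -[LHS]/(nsq (normalize x)) nsqE enorm_normalize// expr1n.
Qed.

(** The radial derivative of [f] at the point of the sphere of radius [r] in the direction of
    [x]. *)
Definition radgrad f (r : R) x : R := \sum_(j < n) normalize x ord0 j * pd j f (r *: normalize x).

(* The 0-homogeneous extension of the restriction of [f] to the sphere of radius [r]. *)
Lemma is_derive_sphere f (r : R) i x : Ck 1 f -> 0 < r -> x != 0 ->
  is_derive x (dl i) (fun z => f (r *: normalize z))
   (r * (enorm x)^-1 * (pd i f (r *: normalize x) - normalize x ord0 i * radgrad f r x)).
Proof.
move=> Cf r0 x0.
pose dphi j := r * (((j == i)%:R - normalize x ord0 j * normalize x ord0 i) * (enorm x)^-1).
have y0 : r *: normalize x != 0 by rewrite scaler_eq0 negb_or gt_eqF// normalize_neq0.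
have := @is_derive_chain _ _ f (fun z => r *: normalize z) x (dl i) dphi Cf y0.
move=> /(_ _)/is_derive_eq; apply.
  move=> j; rewrite (_ : (fun z => _) = fun z => r * normalize z ord0 j); last first.
    by apply/funext => z; rewrite mxE.
  have Cn : Ck 1 (fun z : V => r * normalize z ord0 j) by apply: Ck_scale; exact: Ck1_normalize.
  rewrite /dphi -(pd_normalize i j x0) -(pdZ r i (Ck1_normalize j) x0).
  by apply/derivableP; exact: (@Ck_derivable _ _ 0 _ i _ Cn x0).
rewrite /dphi /radgrad mulrBr !mulr_sumr.
rewrite (eq_bigr (fun j => r * (enorm x)^-1 * ((j == i)%:R * pd j f (r *: normalize x))
  - r * (enorm x)^-1 * (normalize x ord0 i * (normalize x ord0 j * pd j f (r *: normalize x))))).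
  rewrite sumrB; congr (_ - _).
  by rewrite -mulr_sumr (bigD1 i)//= eqxx mul1r big1 ?addr0// => j /negbTE ->; rewrite mul0r.
by move=> j _; ring.
Qed.

(** The i-th partial derivative of the cone function |x| (f (r x / |x|) - m), see [is_derive_cone]:
    a radial part plus [r] times the tangential gradient of [f]. The explicit formula has a value at
    every point, and is 0-homogeneous. *)
Definition spgrad f (r m : R) i x : R := normalize x ord0 i * (f (r *: normalize x) - m)
  + r * (pd i f (r *: normalize x) - normalize x ord0 i * radgrad f r x).

Lemma is_derive_cone f (r m : R) i x : Ck 1 f -> 0 < r -> x != 0 ->
  is_derive x (dl i) (fun z => enorm z * (f (r *: normalize z) - m)) (spgrad f r m i x).
Proof.
move=> Cf r0 x0; have e0 : enorm x != 0 by rewrite enorm_eq0.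
have d1 := is_derive_sphere i Cf r0 x0.
have d2 := is_derive_enorm i x0.
have d3 : is_derive x (dl i) (fun z => f (r *: normalize z) - m)
   (r * (enorm x)^-1 * (pd i f (r *: normalize x) - normalize x ord0 i * radgrad f r x)).
  by rewrite -[X in is_derive _ _ _ X]subr0; apply: is_deriveB.
apply: is_derive_eq (is_deriveM d2 d3) _.
rewrite /spgrad /GRing.scale/= normalize_coord; field.
exact: e0.
Qed.

Lemma continuous_at_sphere f (r : R) x : Ck 0 f -> 0 < r -> x != 0 ->
  {for x, continuous (fun z => f (r *: normalize z))}.
Proof.
move=> Cf r0 x0.
have y0 : r *: normalize x != 0 by rewrite scaler_eq0 negb_or gt_eqF// normalize_neq0.
apply: (@continuous_comp _ _ _ (fun z : V => r *: normalize z) f).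
  by apply: continuousZl_tmp; exact: continuous_at_normalize.
exact: Ck_cont Cf y0.
Qed.

Lemma continuous_at_radgrad f (r : R) x : Ck 1 f -> 0 < r -> x != 0 ->
  {for x, continuous (radgrad f r)}.
Proof.
move=> Cf r0 x0; apply: continuous_at_sum => j; apply: continuous_at_mul.
  exact: (Ck_cont (Ck1_normalize j) x0).
exact: (continuous_at_sphere (Ck_pd j Cf) r0 x0).
Qed.

Lemma continuous_at_spgrad f (r m : R) i x : Ck 1 f -> 0 < r -> x != 0 ->
  {for x, continuous (spgrad f r m i)}.
Proof.
move=> Cf r0 x0; have cn := Ck_cont (Ck1_normalize i) x0.
apply: continuous_at_add.
  apply: continuous_at_mul => //; apply: continuous_at_sub; last exact: cst_continuous.
  exact: (continuous_at_sphere (CkW Cf) r0 x0).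
apply: continuous_at_mul; first exact: cst_continuous.
apply: continuous_at_sub; first exact: (continuous_at_sphere (Ck_pd i Cf) r0 x0).
apply: continuous_at_mul => //; exact: continuous_at_radgrad.
Qed.

(** Pythagoras: the radial and tangential parts are orthogonal, and the last bracket is the squared
    tangential gradient of [f]. *)
Lemma spgrad_sqr f (r m : R) x : x != 0 ->
  \sum_(i < n) spgrad f r m i x ^+ 2 = (f (r *: normalize x) - m) ^+ 2 +
  r ^+ 2 * (dotg f f (r *: normalize x) - radgrad f r x ^+ 2).
Proof.
move=> x0; rewrite /spgrad; set k := f _ - m; set p := radgrad f r x.
rewrite (eq_bigr (fun i => (k - r * p) ^+ 2 * (normalize x ord0 i * normalize x ord0 i)
  + 2 * (k - r * p) * r * (normalize x ord0 i * pd i f (r *: normalize x))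
  + r ^+ 2 * (pd i f (r *: normalize x) * pd i f (r *: normalize x)))); last first.
  by move=> i _; ring.
rewrite !big_split/= -!mulr_sumr sum_normalize_sqr// -/(radgrad f r x) -/p -/(dotg f f _).
ring.
Qed.

Lemma spgrad_homog f (r m c : R) i x : 0 < c -> spgrad f r m i (c *: x) = spgrad f r m i x.
Proof. by move=> c0; rewrite /spgrad /radgrad normalizeZ. Qed.

(** The factor by which [x] is multiplied in the gradient at [x] of the radial function sending z to
    f (|z| y). *)
Definition raderiv f y x : R :=
  (enorm x)^-1 * \sum_(j < n) y ord0 j * pd j f (enorm x *: y).

Lemma is_derive_radial f y i x : Ck 1 f -> y != 0 -> x != 0 ->
  is_derive x (dl i) (fun z => f (enorm z *: y)) (x ord0 i * raderiv f y x).
Proof.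
move=> Cf y0 x0.
pose dphi j := x ord0 i * (enorm x)^-1 * y ord0 j.
have ey0 : enorm x *: y != 0 by rewrite scaler_eq0 negb_or enorm_eq0 x0.
have := @is_derive_chain _ _ f (fun z => enorm z *: y) x (dl i) dphi Cf ey0.
move=> /(_ _)/is_derive_eq; apply.
  move=> j; rewrite (_ : (fun z => _) = fun z => y ord0 j * enorm z); last first.
    by apply/funext => z; rewrite mxE mulrC.
  apply: is_derive_eq (is_deriveZ (y ord0 j) (is_derive_enorm i x0)) _.
  by rewrite /dphi /GRing.scale/=; ring.
by rewrite /raderiv /dphi mulrA mulr_sumr; apply: eq_bigr => j _; ring.
Qed.

Lemma Ck1_radial f y : Ck 1 f -> y != 0 -> Ck 1 (fun z => f (enorm z *: y)).
Proof.
move=> Cf y0.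
have cc g x : Ck 0 g -> x != 0 -> {for x, continuous (fun z => g (enorm z *: y))}.
  move=> Cg x0; have ey0 : enorm x *: y != 0 by rewrite scaler_eq0 negb_or enorm_eq0 x0.
  apply: (@continuous_comp _ _ _ (fun z : V => enorm z *: y) g); last exact: Ck_cont Cg ey0.
  by apply: continuousZr_tmp; exact: enorm_continuous.
split=> [x x0|i]; first exact: cc (CkW Cf) x0.
split=> [x x0|]; first by have [] := is_derive_radial i Cf y0 x0.
split => // x x0.
apply: (@continuous_at_ext _ _ (fun z : V => z ord0 i * raderiv f y z)) => //.
  by move=> z z0; have [_ h] := is_derive_radial i Cf y0 z0; symmetry; exact: h.
apply: continuous_at_mul; first exact: coord_continuous.
apply: continuous_at_mul; first exact: continuous_at_enormV.
apply: continuous_at_sum => j; apply: continuous_at_mul; first exact: cst_continuous.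
exact: cc (Ck_pd j Cf) x0.
Qed.

Lemma pd_radial f y i x : Ck 1 f -> y != 0 -> x != 0 ->
  pd i (fun z => f (enorm z *: y)) x = x ord0 i * raderiv f y x.
Proof. by move=> Cf y0 x0; have [_] := is_derive_radial i Cf y0 x0. Qed.

Lemma annular_radial f y : annular f -> enorm y = 1 -> annular (fun z => f (enorm z *: y)).
Proof.
move=> [ab [a0 fab]] y1; exists ab; split => // x /fab.
by rewrite enormZ ?enorm_ge0// y1 mulr1.
Qed.

(* A radial function has a radial gradient, on which the form [T] vanishes. *)
Lemma B_radial_Lam f y : An 2 f -> enorm y = 1 -> B (fun z => f (enorm z *: y)) (Lam f) = 0.
Proof.
move=> Af y1; have [Cf af] := Af.
have y0 : y != 0 by rewrite -enorm_gt0 y1 ltr01.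
have Cf1 : Ck 1 f := CkW Cf.
have Ah : An 1 (fun z => f (enorm z *: y)).
  by split; [exact: Ck1_radial|exact: annular_radial].
rewrite (B_Lam Af Ah) T_C /T.
have AT := An_T (An_le (isT : (1 <= 2)%N) Af) Ah.1.
rewrite (_ : (fun x => _) = fun x => 0 * Eu f x).
  by rewrite (I_scale 0 (An_Eu Af)) mul0r.
apply: (An_eq AT (An_scale 0 (An_Eu Af))) => x x0; rewrite mul0r.
have -> : Eu (fun z => f (enorm z *: y)) x = nsq x * raderiv f y x.
  by rewrite /Eu mulr_suml; apply: eq_bigr => i _; rewrite pd_radial// mulrA.
have -> : dotg f (fun z => f (enorm z *: y)) x = raderiv f y x * Eu f x.
  by rewrite /Eu mulr_sumr; apply: eq_bigr => i _; rewrite pd_radial//; ring.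
have := qK x0; rewrite !wE; move: (nsq x) (q x) (Eu f x) (raderiv f y x) => a b c d ab.
have -> : b * b * (c * (a * d)) = (a * b) * (b * (d * c)) by ring.
by rewrite ab mul1r subrr.
Qed.

End radial_calculus.
(** * The Poincare inequality on spheres *)

Section polar_gauss.
Local Open Scope ereal_scope.
Context {R : realType}.
Notation leb := (@lebesgue_measure R).
Notation RR := (measurableTypeR R).
Notation mu := (@lebesgue_rV R).

Lemma FTC2_is_derive (f F : R -> R) (a b : R) : (a < b)%R -> continuous f ->
  (forall x : R, is_derive x (1 : R)%R F (f x)) ->
  \int[leb]_(x in `]a, b]) (f x)%:E = (F b - F a)%:E.
Proof.
move=> ab cf dF.
have cF x : {for x, continuous F}.
  by apply: differentiable_continuous; apply/derivable1_diffP; have [] := dF x.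
rewrite integral_itv_obnd_cbnd; last first.
  by apply: measurable_funTS; apply/measurable_EFinP; exact: continuous_measurable_fun.
rewrite (continuous_FTC2 ab (F := F)) ?EFinB//.
- exact: continuous_subspaceT.
- split; first by move=> x _; have [] := dF x.
  + by apply: cvg_at_right_filter; exact: cF.
  + by apply: cvg_at_left_filter; exact: cF.
- by move=> x _; rewrite derive1E; have [] := dF x.
Qed.

Lemma integral_power n (a : R) : (0 < n)%N -> (0 < a)%R ->
  \int[leb]_(s in `]0%R, a]) (n%:R * s ^+ n.-1)%:E = (a ^+ n)%:E.
Proof.
move=> n0 a0.
have cf : continuous (fun s : R => n%:R * s ^+ n.-1)%R.
  move=> x; apply: (@continuous_at_mul _ _ (fun=> n%:R) (fun s : R => s ^+ n.-1)%R x).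
    exact: cst_continuous.
  exact: exprn_continuous.
have df (x : R) : is_derive x (1 : R)%R (fun s : R => s ^+ n)%R (n%:R * x ^+ n.-1)%R.
  apply: is_derive_eq (derivableP (@exprn_derivable _ n x (1%R : R))) _.
  by rewrite exp_derive /GRing.scale/= mulr1.
by rewrite (FTC2_is_derive a0 cf df) expr0n eqn0Ngt n0 subr0.
Qed.

(** One of the [n] normalizing factors goes into [gpdf (enorm x)], whence the exponent [n.-1]. *)
Lemma gdens_radial n (x : 'rV[R]_n) : (0 < n)%N ->
  gdens x = (normal_peak 1 ^+ n.-1 * gpdf (enorm x))%R.
Proof.
move=> n0; rewrite gpdfE mulrA -exprSr prednK// /gdens.
rewrite (eq_bigr (fun i => normal_peak 1 * expR (- (x ord0 i ^+ 2 / 2)))%R); last first.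
  by move=> i _; exact: gpdfE.
rewrite big_split/= prodr_const card_ord -expR_sum sumrN -mulr_suml.
by rewrite enorm_sqr.
Qed.

Lemma normalize_normalize n (x : 'rV[R]_n) : x != 0%R -> normalize (normalize x) = normalize x.
Proof. by move=> x0; rewrite {2}/normalize normalizeZ// invr_gt0 enorm_gt0. Qed.

(* E |X|^j for a standard normal vector X, divided by the volume of the unit ball. *)
Definition gmom n j : \bar R := \int[leb]_(r in `]0%R, +oo[)
  (n%:R * r ^+ n.-1 * (normal_peak 1 ^+ n.-1 * gpdf r * r ^+ j))%:E.

Lemma gmom_measurable n j : measurable_fun [set: RR]
  (fun r : R => n%:R * r ^+ n.-1 * (normal_peak 1 ^+ n.-1 * gpdf r * r ^+ j))%R.
Proof.
apply: measurable_funM; first by apply: measurable_funM => //; exact: measurable_funX.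
apply: measurable_funM; last exact: measurable_funX.
by apply: measurable_funM => //; exact: measurable_gpdf.
Qed.

Lemma gmom_integrand_ge0 n j (r : R) : (0 < r)%R ->
  (0 <= n%:R * r ^+ n.-1 * (normal_peak 1 ^+ n.-1 * gpdf r * r ^+ j))%R.
Proof.
move=> r0; rewrite !mulr_ge0// ?exprn_ge0 ?gpdf_ge0 ?(ltW r0)//.
exact: normal_peak_ge0.
Qed.

(** Radial and angular variables separate in polar coordinates; the factor of degree [j] only
    affects the radial moment. *)
Lemma integral_gauss_polar n j (Phi : 'rV[R]_n -> \bar R) : (0 < n)%N ->
  measurable_fun setT Phi -> (forall x, 0 <= Phi x) ->
  wint (mu n) (@gdens R n) (fun x => (enorm x ^+ j)%:E * Phi (normalize x)) =
  gmom n j * \int[mu n]_(y in @punctured_ball R n) Phi (normalize y).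
Proof.
move=> n0 mPhi Phi0.
have mPn : measurable_fun setT (fun x => Phi (normalize x)).
  exact: measurableT_comp mPhi (@measurable_normalize R n).
have me : measurable_fun setT (fun x : 'rV[R]_n => (enorm x ^+ j)%:E).
  by apply/measurable_EFinP; apply: measurable_funX; exact: measurable_enorm.
have mF : measurable_fun setT (fun x : 'rV[R]_n => (gdens x)%:E * ((enorm x ^+ j)%:E * Phi (normalize x))).
  apply: emeasurable_funM; first by apply/measurable_EFinP; exact: measurable_gdens.
  exact: emeasurable_funM.
rewrite /wint integral_polar//; last first.
  by move=> x; rewrite !mule_ge0// lee_fin ?gdens_ge0 ?exprn_ge0 ?enorm_ge0.
rewrite /gmom -ge0_integralZr//.
- apply: eq_integral => r; rewrite inE/= in_itv/= andbT => r0.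
  rewrite [in RHS]EFinM -muleA; congr (_ * _).
  rewrite -ge0_integralZl//; first last.
  + by rewrite lee_fin !mulr_ge0 ?exprn_ge0 ?gpdf_ge0 ?(ltW r0)//; exact: normal_peak_ge0.
  + exact: measurable_funTS.
  + exact: measurable_punctured_ball.
  apply: eq_integral => y /set_mem/= /andP[y0 _].
  have y1 : y != 0%R by rewrite -enorm_gt0.
  rewrite muleA -EFinM gdens_radial// enormZ ?(ltW r0)// enorm_normalize// mulr1.
  by rewrite normalizeZ// normalize_normalize.
- by apply: measurable_funTS; apply/measurable_EFinP; exact: gmom_measurable.
- by move=> r; rewrite /= in_itv/= andbT => r0; rewrite lee_fin gmom_integrand_ge0.
- exact: integral_ge0.
Qed.

(** The total mass of the Gaussian. It normalizes averages over the ball without any formula for the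
    volume. *)
Lemma gmom0_ball n : (0 < n)%N -> gmom n 0 * mu n (@punctured_ball R n) = 1.
Proof.
move=> n0; have := @integral_gauss_polar n 0 (cst 1) n0 (measurable_cst _) (fun=> @lee01 R).
rewrite integral_cst ?mul1e; last exact: measurable_punctured_ball.
by move=> <-; rewrite -[RHS](@integral_gdens R n); apply: eq_integral => x _; rewrite expr0 mul1e mule1.
Qed.

(** An integration by parts carried out by Tonelli: [gpdf s] is the integral of a gpdf a over a >=
    s, and n s^(n-1) is then integrated over ]0, a]. Divided by [gmom n 0], this says that the
    second moment of |X| is n. *)
Lemma gmom_recl n : (0 < n)%N -> gmom n 2 = n%:R%:E * gmom n 0.
Proof.
move=> n0; pose c := (normal_peak 1 ^+ n.-1 : R)%R.
have c0 : (0 <= c)%R by rewrite exprn_ge0// normal_peak_ge0.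
pose f (s a : RR) : \bar R :=
  (if ((0 < s) && (s <= a))%R then (n%:R * s ^+ n.-1) * (c * (a * gpdf a)) else 0)%:E.
have f0 s a : 0 <= f s a.
  rewrite /f lee_fin; case: ifPn => // /andP[s0 sa].
  have a0 : (0 <= a)%R by exact: le_trans (ltW s0) sa.
  apply: mulr_ge0; first by rewrite mulr_ge0// exprn_ge0// ltW.
  by apply: mulr_ge0 => //; rewrite mulr_ge0// gpdf_ge0.
have mf : measurable_fun setT (fun p : RR * RR => f p.1 p.2).
  apply/measurable_EFinP; apply: measurable_fun_ifT => //.
    by apply: measurable_and; [exact: measurable_fun_ltr|exact: measurable_fun_ler].
  apply: measurable_funM.
    by apply: measurable_funM => //; apply: measurable_funX.
  apply: measurable_funM => //; apply: measurable_funM => //.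
  exact: (measurableT_comp (@measurable_gpdf R) measurable_snd).
have mo : measurable_fun [set: RR] (fun=> 1%R : R) by exact: measurable_cst.
have S := @wint_swap _ _ _ _ _ leb (fun=> 1%R) leb (fun=> 1%R) mo (fun=> ler01) mo (fun=> ler01) f mf f0.
have E1 : wint leb (fun=> 1%R) (fun s => wint leb (fun=> 1%R) (f s)) = gmom n 0.
  clear S mf f0 mo.
  rewrite /gmom [RHS]integral_mkcond; apply: eq_integral => s _; rewrite mul1e patchE mem_setE in_itv/= andbT.
  case: ifPn => s0; last first.
    by apply: integral0_eq => a _; rewrite /f (negbTE s0); exact: mule0.
  transitivity (\int[leb]_(a in `[s, +oo[) ((n%:R * s ^+ n.-1 * c)%:E * (a * gpdf a)%:E)).
    rewrite [RHS]integral_mkcond; apply: eq_integral => a _; rewrite patchE mem_setE in_itv/= andbT mul1e.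
    rewrite /f s0 /=; case: ifP => _; last exact: erefl.
    by rewrite -EFinM; congr (_%:E); rewrite mulrA.
  rewrite ge0_integralZl; [|exact: measurable_itv| | |].
  - rewrite (integral_xgpdf (ltW s0)) -EFinM expr0 mulr1; congr (_%:E).
    by rewrite mulrA.
  - apply: measurable_funTS; apply/measurable_EFinP; apply: measurable_funM => //.
    exact: measurable_gpdf.
  - move=> a /=; rewrite in_itv/= andbT => sa; rewrite lee_fin mulr_ge0 ?gpdf_ge0//.
    exact: le_trans (ltW s0) sa.
  - by rewrite lee_fin; apply: mulr_ge0 => //; apply: mulr_ge0 => //; rewrite exprn_ge0// ltW.
have mfS : measurable_fun [set: RR] (fun a => wint leb (fun=> 1%R) (f^~ a)).
  have mf' : measurable_fun setT (fun p : RR * RR => f p.2 p.1).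
    exact: (measurableT_comp mf (@measurable_swap _ _ RR RR)).
  have f0' a s : 0 <= f s a by exact: f0.
  exact (@measurable_wint_comp _ _ _ leb (fun=> 1%R) mo (fun=> ler01) _ RR (fun a s => f s a) mf' f0').
have fS0 a : 0 <= wint leb (fun=> 1%R) (f^~ a) by exact: wint_ge0.
rewrite -E1 S /gmom integral_mkcond.
transitivity (\int[leb]_a (n%:R%:E * wint leb (fun=> 1%R) (f^~ a))); last first.
  rewrite ge0_integralZl; [|exact: measurableT|exact: mfS|by move=> a _; exact: fS0|by rewrite lee_fin].
  by congr (_ * _); apply: eq_integral => a _; rewrite mul1e.
apply: eq_integral => a _; rewrite patchE mem_setE in_itv/= andbT.
clear S E1 mf f0 mo mfS fS0.
case: ifPn => a0; last first.
  rewrite /wint integral0_eq ?mule0// => s _; rewrite /f ifF ?mule0//.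
  by apply/negbTE; rewrite negb_and -!leNgt; case: (leP s 0%R) => //= s0; rewrite -ltNge (le_lt_trans _ s0)// leNgt.
transitivity (n%:R%:E * \int[leb]_(s in `]0%R, a]) ((c * (a * gpdf a))%:E * (n%:R * s ^+ n.-1)%:E)).
  rewrite ge0_integralZl; [|exact: measurable_itv| | |].
  - rewrite integral_power// -!EFinM; congr (_%:E).
    rewrite -/c; have -> : (a ^+ n = a * a ^+ n.-1)%R by rewrite -exprS prednK.
    by move: (c) (gpdf a) (a ^+ n.-1)%R (n%:R : R) => c' g p nn; ring.
  - apply: measurable_funTS; apply/measurable_EFinP; apply: measurable_funM => //.
  - by move=> s /=; rewrite in_itv/= => /andP[s0 _]; rewrite lee_fin mulr_ge0// exprn_ge0// ltW.
  - by rewrite lee_fin; apply: mulr_ge0 => //; rewrite mulr_ge0 ?gpdf_ge0// ltW.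
congr (_ * _); rewrite integral_mkcond; apply: eq_integral => s _; rewrite patchE mem_setE in_itv/= mul1e.
by rewrite /f; case: ifP => // _; rewrite -EFinM mulrC.
Qed.

End polar_gauss.

(** * Averages over the ball and the surface measure *)

Section ball_average.
Local Open Scope ereal_scope.
Context {R : realType} {n : nat}.
Hypothesis n0 : (0 < n)%N.
Notation V := 'rV[R]_n.
Notation mu := (@lebesgue_rV R n).
Notation ball1 := (@punctured_ball R n).

Definition vball : R := fine (mu ball1).

Let mB : measurable ball1. Proof. exact: measurable_punctured_ball. Qed.

Lemma ball_normalize_neq0 (y : V) : ball1 y -> y != 0%R.
Proof. by move=> /= /andP[y0 _]; rewrite -enorm_gt0. Qed.

Lemma vballE : mu ball1 = vball%:E.
Proof.
rewrite fineK// ge0_fin_numE//.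
apply: (le_lt_trans _ (@lebesgue_rV_cube_fin R n 1)).
apply: le_measure; rewrite ?inE//.
  apply: (@measurable_rV_box R n (fun=> `[(- 1)%R, 1%R]%classic)) => i.
  exact: measurable_itv.
move=> x /= /andP[_ x1] i; rewrite in_itv/= -ler_norml.
exact: le_trans (ler_enorm_coord x i) x1.
Qed.

(** A null ball would make the product in [gmom0_ball] vanish, whereas it is 1. *)
Lemma vball_gt0 : (0 < vball)%R.
Proof.
have v0 : (0 <= vball)%R by exact: fine_ge0.
rewrite lt_neqAle v0 andbT; apply/eqP => vE.
by have := @gmom0_ball R n n0; rewrite vballE -vE mule0 => /esym/eqP; rewrite onee_eq0.
Qed.

Lemma gmom0E : @gmom R n 0 = (vball^-1)%:E.
Proof.
have := @gmom0_ball R n n0; rewrite vballE => h.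
have v0 := vball_gt0.
rewrite -[LHS]mule1 -[X in _ * X](_ : vball%:E * (vball^-1)%:E = 1).
  by rewrite muleA h mul1e.
by rewrite -EFinM divff// gt_eqF.
Qed.

Lemma integral_surface (Phi : V -> \bar R) : measurable_fun setT Phi ->
  (forall x, 0 <= Phi x) ->
  \int[surface_measure n]_(x in sphere n) Phi x =
  n%:R%:E * \int[mu]_(y in ball1) Phi (normalize y).
Proof.
move=> mPhi Phi0.
(* Off the ball [phi] is 0, a point outside the sphere. On subsets of the sphere the surface measure
   is therefore n times the push-forward by [phi] of the whole Lebesgue measure. *)
pose phi (y : V) : V := if y \in ball1 then normalize y else 0%R.
have mphi : measurable_fun setT phi.
  apply: measurable_fun_ifT => //; last exact: measurable_normalize.
  by apply: (measurable_fun_bool true); rewrite setTI preimage_mem_true.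
have nn0 : (0 <= n%:R :> R)%R by [].
have mS : measurable (@sphere R n).
  rewrite (_ : sphere n = @enorm R n @^-1` [set 1%R])//.
  by rewrite -[X in measurable X]setTI; apply: measurable_enorm => //; exact: measurable_set1.
rewrite (@eq_measure_integral _ _ _ _ (mscale (NngNum nn0) (pushforward mu phi))); last first.
  move=> A mA AS; rewrite /surface_measure /mscale /pushforward/=; congr (_ * mu _).
  apply/seteqP; split => y /=.
    by move=> [yB Ay]; rewrite /phi mem_set.
  rewrite /phi; case: ifPn => [/set_mem//|_ A0].
  have := AS _ A0; rewrite /sphere/= => /eqP.
  by rewrite (eqP (_ : enorm (0%R : V) == 0%R)) ?enorm_eq0 ?eqxx// eq_sym oner_eq0.
rewrite ge0_integral_mscale//; last exact: measurable_funTS.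
rewrite ge0_integral_pushforward//; last exact: measurable_funTS.
congr (_ * _).
rewrite (_ : phi @^-1` sphere n = ball1).
  by apply: eq_integral => y yB; rewrite /= /phi yB.
apply/seteqP; split => y /=; rewrite /phi.
  case: ifPn => [/set_mem//|_]; rewrite /sphere/= => /eqP.
  by rewrite (eqP (_ : enorm (0%R : V) == 0%R)) ?enorm_eq0 ?eqxx// eq_sym oner_eq0.
by move=> yB; rewrite mem_set//= /sphere/= enorm_normalize// ball_normalize_neq0.
Qed.

Lemma ball_bounded_integrable (M : R) (g : V -> R) : measurable_fun setT g ->
  (forall x, (`|g x| <= M)%R) -> mu.-integrable ball1 (EFin \o g).
Proof.
move=> mg gM; apply: measurable_bounded_integrable => //.
- by change (mu ball1 < +oo); rewrite vballE ltry.
- exact: measurable_funTS.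
- exists M; split; first exact: num_real.
  by move=> N MN x _ /=; rewrite (le_trans (gM x))// ltW.
Qed.

Lemma Rintegral_surface (M : R) (g : V -> R) : measurable_fun setT g ->
  (forall x, (`|g x| <= M)%R) ->
  (\int[surface_measure n]_(x in sphere n) g x =
  n%:R * \int[mu]_(y in ball1) g (normalize y))%R.
Proof.
move=> mg gM; rewrite /Rintegral.
have mgE : measurable_fun setT (EFin \o g) by exact/measurable_EFinP.
have mgn : measurable_fun setT (g \o @normalize R n).
  exact: measurableT_comp mg (@measurable_normalize R n).
have ig := @ball_bounded_integrable M _ mgn (fun x => gM _).
have [fp fn] := (integrable_pos_fin_num mB ig, integrable_neg_fin_num mB ig).
rewrite integralE integral_surface//; last exact: measurable_funepos.
rewrite integral_surface//; last exact: measurable_funeneg.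
rewrite [in RHS]integralE.
set a := (X in n%:R%:E * X - _); set b := (X in _ - n%:R%:E * X).
have aE : a = \int[mu]_(x in ball1) (EFin \o (g \o @normalize R n))^\+ x.
  by apply: eq_integral => y _; rewrite !funeposE.
have bE : b = \int[mu]_(x in ball1) (EFin \o (g \o @normalize R n))^\- x.
  by apply: eq_integral => y _; rewrite !funenegE.
rewrite -[X in (_ * fine (X - _))%R]aE -[X in (_ * fine (_ - X))%R]bE.
rewrite -aE in fp; rewrite -bE in fn.
by rewrite -(fineK fp) -(fineK fn) -!EFinM -!EFinB/= mulrBr.
Qed.

(** [radial_proj] for real functions, as an average over the ball: the factor n of the surface
    measure cancels. *)
Definition rproj (f : V -> R) (x : V) : R :=
  (vball^-1 * \int[mu]_(y in ball1) f (enorm x *: normalize y))%R.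

Lemma surface_sphere : surface_measure n (sphere n) = (n%:R * vball)%:E.
Proof.
rewrite /surface_measure EFinM -vballE; congr (_ * mu _).
apply/seteqP; split => y /=; first by case.
by move=> yB; split => //; rewrite /sphere/= enorm_normalize// ball_normalize_neq0.
Qed.

Lemma measurable_scale_rV (r : R) : measurable_fun setT (fun x : V => (r *: x)%R).
Proof.
apply: measurable_fun_rVP => i.
under eq_fun do rewrite mxE.
by apply: measurable_funM => //; exact: measurable_rV_coord.
Qed.

Lemma radial_proj_Re (M : R) (f : V -> R[i]) (x : V) :
  measurable_fun setT (fun y => complex.Re (f y)) ->
  (forall y, (`|complex.Re (f y)| <= M)%R) ->
  complex.Re (radial_proj f x) = rproj (fun y => complex.Re (f y)) x.
Proof.
move=> mf fM; rewrite /radial_proj /sphere_integral /= mul0r subr0 surface_sphere /=.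
rewrite (@Rintegral_surface M)//; last first.
  exact: measurableT_comp mf (measurable_scale_rV _).
by rewrite /rproj invfM -mulrA [X in (_ * X)%R]mulrCA mulKf// pnatr_eq0 -lt0n.
Qed.

Lemma radial_proj_Im (M : R) (f : V -> R[i]) (x : V) :
  measurable_fun setT (fun y => complex.Im (f y)) ->
  (forall y, (`|complex.Im (f y)| <= M)%R) ->
  complex.Im (radial_proj f x) = rproj (fun y => complex.Im (f y)) x.
Proof.
move=> mf fM; rewrite /radial_proj /sphere_integral /= mul0r addr0 surface_sphere /=.
rewrite (@Rintegral_surface M)//; last first.
  exact: measurableT_comp mf (measurable_scale_rV _).
by rewrite /rproj invfM -mulrA [X in (_ * X)%R]mulrCA mulKf// pnatr_eq0 -lt0n.
Qed.

End ball_average.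
Section sphere_tools.
Local Open Scope ereal_scope.
Context {R : realType}.
Notation leb := (@lebesgue_measure R).

Lemma continuous_itv_integrable (f : R -> R) (a b : R) : continuous f ->
  leb.-integrable `]a, b] (EFin \o f).
Proof.
move=> cf; apply: (@integrableS _ _ _ leb (`[a, b]%classic : set (measurableTypeR R))) => //.
- by move=> x /=; rewrite !in_itv/= => /andP[/ltW -> ->].
- apply: continuous_compact_integrable; first exact: segment_compact.
  exact: continuous_subspaceT.
Qed.

(* Integrate [S ^+ 2 >= 2 c S - c ^+ 2] with [c] the mean slope of [H]. *)
Lemma sqr_increment_le (H S : R -> R) (a b : R) : (b < a)%R -> continuous S ->
  (forall t : R, is_derive t (1 : R)%R H (S t)) ->
  sqd (H a) (H b) <= (a - b)%:E * \int[leb]_(t in `]b, a]) (S t ^+ 2)%:E.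
Proof.
move=> ba cS dH; pose c := ((H a - H b) / (a - b))%R.
have ab0 : (0 < a - b)%R by rewrite subr_gt0.
have c2S : continuous (fun t => 2 * c * S t - c ^+ 2)%R.
  move=> t; apply: (@continuous_at_sub _ _ (fun t => 2 * c * S t)%R (fun=> c ^+ 2)%R t).
    apply: (@continuous_at_mul _ _ (fun=> 2 * c)%R S t); [exact: cst_continuous|exact: cS].
  exact: cst_continuous.
have cSS : continuous (fun t => S t ^+ 2)%R.
  by move=> t; apply: (@continuous_at_mul _ _ S S t); exact: cS.
have d2 (t : R) : is_derive t (1 : R)%R (fun t => 2 * c * H t - c ^+ 2 * t)%R (2 * c * S t - c ^+ 2)%R.
  have h := is_deriveB (is_deriveZ (2 * c)%R (dH t)) (is_deriveZ (c ^+ 2)%R (is_derive_id t (1 : R)%R)).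
  by apply: is_derive_eq h _; rewrite /GRing.scale/= mulr1.
have := FTC2_is_derive ba c2S d2.
move=> E1.
have : \int[leb]_(t in `]b, a]) (2 * c * S t - c ^+ 2)%:E <= \int[leb]_(t in `]b, a]) (S t ^+ 2)%:E.
  apply: le_integral.
  - exact: measurable_itv.
  - exact: continuous_itv_integrable c2S.
  - exact: continuous_itv_integrable cSS.
  - move=> t _; rewrite lee_fin -subr_ge0.
    by rewrite (_ : (_ - _)%R = (S t - c) ^+ 2)%R ?sqr_ge0//; ring.
rewrite E1 => h; rewrite sqdE.
apply: (@le_trans _ _ ((a - b)%:E * (2 * c * H a - c ^+ 2 * a - (2 * c * H b - c ^+ 2 * b))%:E)).
  rewrite -EFinM lee_fin le_eqVlt; apply/orP; left; apply/eqP; rewrite /c; field.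
  by rewrite gt_eqF.
by apply: lee_wpmul2l h; rewrite lee_fin ltW.
Qed.

Section centered.
Context d (T : measurableType d).
Variables (m : {sigma_finite_measure set T -> \bar R}) (w : T -> R) (F : T -> R).
Hypotheses (mw : measurable_fun setT w) (w0 : forall x, (0 <= w x)%R).
Hypotheses (w1 : \int[m]_x (w x)%:E = 1) (mF : measurable_fun setT F).
Hypotheses (F2 : wint m w (fun x => (F x ^+ 2)%:E) < +oo).

Let iw : m.-integrable setT (EFin \o w).
Proof.
apply/integrableP; split; first exact/measurable_EFinP.
under eq_integral do rewrite /= ger0_norm//.
by rewrite w1 ltry.
Qed.

Let iwF2 : m.-integrable setT (EFin \o (fun x => w x * F x ^+ 2)%R).
Proof.
apply/integrableP; split.
  by apply/measurable_EFinP; apply: measurable_funM => //; exact: measurable_funX.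
rewrite (eq_integral (fun x => (w x)%:E * (F x ^+ 2)%:E)) => [|x _]; first exact: F2.
by rewrite /= ger0_norm ?EFinM// mulr_ge0 ?sqr_ge0.
Qed.

(** Domination by |F| <= 1 + F^2, the weight itself being integrable. *)
Lemma integrable_of_sqr : m.-integrable setT (EFin \o (fun x => w x * F x)%R).
Proof.
apply: (@le_integrable _ _ _ _ _ _ _ (EFin \o (fun x => w x + w x * F x ^+ 2)%R)) => //.
- by apply/measurable_EFinP; exact: measurable_funM.
- move=> x _ /=; rewrite lee_fin normrM ger0_norm//.
  rewrite [leRHS]ger0_norm; last by rewrite addr_ge0// mulr_ge0// sqr_ge0.
  rewrite -[X in (_ <= X + _)%R]mulr1 -mulrDr ler_wpM2l//.
  rewrite -(real_normK (num_real (F x))).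
  have := sqr_ge0 (`|F x| - 1)%R; have := normr_ge0 (F x); move: (`|F x|)%R => t; nra.
- have := integrableD measurableT iw iwF2; exact: eq_integrable.
Qed.

Lemma wint_centered (c : R) : \int[m]_x (w x * F x)%:E = 0 ->
  wint m w (fun y => sqd c (F y)) = (c ^+ 2)%:E + wint m w (fun x => (F x ^+ 2)%:E).
Proof.
move=> wF0.
rewrite /wint.
transitivity (\int[m]_x (((c ^+ 2)%:E * (w x)%:E + (- 2 * c)%:E * (w x * F x)%:E) + (w x * F x ^+ 2)%:E)).
  by apply: eq_integral => x _; rewrite sqdE -!EFinM -!EFinD; congr (_%:E); ring.
have i1 := integrableZl measurableT (c ^+ 2)%R iw.
have i2 := integrableZl measurableT (- 2 * c)%R integrable_of_sqr.
have i12 := integrableD measurableT i1 i2.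
rewrite (integralD measurableT i12 iwF2) (integralD measurableT i1 i2).
rewrite (integralZl measurableT iw) (integralZl measurableT integrable_of_sqr).
by rewrite w1 wF0 mule0 adde0 mule1; congr (_ + _); apply: eq_integral => x _; rewrite EFinM.
Qed.

End centered.
End sphere_tools.
Section sphere_poincare.
Local Open Scope ereal_scope.
Context {R : realType} {n : nat}.
Hypothesis n2 : (2 <= n)%N.
Notation V := 'rV[R]_n.
Notation mu := (@lebesgue_rV R n).
Notation ball1 := (@punctured_ball R n).
Notation dl i := (delta_mx ord0 i : V).
Notation leb := (@lebesgue_measure R).
Notation EE := (wint mu (@gdens R n)).

Let n0 : (0 < n)%N. Proof. exact: ltnW. Qed.
Let mB : measurable ball1. Proof. exact: measurable_punctured_ball. Qed.
Let mw : measurable_fun setT (@gdens R n). Proof. exact: measurable_gdens. Qed.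
Let w0 (x : V) : (0 <= gdens x)%R. Proof. exact: gdens_ge0. Qed.

Variables (f : V -> R) (r m : R).
Hypotheses (Af : An 1 f) (r0 : (0 < r)%R).

Let k (y : V) : R := (f (r *: y) - m)%R.
Let F (x : V) : R := (enorm x * k (normalize x))%R.

Let mcomp (g : V -> R) : An 0 g -> measurable_fun setT (fun y : V => g (r *: y)).
Proof.
move=> Ag; apply: (@measurableT_comp _ _ _ _ _ _ g); last exact: measurable_scale_rV.
by apply: continuous_measurable_rV; exact: An_cont.
Qed.

Let mk : measurable_fun setT k.
Proof. by apply: measurable_funB => //; apply: mcomp; exact: An_le Af. Qed.

Let mF : measurable_fun setT F.
Proof.
apply: measurable_funM; first exact: measurable_enorm.
exact: measurableT_comp mk (@measurable_normalize R n).
Qed.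

Lemma measurable_spgrad i : measurable_fun setT (spgrad f r m i).
Proof.
have mn j : measurable_fun setT (fun x : V => normalize x ord0 j).
  exact: measurableT_comp (@measurable_rV_coord R n j) (@measurable_normalize R n).
have mp j : measurable_fun setT (fun x : V => pd j f (r *: normalize x)).
  by apply: (measurableT_comp (mcomp (An_pd j Af)) (@measurable_normalize R n)).
apply: measurable_funD; apply: measurable_funM => //.
  exact: measurableT_comp mk (@measurable_normalize R n).
apply: measurable_funB => //; apply: measurable_funM => //.
by apply: measurable_sum => j; exact: measurable_funM.
Qed.

(** The i-th coordinate axis. A line parallel to it either coincides with it or avoids the origin,
    so the singularity of the cone function [F] is met on this line only. *)
Let onaxis i : set V := [set x | forall j, j != i -> x ord0 j = 0%R].

Let maxis i : measurable (onaxis i).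
Proof.
rewrite (_ : onaxis i = [set x | forall j, (if j == i then setT else [set 0%R]) (x ord0 j)]).
  apply: (@measurable_rV_box R n (fun j => if j == i then setT else [set 0%R])) => j.
  by case: ifP.
by apply/seteqP; split => x /= h j; have := h j; case: eqVneq => //= _; apply.
Qed.

(** The value +oo on the axis makes the increment bound trivial there; elsewhere it is the squared
    derivative of [F]. *)
Let G i (x : V) : \bar R := if x \in onaxis i then +oo else (spgrad f r m i x ^+ 2)%:E.

Let mG i : measurable_fun setT (G i).
Proof.
apply: measurable_fun_ifT => //.
  by apply: (measurable_fun_bool true); rewrite setTI preimage_mem_true.
by apply/measurable_EFinP; apply: measurable_funX; exact: measurable_spgrad.
Qed.

Let G0 i x : 0 <= G i x.
Proof. by rewrite /G; case: ifP => // _; rewrite lee_fin sqr_ge0. Qed.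

Let onaxis_line i (x : V) (t : R) : (x + t *: dl i \in onaxis i)%R = (x \in onaxis i).
Proof.
have E (z : V) (s : R) : onaxis i z -> onaxis i (z + s *: dl i)%R.
  by move=> h j ji; rewrite !mxE h// (negbTE ji) andbF mulr0 addr0.
apply/idP/idP => /set_mem h; apply/mem_set; last exact: E.
by have := E _ (- t)%R h; rewrite scaleNr addrK.
Qed.

Let G_line i (x : V) (a b : R) : (b < a)%R ->
  sqd (F (x + a *: dl i)%R) (F (x + b *: dl i)%R) <=
     (a - b)%:E * \int[leb]_(t in `]b, a]) G i (x + t *: dl i)%R.
Proof.
move=> ba; have ab0 : (0 < a - b)%R by rewrite subr_gt0.
have [Cf _] := Af.
case: (boolP (x \in onaxis i)) => xi.
  rewrite (eq_integral (cst +oo)) => [|t _]; last by rewrite /G onaxis_line xi.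
  rewrite integral_cst ?measurable_itv//= lebesgue_measure_itv/= lte_fin ba.
  by rewrite -EFinB gt0_mulye ?lte_fin// gt0_muley ?lte_fin// leey.
have x0 (t : R) : (x + t *: dl i)%R != 0%R.
  apply: contraNneq xi => xt; rewrite -(onaxis_line i x t) xt.
  by apply/mem_set => j _; rewrite mxE.
have -> : \int[leb]_(t in `]b, a]) G i (x + t *: dl i)%R =
    \int[leb]_(t in `]b, a]) (spgrad f r m i (x + t *: dl i)%R ^+ 2)%:E.
  by apply: eq_integral => t _; rewrite /G onaxis_line (negbTE xi).
apply: (@sqr_increment_le _ (fun t => F (x + t *: dl i)%R) (fun t => spgrad f r m i (x + t *: dl i)%R) a b ba).
  move=> t; apply: (@continuous_comp _ _ _ (fun t : R => x + t *: dl i)%R (spgrad f r m i)).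
    exact: continuous_line_rV.
  by have := @continuous_at_spgrad R n f r m i (x + t *: dl i)%R Cf r0 (x0 t).
move=> t; have h := is_derive_cone m i Cf r0 (x0 t).
have [h1 h2] := h.
by apply: is_derive_eq (is_derive_line h1) _; rewrite h2.
Qed.

(** As n >= 2, the axis lies in a hyperplane [x ord0 j = 0] with j different from i, hence is
    negligible. *)
Let EE_G i : EE (G i) = EE (fun x => (spgrad f r m i x ^+ 2)%:E).
Proof.
have [j ji] : exists j : 'I_n, j != i.
  case: (eqVneq i (Ordinal n0)) => [->|]; last by exists (Ordinal n0); rewrite eq_sym.
  by exists (Ordinal n2); apply/eqP => /(congr1 val).
have mS : measurable_fun setT (fun x => (spgrad f r m i x ^+ 2)%:E).
  by apply/measurable_EFinP; apply: measurable_funX; exact: measurable_spgrad.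
apply: ge0_ae_eq_integral => //.
- exact: measurable_weight.
- exact: measurable_weight.
- by move=> x _; rewrite mule_ge0// lee_fin.
- by move=> x _; rewrite mule_ge0// lee_fin ?sqr_ge0.
exists [set x : V | x ord0 j = 0%R]; split.
- rewrite (_ : [set _ | _] = (fun x : V => x ord0 j) @^-1` [set 0%R])//.
  by rewrite -[X in measurable X]setTI; apply: measurable_rV_coord => //; exact: measurable_set1.
- exact: lebesgue_rV_coord0.
- move=> x /=; apply: contra_notP => xj _; rewrite /G ifF//.
  by apply/negbTE/negP => /set_mem/(_ _ ji).
Qed.

Let A := \int[mu]_(y in ball1) (k (normalize y) ^+ 2)%:E.
Let S2 (x : V) := \sum_(i < n) (spgrad f r m i x ^+ 2)%:E.

Let mS2 : measurable_fun setT S2.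
Proof.
apply: emeasurable_sum => i; apply/measurable_EFinP; apply: measurable_funX.
exact: measurable_spgrad.
Qed.

Let S20 x : 0 <= S2 x.
Proof. by apply: sume_ge0 => i _; rewrite lee_fin sqr_ge0. Qed.

(** By 0-homogeneity of [spgrad], only the moment of order 0 occurs. *)
Let EE_sumG : \sum_(i < n) EE (G i) = @gmom R n 0 * \int[mu]_(y in ball1) S2 y.
Proof.
rewrite (eq_bigr (fun i => EE (fun x => (spgrad f r m i x ^+ 2)%:E))); last by move=> i _; exact: EE_G.
rewrite -(@wint_sum _ _ _ _ _ mw w0 _ (index_enum 'I_n)
   (fun i x => (spgrad f r m i x ^+ 2)%:E)); first last.
- by move=> i x; rewrite lee_fin sqr_ge0.
- move=> i; apply/measurable_EFinP; apply: measurable_funX; exact: measurable_spgrad.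
have sn (x : V) : S2 (normalize x) = S2 x.
  have [->|x0] := eqVneq x 0%R; first by rewrite /normalize scaler0.
  by apply: eq_bigr => i _; rewrite /normalize spgrad_homog// invr_gt0 enorm_gt0.
have := integral_gauss_polar 0 n0 mS2 S20.
rewrite (eq_integral _ _ (fun y _ => sn y)) => <-.
by apply: eq_wint => x; rewrite expr0 mul1e sn.
Qed.

Let M_ex : exists M : R, forall y, (`|k y| <= M)%R.
Proof.
have Af0 : An 0 f by exact: An_le Af.
have [M fM] := annular_continuous_bounded (An_cont Af0) Af.2.
exists (M + `|m|)%R => y; apply: (le_trans (ler_normB _ _)).
by rewrite lerD2r.
Qed.

Let Aoo : A < +oo.
Proof.
have [M kM] := M_ex.
have mk2 : measurable_fun setT (fun y => k (normalize y) ^+ 2)%R.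
  apply: measurable_funX; exact: measurableT_comp mk (@measurable_normalize R n).
have := @ball_bounded_integrable R n (M ^+ 2)%R _ mk2.
case/(_ _)/integrableP.
  by move=> x; rewrite normrX lerXn2r ?nnegrE// (le_trans _ (kM 0%R)).
move=> _; rewrite (eq_integral (fun y => (k (normalize y) ^+ 2)%:E))//.
by move=> y _ /=; rewrite ger0_norm ?sqr_ge0.
Qed.

Let A0 : 0 <= A.
Proof. by apply: integral_ge0 => y _; rewrite lee_fin sqr_ge0. Qed.

Let EEF2 : EE (fun x => (F x ^+ 2)%:E) = @gmom R n 2 * A.
Proof.
have mk2 : measurable_fun setT (fun y => (k y ^+ 2)%:E).
  by apply/measurable_EFinP; apply: measurable_funX.
rewrite /A -(integral_gauss_polar 2 n0 mk2); last by move=> x; rewrite lee_fin sqr_ge0.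
by apply: eq_wint => x; rewrite /F exprMn EFinM.
Qed.

Let g0E : @gmom R n 0 = ((@vball R n)^-1)%:E. Proof. exact: gmom0E. Qed.

Let c0 : (0 < (@vball R n)^-1)%R. Proof. by rewrite invr_gt0; exact: vball_gt0. Qed.

(** [F] has degree 1, so the second moment of |x| enters and supplies the factor n; the k^2 part of
    the gradient later takes 1 away from it. *)
Let EEF2E : EE (fun x => (F x ^+ 2)%:E) = (n%:R * (@vball R n)^-1)%:E * A.
Proof. by rewrite EEF2 gmom_recl// g0E EFinM. Qed.

Let EEF2oo : EE (fun x => (F x ^+ 2)%:E) < +oo.
Proof.
rewrite EEF2E lte_mul_pinfty// lee_fin mulr_ge0//; exact: ltW.
Qed.

Hypothesis km : (\int[mu]_(y in ball1) k (normalize y) = 0)%R.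

Let kpn : \int[mu]_(y in ball1) (Num.max (k (normalize y)) 0%R)%:E =
  \int[mu]_(y in ball1) (Num.max (- k (normalize y)) 0)%R%:E.
Proof.
have [M kM] := M_ex.
have mkn : measurable_fun setT (fun y => k (normalize y)).
  exact: measurableT_comp mk (@measurable_normalize R n).
have ik := @ball_bounded_integrable R n M _ mkn (fun y => kM _).
have [fp fn] := (integrable_pos_fin_num mB ik, integrable_neg_fin_num mB ik).
have fi := integrable_fin_num mB ik.
have : \int[mu]_(y in ball1) (EFin \o (fun y => k (normalize y))) y = 0.
  by rewrite -[LHS]fineK// -[fine _]/(\int[mu]_(y in ball1) k (normalize y))%R km.
rewrite integralE => /eqP; rewrite sube_eq ?add0e//.
move=> /eqP h.
rewrite (eq_integral (fun y => (EFin \o (fun y => k (normalize y)))^\+ y)); last first.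
  by move=> y _; rewrite funeposE/= EFin_max.
rewrite h; apply: eq_integral => y _.
by rewrite funenegE/= EFin_max.
Qed.

(** The polar formula is for nonnegative functions, so the positive and negative parts are compared:
    those of [k] have equal integrals by [kpn], and the moment of order 1 is a common factor. *)
Let F_centered : \int[mu]_x (gdens x * F x)%:E = 0.
Proof.
have iF := integrable_of_sqr mw w0 (@integral_gdens R n) mF EEF2oo.
have fp := integrable_pos_fin_num measurableT iF.
have mkp (s : R) : measurable_fun setT (fun y => (Num.max (s * k y) 0%R)%:E).
  by apply/measurable_EFinP; apply: measurable_maxr => //; exact: measurable_funM.
have kp0 (s : R) y : 0 <= (Num.max (s * k y) 0%R)%:E by rewrite lee_fin le_max lexx orbT.
have E (s : R) : \int[mu]_x (Num.max (s * (gdens x * F x)) 0%R)%:E =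
    @gmom R n 1 * \int[mu]_(y in ball1) (Num.max (s * k (normalize y)) 0%R)%:E.
  rewrite -(integral_gauss_polar 1 n0 (mkp s) (kp0 s)); apply: eq_integral => x _.
  rewrite -!EFinM; congr (_%:E); rewrite expr1 maxr_pMr ?enorm_ge0// mulr0 maxr_pMr// mulr0.
  by congr (Num.max _ _); rewrite /F; ring.
have Ep : \int[mu]_x (EFin \o (fun x => gdens x * F x)%R)^\+ x =
    \int[mu]_x (Num.max (1 * (gdens x * F x)) 0%R)%:E.
  by apply: eq_integral => x _; rewrite funeposE/= EFin_max mul1r.
have En : \int[mu]_x (EFin \o (fun x => gdens x * F x)%R)^\- x =
    \int[mu]_x (Num.max (-1 * (gdens x * F x)) 0%R)%:E.
  by apply: eq_integral => x _; rewrite funenegE/= EFin_max mulN1r.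
have eqpn : \int[mu]_x (EFin \o (fun x => gdens x * F x)%R)^\+ x =
     \int[mu]_x (EFin \o (fun x => gdens x * F x)%R)^\- x.
  rewrite Ep En !E; congr (_ * _).
  rewrite (eq_integral (fun y => (Num.max (k (normalize y)) 0%R)%:E)); last first.
    by move=> y _; rewrite mul1r.
  rewrite kpn; apply: eq_integral => y _.
  by rewrite mulN1r.
by rewrite integralE -eqpn subee.
Qed.

(** The Gaussian inequality for [F], after cancelling 2 and the inverse volume of the ball. By
    [spgrad_sqr] the sum on the right contains (f - m)^2 besides the tangential gradient. *)
Lemma sphere_poincare_spgrad :
  n%:R%:E * \int[mu]_(y in ball1) ((f (r *: normalize y) - m) ^+ 2)%:E <=
  \int[mu]_(y in ball1) \sum_(i < n) (spgrad f r m i y ^+ 2)%:E.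
Proof.
have := gauss_poincare mF mG G0 G_line.
rewrite EE_sumG g0E.
have -> : EE (fun x => EE (fun y => sqd (F x) (F y))) =
    2%:E * EE (fun x => (F x ^+ 2)%:E).
  rewrite (@eq_wint _ _ _ mu (@gdens R n) _ (fun x => (F x ^+ 2)%:E + EE (fun y => (F y ^+ 2)%:E))); last first.
    by move=> x; rewrite (wint_centered mw w0 (@integral_gdens R n) mF EEF2oo _ F_centered).
  have mF2 : measurable_fun setT (fun x => (F x ^+ 2)%:E).
    by apply/measurable_EFinP; exact: measurable_funX.
  have F20 x : 0 <= (F x ^+ 2)%:E by rewrite lee_fin sqr_ge0.
  have EF0 : 0 <= EE (fun y => (F y ^+ 2)%:E) by exact: wint_ge0.
  rewrite wintD// wint_cst//; last exact: integral_gdens.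
  by rewrite (_ : 2%:E = 1 + 1)// ge0_muleDl// mul1e.
rewrite EEF2E -/A.
rewrite (_ : (n%:R * (@vball R n)^-1)%:E * A = ((@vball R n)^-1)%:E * (n%:R%:E * A)); last first.
  by rewrite muleA -EFinM mulrC.
rewrite lee_pmul2l// lee_pmul2l//.
Qed.

End sphere_poincare.
(** * The radial projection *)

Section measurable_annular.
Context {R : realType} {n : nat}.
Notation V := 'rV[R]_n.
Notation mu := (@lebesgue_rV R n).
Notation ball1 := (@punctured_ball R n).
Notation w := (@w R n).
Implicit Types f g h : V -> R.

(** A class weaker than [An 0] to which [rproj f] is shown to belong; it is closed under the
    operations below and still makes every integral finite. *)
Definition MB g := [/\ measurable_fun setT g, exists M, forall x, `|g x| <= M & annular g].

Lemma MB_An g : An 0 g -> MB g.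
Proof.
move=> Ag; have cg := An_cont Ag; split; last by case: Ag.
  exact: continuous_measurable_rV.
by have [M gM] := annular_continuous_bounded cg Ag.2; exists M.
Qed.

Lemma MB_mul g h : MB g -> MB h -> MB (fun x => g x * h x).
Proof.
move=> [mg [M gM] ag] [mh [N hN] ah]; split; first exact: measurable_funM.
  by exists (M * N) => x; rewrite normrM ler_pM.
exact: annular_mulr.
Qed.

Lemma MB_scale c g : MB g -> MB (fun x => c * g x).
Proof.
move=> [mg [M gM] ag]; split; first exact: measurable_funM.
  by exists (`|c| * M) => x; rewrite normrM ler_wpM2l.
exact: annular_mull.
Qed.

Lemma MB_add g h : MB g -> MB h -> MB (fun x => g x + h x).
Proof.
move=> [mg [M gM] ag] [mh [N hN] ah]; split; first exact: measurable_funD.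
  by exists (M + N) => x; rewrite (le_trans (ler_normD _ _))// lerD.
exact: annular_add.
Qed.

Lemma MB_sub g h : MB g -> MB h -> MB (fun x => g x - h x).
Proof.
move=> Mg /(MB_scale (-1)) /(MB_add Mg); congr MB.
by apply/funext => x; rewrite mulN1r.
Qed.

Lemma MB_integrable g : MB g -> mu.-integrable setT (EFin \o g).
Proof.
move=> [mg [M gM] [[a b] /= [a0 gab]]]; apply: (@bounded_support_integrable R n M b) => // x i.
by move=> /gab/andP[_]; apply: le_trans; exact: ler_enorm_coord.
Qed.

Lemma w_enorm (x : V) : w x = (enorm x ^+ 4)^-1.
Proof. by rewrite wE qE nsqE -invfM -exprD. Qed.

Lemma w_ge0 (x : V) : 0 <= w x.
Proof. by rewrite w_enorm invr_ge0 exprn_ge0// enorm_ge0. Qed.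

Lemma measurable_w : measurable_fun setT w.
Proof.
rewrite (_ : w = (fun x => (enorm x ^+ 4)^-1)); last by apply/funext => x; exact: w_enorm.
apply: measurableT_comp (@measurable_invr R) _.
by apply: measurable_funX; exact: measurable_enorm.
Qed.

Lemma MB_w g : MB g -> MB (fun x => w x * g x).
Proof.
move=> [mg [M gM] ag]; split; last exact: annular_mull.
  by apply: measurable_funM => //; exact: measurable_w.
have [[a b] /= [a0 gab]] := ag; exists ((a ^+ 4)^-1 * M) => x.
rewrite normrM (ger0_norm (w_ge0 x)).
have [->|/gab/andP[ax _]] := eqVneq (g x) 0.
  by rewrite normr0 mulr0 mulr_ge0 ?invr_ge0 ?exprn_ge0 ?(ltW a0)// (le_trans _ (gM x)).
apply: ler_pM => //; first exact: w_ge0.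
rewrite w_enorm lef_pV2 ?posrE ?exprn_gt0//; last exact: lt_le_trans ax.
by rewrite lerXn2r ?nnegrE ?(ltW a0)// enorm_ge0.
Qed.

Lemma MB_I_add g h : MB g -> MB h -> I (fun x => g x + h x) = I g + I h.
Proof. by move=> Mg Mh; rewrite /I RintegralD//; exact: MB_integrable. Qed.

Lemma MB_I_scale c g : MB g -> I (fun x => c * g x) = c * I g.
Proof. by move=> Mg; rewrite /I RintegralZl//; exact: MB_integrable. Qed.

Lemma MB_I_sub g h : MB g -> MB h -> I (fun x => g x - h x) = I g - I h.
Proof. by move=> Mg Mh; rewrite /I RintegralB//; exact: MB_integrable. Qed.

Lemma MB_EFin_I g : MB g -> (\int[mu]_x (g x)%:E = (I g)%:E)%E.
Proof.
move=> Mg; rewrite /I /Rintegral fineK//.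
exact: integrable_fin_num (MB_integrable Mg).
Qed.

End measurable_annular.

(** * Measurability and bounds of the radial projection *)

Section rproj_theory.
Local Open Scope ereal_scope.
Context {R : realType} {n : nat}.
Hypothesis n0 : (0 < n)%N.
Notation V := 'rV[R]_n.
Notation mu := (@lebesgue_rV R n).
Notation ball1 := (@punctured_ball R n).
Notation w := (@w R n).
Notation vb := (@vball R n).
Variable f : V -> R.
Hypothesis Af : An 0 f.

Let mB : measurable ball1. Proof. exact: measurable_punctured_ball. Qed.
Let mf : measurable_fun setT f.
Proof. by apply: continuous_measurable_rV; exact: An_cont. Qed.

(** The indicator turns the average over the ball into an integral over the whole space, ready for
    Fubini's theorem. *)
Definition kernel (x y : V) : R := (f (enorm x *: normalize y) * \1_ball1 y)%R.

Let vb0 : (0 < vb)%R. Proof. exact: vball_gt0. Qed.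

Lemma measurable_kernel : measurable_fun setT (fun p : V * V => kernel p.1 p.2).
Proof.
apply: measurable_funM.
  apply: (measurableT_comp mf); apply: measurable_fun_rVP => i.
  under eq_fun do rewrite mxE.
  apply: measurable_funM.
    exact: measurableT_comp (@measurable_enorm R n) measurable_fst.
  apply: measurableT_comp (@measurable_rV_coord R n i) _.
  exact: measurableT_comp (@measurable_normalize R n) measurable_snd.
by apply: measurableT_comp measurable_snd; exact: measurable_indic.
Qed.

Lemma kernel_bound : exists2 M : R, (0 <= M)%R & forall x y, (`|kernel x y| <= M * \1_ball1 y)%R.
Proof.
have [M fM] := annular_continuous_bounded (An_cont Af) Af.2.
exists M; first by rewrite (le_trans _ (fM 0%R)).
by move=> x y; rewrite normrM [X in (_ * X)%R]ger0_norm// ler_wpM2r.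
Qed.

Let int_ind : \int[mu]_y (\1_ball1 y)%:E = vb%:E.
Proof. by rewrite integral_indic// setIT; exact: vballE. Qed.

Lemma integrable_kernel_slice x : mu.-integrable setT (EFin \o kernel x).
Proof.
have [M M0 kM] := kernel_bound.
apply: (@le_integrable _ _ _ _ _ _ _ (fun y => M%:E * (\1_ball1 y)%:E)) => //.
- apply/measurable_EFinP.
  exact: (measurableT_comp measurable_kernel (measurable_pair1 x)).
- move=> y _ /=; rewrite lee_fin [leRHS]ger0_norm; last by rewrite mulr_ge0.
  exact: kM.
- apply: integrableZl => //; apply/integrableP; split.
    by apply/measurable_EFinP; exact: measurable_indic.
  under eq_integral do rewrite gee0_abs ?lee_fin//.
  by rewrite int_ind ltry.
Qed.

Lemma integral_kernel x : \int[mu]_y (kernel x y)%:E = (vb * rproj f x)%:E.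
Proof.
rewrite /rproj mulrA divff ?gt_eqF// mul1r -[LHS]fineK.
  congr (_%:E); rewrite [RHS]Rintegral_mkcond; congr fine; apply: eq_integral => y _ /=.
  rewrite patchE /kernel indicE; case: (_ \in _); first by rewrite mulr1.
  by rewrite mulr0.
exact: integrable_fin_num (integrable_kernel_slice x).
Qed.

Lemma rproj_annular : annular (rproj f).
Proof.
have [_ [[a b] /= [a0 fab]]] := Af; exists (a, b); split => // x /=.
apply: contraNT => xab; rewrite /rproj mulf_eq0; apply/orP; right.
have -> : (\int[mu]_(y in ball1) f (enorm x *: normalize y) = \int[mu]_(y in ball1) 0)%R.
  apply: eq_Rintegral => y /set_mem yB; apply/eqP; apply: contraNT xab => /fab.
  by rewrite enormZ ?enorm_ge0// enorm_normalize ?mulr1//; exact: ball_normalize_neq0 yB.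
by rewrite /Rintegral integral0.
Qed.

Lemma rproj_bounded : exists M, forall x, (`|rproj f x| <= M)%R.
Proof.
have [M fM] := annular_continuous_bounded (An_cont Af) Af.2.
exists M => x.
have ik : mu.-integrable ball1 (EFin \o (fun y => f (enorm x *: normalize y))).
  apply: (@ball_bounded_integrable R n M) => [|y]; last exact: fM.
  apply: (measurableT_comp mf); apply: (measurableT_comp (measurable_scale_rV _)).
  exact: measurable_normalize.
rewrite /rproj normrM ger0_norm ?invr_ge0 ?(ltW vb0)// ler_pdivrMl//.
apply: (le_trans (le_normr_Rintegral mB ik)).
rewrite mulrC -(Rintegral_cst mu mB); apply: le_Rintegral => //.
- exact: integrable_norm.
- by apply: (@ball_bounded_integrable R n `|M|) => // y; exact: measurable_cst.
Qed.

Lemma integrable_kernel (g : V -> R) : MB g ->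
  (mu \x mu).-integrable setT (fun p : V * V => (g p.1 * kernel p.1 p.2)%:E).
Proof.
move=> Mg; have [mg _ _] := Mg.
have mh : measurable_fun setT (fun p : V * V => (g p.1 * kernel p.1 p.2)%:E).
  apply/measurable_EFinP; apply: measurable_funM; last exact: measurable_kernel.
  exact: measurableT_comp mg measurable_fst.
apply/(integrable12ltyP _ _ mh).
have [M M0 kM] := kernel_bound.
have /integrableP[_ goo] := integrableZl measurableT (M * vb)%R (MB_integrable Mg).
apply: le_lt_trans goo; apply: ge0_le_integral => //.
- by move=> x _; exact: integral_ge0.
- apply: (@measurable_fun_fubini_tonelli_F _ _ _ _ _ mu (fun p => `|(g p.1 * kernel p.1 p.2)%:E|)).
  + exact: measurableT_comp.
  + by [].
- apply: measurableT_comp => //.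
  by apply: emeasurable_funM => //; exact/measurable_EFinP.
- move=> x _; apply: (@le_trans _ _ (\int[mu]_y ((`|g x| * M)%:E * (\1_ball1 y)%:E))).
    apply: ge0_le_integral => //.
    + apply: (measurableT_comp (f := fun p : V * V => `|(g p.1 * kernel p.1 p.2)%:E|) _ (measurable_pair1 x)).
      exact: measurableT_comp.
    + apply: emeasurable_funM => //; apply/measurable_EFinP; exact: measurable_indic.
    + by move=> y _; rewrite -EFinM lee_fin normrM -mulrA ler_wpM2l.
  rewrite ge0_integralZl//; first last.
  + by rewrite lee_fin mulr_ge0.
  + by apply/measurable_EFinP; exact: measurable_indic.
  rewrite int_ind -EFinM lee_fin /= !normrM (ger0_norm M0) (ger0_norm (ltW vb0)).
  by rewrite [leRHS]mulrC mulrA.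
Qed.

Lemma MB_rproj : MB (rproj f).
Proof.
split; [|exact: rproj_bounded|exact: rproj_annular].
have [[a b] /= [a0 rab]] := rproj_annular.
(* The shell outside which [rproj f] vanishes. Multiplying by its indicator changes nothing and
   provides the factor in [MB] for [integrable_kernel]; Fubini's theorem then yields
   measurability. *)
pose A : set V := [set x | a <= enorm x <= b]%R.
have mA : measurable A.
  rewrite (_ : A = @enorm R n @^-1` `[a, b]).
    by rewrite -[X in measurable X]setTI; exact: measurable_enorm.
  by apply/seteqP; split => x /=; rewrite in_itv.
have MA : MB (\1_A : V -> R).
  split; first exact: measurable_indic.
    by exists 1%R => x; rewrite indicE; case: (_ \in _); rewrite ?normr1 ?normr0.
  exists (a, b); split => // x; rewrite indicE.
  by case: (boolP (x \in A)) => [/set_mem//|_]; rewrite eqxx.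
have := measurable_fubini_F (integrable_kernel MA).
rewrite (_ : fubini_F _ _ = fun x => (vb * rproj f x)%:E); last first.
  apply/funext => x; rewrite /fubini_F /=.
  under eq_integral do rewrite EFinM.
  rewrite (integralZl measurableT (integrable_kernel_slice x)) integral_kernel -EFinM.
  congr (_%:E); rewrite indicE; case: (boolP (x \in A)) => xA; first by rewrite mul1r.
  rewrite mul0r; apply/esym/eqP; rewrite mulf_eq0; apply/orP; right.
  by apply: contraNT xA => /rab xab; exact/mem_set.
move=> /measurable_EFinP m1.
rewrite (_ : rproj f = (fun x => vb^-1 * (vb * rproj f x))%R).
  exact: measurable_funM.
by apply/funext => x; rewrite mulKf// gt_eqF.
Qed.

End rproj_theory.

Section rproj_orthogonal.
Local Open Scope ereal_scope.
Context {R : realType} {n : nat}.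
Hypothesis n0 : (0 < n)%N.
Notation V := 'rV[R]_n.
Notation mu := (@lebesgue_rV R n).
Notation ball1 := (@punctured_ball R n).
Notation w := (@w R n).
Notation vb := (@vball R n).

Lemma An0_radial (f : V -> R) y : An 0 f -> enorm y = 1%R ->
  An 0 (fun z : V => f (enorm z *: y)%R).
Proof.
move=> Af y1; split; last exact: annular_radial Af.2 y1.
split=> [x x0|//].
have Y0 : (enorm x *: y)%R != 0%R.
  by rewrite -enorm_gt0 enormZ ?enorm_ge0// y1 mulr1 enorm_gt0.
apply: (@continuous_comp _ _ _ (fun z : V => enorm z *: y)%R f).
  by apply: continuousZr_tmp; exact: enorm_continuous.
exact (Ck_cont Af.1 Y0).
Qed.

(** [rproj f] is an average over directions of the radial functions of [B_radial_Lam], each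
    orthogonal to Lam f, and Fubini's theorem exchanges the average with [B]. No derivative of
    [rproj f] is taken. *)
Lemma rproj_Lam (f : V -> R) : An 2 f -> B (rproj f) (Lam f) = 0%R.
Proof.
move=> Af; have Af0 : An 0 f by exact: An_le Af.
have AL : An 0 (Lam f) by exact: An_Lam.
have Mg : MB (fun x => w x * Lam f x)%R by apply: MB_w; exact: MB_An.
have Mr := MB_rproj n0 Af0.
have vb0 : (0 < vb)%R by exact: vball_gt0.
have E := Fubini (integrable_kernel n0 Af0 Mg).
have : \int[mu]_x (vb * (w x * Lam f x * rproj f x))%:E = 0.
  transitivity (\int[mu]_x \int[mu]_y (w x * Lam f x * kernel f x y)%:E).
    apply: eq_integral => x _.
    under [RHS]eq_integral do rewrite EFinM.
    rewrite (integralZl measurableT (integrable_kernel_slice Af0 x)).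
    by rewrite (integral_kernel n0 Af0) -EFinM; congr (_%:E); ring.
  rewrite E; apply: integral0_eq => y _ /=.
  rewrite /kernel indicE; case: (boolP (y \in ball1)) => [/set_mem yB|_]; last first.
    by apply: integral0_eq => x _; rewrite !mulr0.
  have y1 : enorm (normalize y) = 1%R by apply: enorm_normalize; exact: (ball_normalize_neq0 yB).
  have := B_radial_Lam Af y1; rewrite /B => BL.
  transitivity (\int[mu]_x (w x * (f (enorm x *: normalize y) * Lam f x))%:E).
    by apply: eq_integral => x _; congr (_%:E); rewrite mulr1; ring.
  have MR : MB (fun x => w x * (f (enorm x *: normalize y) * Lam f x))%R.
    apply: MB_w; apply: MB_mul; last exact (MB_An AL).
    exact (MB_An (An0_radial Af0 y1)).
  by have := MB_EFin_I MR; rewrite BL.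
have MM : MB (fun x => w x * Lam f x * rproj f x)%R by exact: MB_mul.
rewrite (MB_EFin_I (MB_scale vb MM)) (MB_I_scale _ MM).
have -> : (fun x => w x * Lam f x * rproj f x)%R = (fun x => w x * (rproj f x * Lam f x))%R.
  by apply/funext => x; ring.
rewrite -/(B (rproj f) (Lam f)); move: (B _ _) => b [/eqP].
by clear -vb0; rewrite mulf_eq0 (gt_eqF vb0) => /eqP.
Qed.

End rproj_orthogonal.

(** * The spherical inequality integrated over all radii *)

Section global_poincare.
Local Open Scope ereal_scope.
Context {R : realType} {n : nat}.
Hypothesis n2 : (2 <= n)%N.
Notation V := 'rV[R]_n.
Notation mu := (@lebesgue_rV R n).
Notation ball1 := (@punctured_ball R n).
Notation w := (@w R n).
Notation q := (@q R n).
Notation vb := (@vball R n).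
Notation leb := (@lebesgue_measure R).

Let n0 : (0 < n)%N. Proof. exact: ltnW. Qed.
Let mB : measurable ball1. Proof. exact: measurable_punctured_ball. Qed.

Variable f : V -> R.
Hypothesis Af : An 2 f.

Let Af0 : An 0 f. Proof. exact: An_le Af. Qed.
Let Af1 : An 1 f. Proof. exact: An_le Af. Qed.
Let mf : measurable_fun setT f.
Proof. by apply: continuous_measurable_rV; exact: An_cont. Qed.

Let u (x : V) : R := (f x - rproj f x)%R.

Lemma MB_compl : MB u.
Proof. by apply: MB_sub; [exact: MB_An|exact: MB_rproj]. Qed.

(** For r > 0, the value of [rproj f] on the sphere of radius [r]: this is the constant to subtract
    there. *)
Let avg (r : R) : R := (vb^-1 * \int[mu]_(y in ball1) f (r *: normalize y)%R)%R.

Let P (x : V) : R := (w x * (u x * u x))%R.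
Let Q (x : V) : R := (q x * dotg f f x - w x * (Eu f x * Eu f x))%R.

Let MP : MB P. Proof. by apply: MB_w; apply: MB_mul; exact: MB_compl. Qed.
Let MQ : MB Q. Proof. by apply: MB_An; exact: An_T Af1 Af1.1. Qed.

Let P_shell (r : R) (y : V) : (0 < r)%R -> ball1 y ->
  P (r *: normalize y)%R = ((r ^+ 4)^-1 * (f (r *: normalize y) - avg r) ^+ 2)%R.
Proof.
move=> r0 yB; have y0 := ball_normalize_neq0 yB.
rewrite /P w_enorm /u /rproj enormZ ?(ltW r0)// enorm_normalize// mulr1.
by rewrite -expr2.
Qed.

(** By [spgrad_sqr], removing the radial part leaves r^2 times the squared tangential gradient, and
    r^-4 is the weight. *)
Let Q_shell (r : R) (y : V) : (0 < r)%R -> ball1 y ->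
  Q (r *: normalize y)%R =
  ((r ^+ 4)^-1 * (\sum_(i < n) spgrad f r (avg r) i y ^+ 2 - (f (r *: normalize y) - avg r) ^+ 2))%R.
Proof.
move=> r0 yB; have y0 := ball_normalize_neq0 yB.
rewrite (spgrad_sqr f r (avg r) y0) addrC addKr.
have -> : Q (r *: normalize y)%R = ((r ^+ 2)^-1 * dotg f f (r *: normalize y)
   - (r ^+ 4)^-1 * (r * radgrad f r y * (r * radgrad f r y)))%R.
  have En : enorm (r *: normalize y)%R = r by rewrite enormZ ?(ltW r0)// enorm_normalize// mulr1.
  have Ee : Eu f (r *: normalize y)%R = (r * radgrad f r y)%R.
    by rewrite /Eu /radgrad mulr_sumr; apply: eq_bigr => i _; rewrite mxE mulrA.
  by rewrite /Q w_enorm Ee En qE nsqE En.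
move: (dotg _ _ _) (radgrad _ _ _) => d g; field.
by rewrite gt_eqF.
Qed.

Let mscale1 (g : V -> R) (r : R) : measurable_fun setT g ->
  measurable_fun setT (fun y : V => g (r *: normalize y)%R).
Proof.
move=> mg; apply: (measurableT_comp mg); apply: (measurableT_comp (measurable_scale_rV _)).
exact: measurable_normalize.
Qed.

Let avg_centered (r : R) :
  (\int[mu]_(y in ball1) (f (r *: normalize y) - avg r) = 0)%R.
Proof.
have [M fM] := annular_continuous_bounded (An_cont Af0) Af0.2.
have ik := @ball_bounded_integrable R n M _ (mscale1 r mf) (fun y => fM _).
rewrite RintegralB//; last first.
  by apply: (@ball_bounded_integrable R n `|avg r|%R) => // y; exact: measurable_cst.
rewrite Rintegral_cst// /avg -/vb mulrC mulrA divff ?mul1r ?subrr// gt_eqF//.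
exact: vball_gt0.
Qed.

(** The spherical inequality reads n a <= a + d, where [a] is the integral of [k2] and [d] that of
    [D]. As [f] is bounded, [a] is finite and can be subtracted, which leaves n - 1. *)
Let shell_le (r : R) : (0 < r)%R ->
  (n%:R - 1)%:E * \int[mu]_(y in ball1) (P (r *: normalize y)%R)%:E <=
  \int[mu]_(y in ball1) (Q (r *: normalize y)%R)%:E.
Proof.
move=> r0; pose c := ((r ^+ 4)^-1)%R.
have c0 : (0 < c)%R by rewrite invr_gt0 exprn_gt0.
pose k2 (y : V) := ((f (r *: normalize y) - avg r) ^+ 2)%R.
pose D (y : V) := (c^-1 * Q (r *: normalize y))%R.
have [mP _ _] := MP; have [mQ _ _] := MQ.
have mk2 : measurable_fun setT k2.
  by apply: measurable_funX; apply: measurable_funB => //; exact: mscale1.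
have mD : measurable_fun setT D by apply: measurable_funM => //; exact: mscale1.
have D0 y : (0 <= D y)%R.
  apply: mulr_ge0; first by rewrite invr_ge0 ltW.
  exact: (T_density_ge0 f (r *: normalize y)%R).
have k20 y : (0 <= k2 y)%R by rewrite sqr_ge0.
have S := sphere_poincare_spgrad n2 Af1 r0 (avg_centered r).
have ck2 : measurable_fun ball1 (fun y => (k2 y)%:E).
  by apply: measurable_funTS; exact/measurable_EFinP.
have cD : measurable_fun ball1 (fun y => (D y)%:E).
  by apply: measurable_funTS; exact/measurable_EFinP.
have k2E (y : V) : ball1 y -> 0 <= (k2 y)%:E by move=> _; rewrite lee_fin.
have DE (y : V) : ball1 y -> 0 <= (D y)%:E by move=> _; rewrite lee_fin.
have cE : 0 <= c%:E by rewrite lee_fin ltW.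
have -> : \int[mu]_(y in ball1) (P (r *: normalize y)%R)%:E = c%:E * \int[mu]_(y in ball1) (k2 y)%:E.
  rewrite -(ge0_integralZl mu mB ck2 k2E cE).
  by apply: eq_integral => y /set_mem yB; rewrite P_shell.
have -> : \int[mu]_(y in ball1) (Q (r *: normalize y)%R)%:E = c%:E * \int[mu]_(y in ball1) (D y)%:E.
  rewrite -(ge0_integralZl mu mB cD DE cE).
  by apply: eq_integral => y _; rewrite -EFinM /D mulrA divff ?mul1r// gt_eqF.
rewrite muleCA lee_pmul2l//.
have Sk : \int[mu]_(y in ball1) \sum_(i < n) (spgrad f r (avg r) i y ^+ 2)%:E =
   \int[mu]_(y in ball1) (k2 y)%:E + \int[mu]_(y in ball1) (D y)%:E.
  rewrite -(ge0_integralD mu mB k2E ck2 DE cD).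
  apply: eq_integral => y /set_mem yB; rewrite -EFinD sumEFin; congr (_%:E).
  by rewrite /D Q_shell// -/c mulKf ?gt_eqF// addrC subrK.
have kf : \int[mu]_(y in ball1) (k2 y)%:E \is a fin_num.
  have [M fM] := annular_continuous_bounded (An_cont Af0) Af0.2.
  apply: integrable_fin_num => //; apply: (@ball_bounded_integrable R n ((M + `|avg r|) ^+ 2)) => // y.
  rewrite /k2 normrX lerXn2r ?nnegrE ?addr_ge0//.
    by rewrite (le_trans _ (fM 0%R)).
  by rewrite (le_trans (ler_normB _ _))// lerD2r.
move: S; rewrite Sk -/(k2 _) -[X in X%:E * _](subrK 1%R) EFinD ge0_muleDl ?lee_fin//; last first.
  by rewrite subr_ge0 ler1n.
by rewrite mul1e => h; rewrite -(leeD2rE _ _ kf) [leRHS]addeC; exact: h.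
Qed.

(** [shell_le] integrated over the radii. The right-hand side involves [f] instead of [u]: both have
    the same tangential gradient, the projection being constant on spheres. *)
Lemma rproj_poincare : ((n%:R - 1) * B u u <= T f f)%R.
Proof.
have [mP _ _] := MP; have [mQ _ _] := MQ.
have P0 x : (0 <= P x)%R by rewrite mulr_ge0 ?w_ge0// -expr2 sqr_ge0.
have Q0 x : (0 <= Q x)%R by exact: T_density_ge0.
have n1 : (0 <= n%:R - 1 :> R)%R by rewrite subr_ge0 ler1n.
rewrite -lee_fin EFinM -(MB_EFin_I MP) -(MB_EFin_I MQ).
have mPE : measurable_fun setT (EFin \o P) by exact/measurable_EFinP.
have mQE : measurable_fun setT (EFin \o Q) by exact/measurable_EFinP.
rewrite (integral_polar (F := EFin \o P) n0)// (integral_polar (F := EFin \o Q) n0)//.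
have pol (g : V -> R) : measurable_fun setT g -> (forall x, 0 <= g x)%R ->
   measurable_fun [set: measurableTypeR R] (fun r : R => \int[mu]_(y in ball1) (g (r *: normalize y)%R)%:E).
  move=> mg g0.
  have mg2 : measurable_fun setT (fun p : measurableTypeR R * V => (g (p.1 *: normalize p.2)%R)%:E).
    apply/measurable_EFinP; apply: (measurableT_comp mg); apply: measurable_fun_rVP => i.
    under eq_fun do rewrite mxE.
    apply: measurable_funM => //; apply: measurableT_comp (@measurable_rV_coord R n i) _.
    exact: measurableT_comp (@measurable_normalize R n) measurable_snd.
  (* With the indicator of the ball as weight, measurability in [r] becomes that of a partial
     integral in Tonelli's theorem. *)
  rewrite (_ : (fun r : R => _) = fun r : R => wint mu (\1_ball1) (fun y => (g (r *: normalize y)%R)%:E)).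
    apply: (@measurable_wint_comp _ _ _ mu (\1_ball1) _ _ _ (measurableTypeR R)
      (fun r y => (g (r *: normalize y)%R)%:E)) => //.
    by move=> r y; rewrite lee_fin.
  apply/funext => r; rewrite integral_mkcond; apply: eq_integral => y _.
  by rewrite patchE indicE; case: (_ \in _); rewrite ?mul1e ?mul0e.
have mr : measurable_fun [set: measurableTypeR R] (fun r : R => (n%:R * r ^+ n.-1)%:E).
  by apply/measurable_EFinP; apply: measurable_funM => //; exact: measurable_funX.
have r_ge0 (r : R) : `]0%R, +oo[%classic r -> (0 < r)%R by rewrite /= in_itv/= andbT.
rewrite -ge0_integralZl//; first last.
- move=> r /r_ge0 r0; apply: mule_ge0; first by rewrite lee_fin mulr_ge0// exprn_ge0// ltW.
  by apply: integral_ge0 => y _; rewrite lee_fin.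
- by apply: measurable_funTS; apply: emeasurable_funM => //; exact: pol.
apply: ge0_le_integral => //.
- move=> r /r_ge0 r0; apply: mule_ge0; first by rewrite lee_fin.
  apply: mule_ge0; first by rewrite lee_fin mulr_ge0// exprn_ge0// ltW.
  by apply: integral_ge0 => y _; rewrite lee_fin.
- apply: measurable_funTS; apply: emeasurable_funM => //; apply: emeasurable_funM => //.
  exact: pol.
- by apply: measurable_funTS; apply: emeasurable_funM => //; exact: pol.
- move=> r /r_ge0 r0; rewrite muleCA; apply: lee_wpmul2l; last exact: shell_le.
  by rewrite lee_fin mulr_ge0// exprn_ge0// ltW.
Qed.

End global_poincare.

(** * The inequality for real-valued functions *)

Section rellich_real.
Context {R : realType} {n : nat}.
Hypothesis n2 : (2 <= n)%N.
Notation V := 'rV[R]_n.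
Notation w := (@w R n).
Variable f : V -> R.
Hypothesis Af : forall k, An k f.

Let u (x : V) : R := f x - rproj f x.

(** Subtracting the projection changes nothing, by [rproj_Lam]. *)
Lemma B_compl_Lam : B u (Lam f) = T f f.
Proof.
have n0 : (0 < n)%N by exact: ltnW.
have ML : MB (Lam f) by exact: (MB_An (An_Lam (Af 2))).
have Mf : MB f by exact: (MB_An (Af 0)).
have Mr := MB_rproj n0 (Af 0).
rewrite -(B_Lam_T Af) -[RHS]subr0 -[X in _ - X](rproj_Lam n0 (Af 2)).
rewrite /B -(MB_I_sub (MB_w (MB_mul Mf ML)) (MB_w (MB_mul Mr ML))).
by congr I; apply/funext => x; rewrite /u mulrBl mulrBr.
Qed.

Lemma B_compl_sqr (s : R) :
  0 <= B (Lam f) (Lam f) - 2 * s * B u (Lam f) + s ^+ 2 * B u u.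
Proof.
have ML : MB (Lam f) by exact: (MB_An (An_Lam (Af 2))).
have Mu : MB u by exact: (MB_compl n2 (Af 2)).
have := B_ge0 (fun x => Lam f x - s * u x).
have M1 := MB_w (MB_mul ML ML); have M2 := MB_w (MB_mul Mu ML); have M3 := MB_w (MB_mul Mu Mu).
have -> : B (fun x => Lam f x - s * u x) (fun x => Lam f x - s * u x) =
    I (fun x => (w x * (Lam f x * Lam f x) - 2 * s * (w x * (u x * Lam f x)))
      + s ^+ 2 * (w x * (u x * u x))).
  congr I; apply/funext => x; move: (w x) (Lam f x) (u x) => a b c; ring.
rewrite (MB_I_add (MB_sub M1 (MB_scale (2 * s) M2)) (MB_scale (s ^+ 2) M3)).
rewrite (MB_I_sub M1 (MB_scale (2 * s) M2)).
by rewrite (MB_I_scale (2 * s) M2) (MB_I_scale (s ^+ 2) M3).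
Qed.

Lemma rellich_real : rellich_const R n ^+ 2 * B f f + rellich_const_compl R n * B u u
  <= I (fun x => Lap f x ^+ 2).
Proof.
have n2R : 2 <= n%:R :> R by rewrite ler_nat.
have core := rellich_core Af; have sq := B_compl_sqr (n%:R - 1).
have po := rproj_poincare n2 (Af 2); rewrite -/u in po.
rewrite (B_Lam_T Af) in core; rewrite B_compl_Lam in sq.
apply: le_trans core; rewrite /rellich_const_compl.
(* The sum is (n^2 - 4) / 4, nonnegative from dimension 2 on. *)
have sR : 0 <= n%:R - 1 + rellich_const R n.
  have -> : n%:R - 1 + rellich_const R n = (n%:R - 2) * (n%:R + 2) / 4.
    by rewrite /rellich_const; field.
  by rewrite divr_ge0// mulr_ge0 ?subr_ge0// addr_ge0.
move: (rellich_const R n) (B f f) (B u u) (T f f) (B (Lam f) (Lam f)) sR po sq => c X Y D Q.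
move: (n%:R - 1) => s sR po sq; clear -sR po sq.
have := mulr_ge0 sR (_ : 0 <= D - s * Y); rewrite subr_ge0 => /(_ po) h.
rewrite -subr_ge0.
(* With c for R and s = n - 1, the gap is the square of Lam f - s u plus a nonnegative multiple of
   the Poincare defect D - s Y; the coefficient of Y is (s + c)^2 - c^2. *)
have -> : c ^+ 2 * X + 2 * c * D + Q - (c ^+ 2 * X + s * (s + 2 * c) * Y) =
  (Q - 2 * s * D + s ^+ 2 * Y) + 2 * ((s + c) * (D - s * Y)) by ring.
by rewrite addr_ge0// mulr_ge0.
Qed.

End rellich_real.

(** * Complex-valued functions and the final inequality *)

Section complex_norms.
Context {R : realType} {n : nat}.
Notation V := 'rV[R]_n.
Notation mu := (@lebesgue_rV R n).
Notation w := (@w R n).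
Implicit Types f g : V -> R[i].

(** An identity in the extended reals: the square undoes the root also when the norm is infinite. *)
Lemma L2norm_sqr g : (L2norm g ^+ 2 =
  \int[mu]_x (complex.Re (g x) ^+ 2 + complex.Im (g x) ^+ 2)%:E)%E.
Proof.
have sqE (x : \bar R) : (0 <= x -> x ^+ 2 = x `^ 2)%E.
  case: x => [r||] x0; last by [].
    by rewrite poweR_EFin powR_mulrn// EFin_expe.
  by rewrite poweRyr// expe2 mulyy.
rewrite /L2norm sqE ?Lnorm_ge0// powR_Lnorm//; apply: eq_integral => x _.
rewrite -[X in (X `^ 2)%E]/(`|Normc.normc (g x)|%:E) poweR_EFin powR_mulrn//.
rewrite real_normK ?num_real//; congr (_%:E).
by case: (g x) => a b /=; rewrite sqr_sqrtr// addr_ge0// sqr_ge0.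
Qed.

Lemma div_sqnorm_sqr g x : complex.Re (div_sqnorm g x) ^+ 2 + complex.Im (div_sqnorm g x) ^+ 2 =
  w x * (complex.Re (g x) * complex.Re (g x)) + w x * (complex.Im (g x) * complex.Im (g x)).
Proof.
rewrite /div_sqnorm -fmorphV w_enorm -[4%N]/(2 * 2)%N exprM.
case: (g x) => a b /=; rewrite !mulr0 subr0 add0r.
by rewrite !exprMn exprVn !expr2; ring.
Qed.

End complex_norms.

Section test_functions.
Context {R : realType} {n : nat}.
Notation V := 'rV[R]_n.
Variable f : V -> R[i].
Hypothesis f_test : test_function_away0 f.

(** The outer radius comes from compactness of the support, the inner one from a neighbourhood of 0
    that misses it. *)
Lemma csupport_annulus : exists ab : R * R, 0 < ab.1 /\ forall x, f x != 0 -> ab.1 <= enorm x <= ab.2.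
Proof.
have [_ _ cK K0] := f_test.
have fK x : f x != 0 -> csupport f x by move=> fx; exact: subset_closure.
have [b fb] : exists b : R, forall x, f x != 0 -> enorm x <= b.
  have cE : compact (@enorm R n @` csupport f).
    by apply: continuous_compact => //; apply: continuous_subspaceT; exact: enorm_continuous.
  have [M [_ /(_ (M + 1)) h]] := compact_bounded cE.
  exists (M + 1) => x /fK Kx; apply: (le_trans (ler_norm _)); apply: h; first by rewrite ltrDl.
  by exists x.
have : nbhs (0 : V) (~` csupport f).
  by apply: open_nbhs_nbhs; split => //; exact/closed_openC/closed_closure.
move=> /nbhs_box[d d0 dK].
exists (d, b); split => // x fx /=; rewrite fb// andbT leNgt; apply/negP => xd.
apply: (dK x _ (fK _ fx)) => j.
by rewrite mxE subr0; exact: le_lt_trans (ler_enorm_coord x j) xd.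
Qed.

Lemma An_Re k : An k (fun x => complex.Re (f x)).
Proof.
have [sf _ _ _] := f_test; split; first exact: smooth_Ck.
have [ab [a0 fab]] := csupport_annulus; exists ab; split => // x Rx; apply: fab.
by apply: contraNneq Rx => ->.
Qed.

Lemma An_Im k : An k (fun x => complex.Im (f x)).
Proof.
have [_ sf _ _] := f_test; split; first exact: smooth_Ck.
have [ab [a0 fab]] := csupport_annulus; exists ab; split => // x Rx; apply: fab.
by apply: contraNneq Rx => ->.
Qed.

End test_functions.

Theorem theorem5 (R : realType) (n : nat) (n_ge2 : (2 <= n)%N)
    (f : 'rV[R]_n -> R[i]) (f_test : test_function_away0 f) :
  ((rellich_const R n ^+ 2)%:E * L2norm (div_sqnorm f) ^+ 2
   + (rellich_const_compl R n)%:E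
     * L2norm (div_sqnorm (radial_compl f)) ^+ 2
   <= L2norm (Laplacian f) ^+ 2)%E.
Proof.
(* All the operators are real, so every squared norm is the sum of those of the real and imaginary
   parts, and [rellich_real] applies to each of the two. *)
pose a x := complex.Re (f x); pose b x := complex.Im (f x).
have Aa k : An k a by exact: An_Re.
have Ab k : An k b by exact: An_Im.
have n0 : (0 < n)%N by exact: ltnW.
pose ua x := a x - rproj a x; pose ub x := b x - rproj b x.
have Mua : MB ua by exact: (MB_compl n_ge2 (Aa 2)).
have Mub : MB ub by exact: (MB_compl n_ge2 (Ab 2)).
have sqM (g h : 'rV[R]_n -> R) : MB g -> MB h ->
    (\int[lebesgue_rV n]_x (w x * (g x * g x) + w x * (h x * h x))%:E = (B g g + B h h)%:E)%E.
  move=> Mg Mh; have M1 := MB_w (MB_mul Mg Mg); have M2 := MB_w (MB_mul Mh Mh).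
  by rewrite (MB_EFin_I (MB_add M1 M2)) (MB_I_add M1 M2).
rewrite !L2norm_sqr.
under eq_integral do rewrite div_sqnorm_sqr.
rewrite (sqM a b (MB_An (Aa 0%N)) (MB_An (Ab 0%N))).
have -> : (\int[lebesgue_rV n]_x
    (complex.Re (div_sqnorm (radial_compl f) x) ^+ 2 + complex.Im (div_sqnorm (radial_compl f) x) ^+ 2)%:E
    = (B ua ua + B ub ub)%:E)%E.
  rewrite -(sqM ua ub Mua Mub); apply: eq_integral => x _; rewrite div_sqnorm_sqr.
  have [ma [Ma aM] _] := MB_An (Aa 0%N); have [mb [Mb bM] _] := MB_An (Ab 0%N).
  have Ra : complex.Re (radial_compl f x) = ua x.
    by rewrite /ua -(radial_proj_Re n0 x ma aM) /radial_compl; rewrite /a; case: (f x) (radial_proj f x) => ? ? [? ?].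
  have Rb : complex.Im (radial_compl f x) = ub x.
    by rewrite /ub -(radial_proj_Im n0 x mb bM) /radial_compl /b; case: (f x) (radial_proj f x) => ? ? [? ?].
  by rewrite Ra Rb.
have -> : (\int[lebesgue_rV n]_x
    (complex.Re (Laplacian f x) ^+ 2 + complex.Im (Laplacian f x) ^+ 2)%:E
    = (I (fun x => Lap a x ^+ 2) + I (fun x => Lap b x ^+ 2))%:E)%E.
  have ML (g : 'rV[R]_n -> R) : (forall k, An k g) -> MB (fun x => Lap g x ^+ 2).
    by move=> Ag; have M := MB_An (An_Lap (Ag 2)); exact: (MB_mul M M).
  by rewrite -(MB_I_add (ML _ Aa) (ML _ Ab)) -(MB_EFin_I (MB_add (ML _ Aa) (ML _ Ab))).
rewrite -!EFinM -EFinD lee_fin !mulrDr addrACA.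
by apply: lerD; [exact (rellich_real n_ge2 Aa)|exact (rellich_real n_ge2 Ab)].
Qed.
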